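(* Let $(X,s)$ be a minimal dynamical system. The following conditions are equivalent: (i) The system $(X,s)$ is a $\mathcal{W}$-system. (ii) The system $(X,s)$ is a factor of $(\mathcal{H},T)$. (iii) There exists a point $x\in X$ such that $\omega_x\mathcal{C}(X)\subseteq\mathcal{W}$. (iv) For every point $x\in X$, we have $\omega_x\mathcal{C}(X)\subseteq\mathcal{W}$. If $(X,s)$ is a dynamical system, not necessarily minimal, then (i), (iv) and the following condition are equivalent: (v) The system $(X,s)$ is distal, and its minimal subsystems are $\mathcal{W}$-systems.
   Context: A dynamical system is a pair $(X,s)$ with $X$ a compact Hausdorff space and $s:X\to X$ a homeomorphism; it is minimal if every orbit $\{s^nx:n\in\mathbb{Z}\}$ is dense. A subsystem is $(Y,s|_Y)$ with $Y\subseteq X$ non-empty, closed and $s(Y)=Y$. $(Y,t)$ is a factor of $(X,s)$ if there is a continuous surjection $\pi:X\to Y$ with $\pi\circ s=t\circ\pi$. The enveloping semigroup $E(X,s)$ is the closure of $\{s^n:n\in\mathbb{Z}\}$ in the product space $X^X$; $(X,s)$ is distal if every member of $E(X,s)$ is injective; $(E(X,s),\lambda_s)$ is the dynamical system with $\lambda_s(a)=s\circ a$. $\mathbb{T}$ is the unit circle in $\mathbb{C}$; $\mathcal{C}(X)$ is the algebra of continuous complex functions on $X$ (supremum norm); $\mathcal{C}(X,\mathbb{T})$ the multiplicative group of continuous functions $X\to\mathbb{T}$; $s^*f=f\circ s$. Let $G_0(X,s)$ be the constant functions $X\to\mathbb{T}$, $G_{m+1}(X,s)=\{g\in\mathcal{C}(X,\mathbb{T}):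 s^*g=fg\text{ for some }f\in G_m(X,s)\}$, $G(X,s)=\bigcup_{m\ge0}G_m(X,s)$. $(X,s)$ has (topological) quasi-discrete spectrum if the linear span of $G(X,s)$ is dense in $\mathcal{C}(X)$. $(X,s)$ is a $\mathcal{W}$-system if $(E(X,s),\lambda_s)$ has quasi-discrete spectrum. For $x\in X$, $\omega_x:\mathcal{C}(X)\to l^\infty(\mathbb{Z})$ is $\omega_x(f)(n)=f(s^nx)$. $\mathcal{W}$ is the smallest closed linear subspace of $l^\infty(\mathbb{Z})$ containing all functions $n\mapsto e^{i2\pi p(n)}$, $p:\mathbb{Z}\to\mathbb{R}$ a polynomial (real coefficients). $\mathbb{N}=\{1,2,\ldots\}$, $\mathbb{Z}_+=\{0,1,\ldots\}$; $\mathbb{T}_Q=\{e^{i2\pi q}:q\in\mathbb{Q}\}$. $H(\mathbb{T})$ is the set of all (not necessarily continuous) group homomorphisms $\mathbb{T}\to\mathbb{T}$, with pointwise multiplication and the topology of pointwise convergence. $\phi^{(j)}$ denotes the $j$-fold composition of $\phi$ with itself; $s(k,j)$ are the (signed) Stirling numbers of the first kind: $n(n-1)\cdots(n-k+1)=\sum_{j=0}^k s(k,j)n^j$. $\mathcal{H}$ is the set of all $(\phi_k)_{k=0}^\infty\in H(\mathbb{T})^{\mathbb{Z}_+}$ with $\phi_0=\mathrm{id}_{\mathbb{T}}$ and $\phi_k(x^{k!})=\prod_{j=1}^k\phi_1^{(j)}(x^{s(k,j)})$ for all $x\in\mathbb{T}_Q$, $k\in\mathbb{N}$, a compact space in the subspace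 topology of the product. $T:\mathcal{H}\to\mathcal{H}$ is the homeomorphism $T(\phi_0,\phi_1,\phi_2,\ldots)=(\phi_0,\phi_0\phi_1,\phi_1\phi_2,\ldots)$ (pointwise products). *)

(* Defs.v *)
From HB Require Import structures.
From mathcomp Require Import all_boot all_order all_algebra complex.
From mathcomp Require Import all_classical all_reals all_analysis.

Set Implicit Arguments.
Unset Strict Implicit.
Unset Printing Implicit Defensive.

Import Order.TTheory GRing.Theory Num.Theory numFieldNormedType.Exports.
Local Open Scope classical_set_scope.
Local Open Scope ring_scope.

(* R[i] at the type on which the canonical topology of a numClosedFieldType
   is found. *)
Definition Cplx (R : realType) : numClosedFieldType := R[i].

Definition circle (R : realType) : Type := [set z : Cplx R | `|z| = 1].

HB.instance Definition _ (R : realType) :=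
  Topological.copy (circle R) [set z : Cplx R | `|z| = 1].

Definition cval (R : realType) (z : circle R) : Cplx R := set_val z.

Section CircleGroup.
Variable R : realType.
Implicit Types x y z : circle R.

Lemma cval_inj : injective (@cval R).
Proof. exact: val_inj. Qed.

Lemma cval_norm x : `|cval x| = 1.
Proof. by case: x => z hz; exact: (set_mem hz). Qed.

Definition mkcircle (z : Cplx R) (hz : `|z| = 1) : circle R :=
  exist _ z (mem_set hz).

Lemma cmul_norm x y : `|cval x * cval y| = 1.
Proof. by rewrite normrM !cval_norm mulr1. Qed.

Lemma cinv_norm x : `|(cval x)^-1| = 1.
Proof. by rewrite normfV cval_norm invr1. Qed.

Definition cmul x y := mkcircle (cmul_norm x y).
Definition cinv x := mkcircle (cinv_norm x).
Definition cone := mkcircle (normr1 (Cplx R)).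

Lemma cval_neq0 x : cval x != 0.
Proof. by rewrite -normr_eq0 cval_norm oner_neq0. Qed.

Lemma cmulA : associative cmul.
Proof. by move=> x y z; apply: cval_inj; exact: mulrA. Qed.

Lemma cmul1x : left_id cone cmul.
Proof. by move=> x; apply: cval_inj; exact: mul1r. Qed.

Lemma cmulx1 : right_id cone cmul.
Proof. by move=> x; apply: cval_inj; exact: mulr1. Qed.

Lemma cmulVx : left_inverse cone cinv cmul.
Proof. by move=> x; apply: cval_inj; exact: (mulVf (cval_neq0 x)). Qed.

Lemma cmulxV : right_inverse cone cinv cmul.
Proof. by move=> x; apply: cval_inj; exact: (mulfV (cval_neq0 x)). Qed.

HB.instance Definition _ :=
  isGroup.Build (circle R) cmulA cmul1x cmulx1 cmulVx cmulxV.

Lemma cvalM x y : cval (x * y)%g = cval x * cval y.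
Proof. by []. Qed.

Lemma cvalV x : cval x^-1%g = (cval x)^-1.
Proof. by []. Qed.

Lemma cval1 : cval (1%g : circle R) = 1.
Proof. by []. Qed.

Lemma circle_mulC : commutative (fun x y => x * y)%g.
Proof. by move=> x y; apply: cval_inj; rewrite !cvalM mulrC. Qed.

Lemma expi_norm (r : R) :
  `|(cos (2 * pi * r) +i* sin (2 * pi * r))%C : Cplx R| = 1.
Proof. by rewrite normc_def /= cos2Dsin2 sqrtr1. Qed.

(* expi r is exp(2 pi i r). *)
Definition expi (r : R) : circle R := mkcircle (expi_norm r).

Lemma cval_expi (r : R) :
  cval (expi r) = (cos (2 * pi * r) +i* sin (2 * pi * r))%C.
Proof. by []. Qed.

Lemma expi0 : expi 0 = 1%g.
Proof. by apply: cval_inj; rewrite cval_expi mulr0 cos0 sin0. Qed.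

Lemma expiD (a b : R) : expi (a + b) = (expi a * expi b)%g.
Proof.
apply: cval_inj; rewrite cvalM !cval_expi mulrDr cosD sinD.
by congr (_ +i* _)%C; rewrite addrC.
Qed.

End CircleGroup.

Definition expgz (G : groupType) (x : G) (n : int) : G :=
  match n with Posz m => (x ^+ m)%g | Negz m => (x ^- m.+1)%g end.

Record homeo (X : topologicalType) := Homeo {
  hfun :> X -> X;
  hinv : X -> X;
  hfunK : cancel hfun hinv;
  hinvK : cancel hinv hfun;
  hfun_continuous : continuous hfun;
  hinv_continuous : continuous hinv }.

(* Negz m is the integer -(m + 1). *)
Definition iterz (X : topologicalType) (s : homeo X) (n : int) : X -> X :=
  match n with
  | Posz m => iter m s
  | Negz m => iter m.+1 (hinv s)
  end.

(* Nonemptiness excludes the empty system, whose orbits are vacuously dense. *)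
Definition minimal (X : topologicalType) (s : homeo X) : Prop :=
  [set: X] !=set0 /\ forall x : X, dense (range (fun n : int => iterz s n x)).

Definition is_subsystem (X : topologicalType) (s : homeo X) (Y : set X) :=
  [/\ Y !=set0, closed Y & s @` Y = Y].

Section Restriction.
Variables (X : topologicalType) (s : homeo X) (Y : set X).
Hypothesis sY : s @` Y = Y.

Lemma restr_funP (y : Y) : Y (s (set_val y)).
Proof.
suff : (s @` Y) (s (set_val y)) by rewrite sY.
by exists (set_val y) => //; exact: set_valP.
Qed.

Lemma restr_invP (y : Y) : Y (hinv s (set_val y)).
Proof.
have : (s @` Y) (set_val y) by rewrite sY; exact: set_valP.
by move=> [x Yx <-]; rewrite hfunK.
Qed.

Definition restr_fun (y : Y) : Y := exist _ (s (set_val y)) (mem_set (restr_funP y)).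
Definition restr_inv (y : Y) : Y := exist _ (hinv s (set_val y)) (mem_set (restr_invP y)).

Lemma restr_funK : cancel restr_fun restr_inv.
Proof. by move=> y; apply: val_inj; exact: hfunK. Qed.

Lemma restr_invK : cancel restr_inv restr_fun.
Proof. by move=> y; apply: val_inj; exact: hinvK. Qed.

Lemma restr_fun_continuous : continuous restr_fun.
Proof.
apply: continuous_comp_initial => y.
apply: (@continuous_comp _ _ _ (set_val : Y -> X) s).
  exact: initial_continuous.
exact: hfun_continuous.
Qed.

Lemma restr_inv_continuous : continuous restr_inv.
Proof.
apply: continuous_comp_initial => y.
apply: (@continuous_comp _ _ _ (set_val : Y -> X) (hinv s)).
  exact: initial_continuous.
exact: hinv_continuous.
Qed.

Definition restr : homeo Y :=
  Homeo restr_funK restr_invK restr_fun_continuous restr_inv_continuous.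

End Restriction.

Definition subsystem_map (X : topologicalType) (s : homeo X) (Y : set X)
  (hY : is_subsystem s Y) : homeo Y := restr (let: And3 _ _ h := hY in h).

(* The second system, (Y, t), is a factor of the first, (X, s). *)
Definition is_factor (X Y : topologicalType) (s : X -> X) (t : Y -> Y) :=
  exists p : X -> Y,
    [/\ continuous p, range p = [set: Y] & forall x, p (s x) = t (p x)].

Section Enveloping.
Variables (X : topologicalType) (s : homeo X).

Definition env_semigroup : set {ptws X -> X} :=
  closure (range (iterz s) : set {ptws X -> X}).

Definition distal := forall a, env_semigroup a -> injective a.

Lemma iterzS (n : int) : exists m, s \o iterz s n = iterz s m.
Proof.
case: n => [n|[|n]]; first by exists n.+1%N%:Z.
  by exists 0%:Z; apply/funext => x /=; rewrite hinvK.
by exists (Negz n); apply/funext => x /=; rewrite hinvK.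
Qed.

Lemma postcomp_continuous :
  continuous (fun a : {ptws X -> X} => s \o a : {ptws X -> X}).
Proof.
pose ev x (b : forall _ : X, X) := b x.
have cx x : continuous
    ((fun b => s \o b) : {ptws X -> X} -> initial_topology (ev x)).
  apply: continuous_comp_initial => b.
  apply: (@continuous_comp {ptws X -> X} X X (ev x) s).
    exact: (@proj_continuous X (fun=> X) x).
  exact: hfun_continuous.
move=> a; have FF : Filter ((fun b : {ptws X -> X} => s \o b) @ a).
  by apply: fmap_filter; exact: nbhs_filter.
by apply/cvg_sup => x; exact: cx.
Qed.

Lemma lambda_subproof (a : env_semigroup) :
  env_semigroup (s \o (set_val a : X -> X)).
Proof.
have ca : env_semigroup (set_val a) by exact: set_valP.
move=> U /postcomp_continuous/ca[_ [[n _ <-] Usn]].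
have [m sm] := iterzS n.
by exists (iterz s m); split; [exists m | rewrite -sm].
Qed.

Definition lambda (a : env_semigroup) : env_semigroup :=
  exist _ (s \o (set_val a : X -> X)) (mem_set (@lambda_subproof a)).

End Enveloping.

Definition is_subspace (R : realType) (U : Type) (V : set (U -> Cplx R)) :=
  V (fun=> 0) /\
  forall (a : Cplx R) f g, V f -> V g -> V (fun u => a * f u + g u).

Definition lin_span (R : realType) (U : Type) (A : set (U -> Cplx R)) :=
  smallest (@is_subspace R U) A.

Section QuasiDiscrete.
Variables (R : realType) (X : topologicalType) (s : X -> X).

Fixpoint qeigen (m : nat) : set (X -> circle R) :=
  match m with
  | 0%N => range (fun (c : circle R) (_ : X) => c)
  | k.+1 => [set g | continuous g /\
               exists2 f, qeigen k f & forall x, g (s x) = (f x * g x)%g]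
  end.

Definition qeigen_all : set (X -> circle R) := \bigcup_m qeigen m.

(* The topology of {uniform X -> Cplx R} is that of the supremum norm. *)
Definition quasi_discrete_spectrum :=
  [set f : X -> Cplx R | continuous f] `<=`
  closure (lin_span [set (@cval R) \o g | g in qeigen_all]
             : set {uniform X -> Cplx R}).

End QuasiDiscrete.

Definition W_system (R : realType) (X : topologicalType) (s : homeo X) :=
  quasi_discrete_spectrum R (@lambda X s).

Definition omega (R : realType) (X : topologicalType) (s : homeo X) (x : X)
  (f : X -> Cplx R) : int -> Cplx R := fun n => f (iterz s n x).

Definition linfty (R : realType) : set (int -> Cplx R) :=
  [set u | exists M : R, forall n, `|u n| <= M%:C%C].

(* linfty is closed in {uniform int -> Cplx R}, and the topology it inherits
   from it is that of its norm. *)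
Definition calW (R : realType) : set (int -> Cplx R) :=
  smallest
    [set V | [/\ V `<=` @linfty R, is_subspace V
               & closed (V : set {uniform int -> Cplx R})]]
    [set u | exists p : {poly R}, u = fun n => cval (expi p.[n%:~R])].

Definition falling (k : nat) : {poly int} := \prod_(i < k) ('X - (i%:Z)%:P).

Definition stirling1 (k j : nat) : int := (falling k)`_j.

Definition TQ (R : realType) : set (circle R) :=
  range (fun q : rat => expi (ratr q)).

Definition homT (R : realType) : set (circle R -> circle R) :=
  [set f : circle R -> circle R | {morph f : x y / (x * y)%g}].

Definition calH (R : realType) :
    set {ptws nat -> {ptws circle R -> circle R}} :=
  [set phi | [/\ forall k, homT (phi k), phi 0%N = id
    & forall (x : circle R) (k : nat), TQ x -> (0 < k)%N ->
        phi k (x ^+ k`!)%g =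
        (\prod_(1 <= j < k.+1)
           iter j (phi 1%N) (expgz x (stirling1 k j)))%g]].

Section TMap.
Variable R : realType.
Implicit Types (x y : circle R) (f g : circle R -> circle R) (p q : {poly int}).

HB.instance Definition _ := Monoid.isComLaw.Build (circle R) 1%g *%g
  (@cmulA R) (@circle_mulC R) (@cmul1x R).

Lemma cvalX x (n : nat) : cval (x ^+ n)%g = cval x ^+ n.
Proof. by elim: n => [|n IH] //; rewrite expgS exprS cvalM IH. Qed.

Lemma cval_expgz x (n : int) : cval (expgz x n) = cval x ^ n.
Proof. by case: n => n; rewrite /= ?cvalV cvalX. Qed.

Lemma expgzD x (m n : int) : expgz x (m + n) = (expgz x m * expgz x n)%g.
Proof. by apply: cval_inj; rewrite cvalM !cval_expgz expfzDr // cval_neq0. Qed.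

Lemma expgzM x (m n : int) : expgz x (m * n) = expgz (expgz x m) n.
Proof. by apply: cval_inj; rewrite !cval_expgz exprz_exp. Qed.

Lemma homT1 f : homT f -> f 1%g = 1%g.
Proof.
move=> hf; apply: cval_inj; apply: (mulfI (cval_neq0 (f 1%g))).
by rewrite -cvalM -hf mulg1 cval1 mulr1.
Qed.

Lemma homT_iter f n : homT f -> homT (iter n f).
Proof. by move=> hf; elim: n => [|n IH] x y //=; rewrite IH hf. Qed.

Lemma homTM f g : homT f -> homT g -> homT (fun x => f x * g x)%g.
Proof.
move=> hf hg x y; rewrite hf hg; apply: cval_inj.
by rewrite !cvalM mulrACA.
Qed.

Let actN f N (p : {poly int}) x : circle R :=
  (\prod_(0 <= i < N) iter i f (expgz x p`_i%R))%g.

Let act f (p : {poly int}) x := actN f (size p) p x.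

Let actE f N p x : homT f -> (size p <= N)%N -> act f p x = actN f N p x.
Proof.
move=> hf pN; have tail : (\prod_(size p <= i < N) iter i f (expgz x p`_i%R))%g = 1%g.
  rewrite big_nat big1 // => i /andP[pi _].
  by rewrite nth_default //; exact: homT1 (homT_iter _ hf).
by rewrite /act /actN [RHS](@big_cat_nat _ _ _ (size p)) //= tail mulg1.
Qed.

Let actD f p q x : homT f -> act f (p + q) x = (act f p x * act f q x)%g.
Proof.
move=> hf; pose N := maxn (size p) (size q).
rewrite !(@actE f N) ?leq_maxl ?leq_maxr ?size_polyD // /actN -big_split /=.
by apply: eq_bigr => i _; rewrite coefD expgzD (homT_iter i hf).
Qed.

Let actX f p x : homT f -> act f (p * 'X) x = f (act f p x).
Proof.
move=> hf; rewrite (@actE f (size p).+1) //; last first.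
  by rewrite (leq_trans (size_polyMleq _ _)) // size_polyX addn2.
rewrite /act /actN big_nat_recl // coefMX /= mul1g.
rewrite (big_morph f hf (homT1 hf)).
by apply: eq_bigr => i _; rewrite coefMX.
Qed.

Let actZ f c p x : homT f -> act f (c *: p) x = act f p (expgz x c).
Proof.
move=> hf; rewrite (@actE f (size p)) ?size_scale_leq // /act /actN.
by apply: eq_bigr => i _; rewrite coefZ expgzM.
Qed.

Let actC f c x : homT f -> act f c%:P x = expgz x c.
Proof.
move=> hf; rewrite (@actE f 1) ?size_polyC_leq1 //.
by rewrite /actN big_nat1 coefC.
Qed.

Let act_shift f p x : homT f ->
  act (fun y => y * f y)%g p x = act f (p \Po ('X + 1)) x.
Proof.
move=> hf; have hg : homT (fun y => y * f y)%g by exact: homTM.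
elim/poly_ind: p => [|p c IH].
  by rewrite comp_poly0 -[0]/(0%:P) !actC.
rewrite comp_poly_MXaddC mulrDr mulr1 !actD // !actX // !actC // IH.
by congr (_ * _)%g; exact: circle_mulC.
Qed.

Let falling_shift k :
  falling k.+1 \Po ('X + 1) = falling k.+1 + k.+1%:Z *: falling k.
Proof.
transitivity (('X + 1) * falling k).
  rewrite /falling big_ord_recl /= subr0 rmorphM /= comp_polyX.
  congr (_ * _); rewrite rmorph_prod; apply: eq_bigr => i _ /=.
  rewrite comp_polyB comp_polyX comp_polyC /bump /= addnC.
  by rewrite PoszD polyCD opprD addrACA addrN addr0.
rewrite /falling big_ord_recr /= -/(falling k) mulrC -mul_polyC.
rewrite [_%:P * _]mulrC -mulrDr; congr (_ * _).
by rewrite -addn1 PoszD polyCD addrA subrK.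
Qed.

Lemma TQX x n : TQ x -> TQ (x ^+ n)%g.
Proof.
move=> [q _ <-]; exists (n%:R * q) => //.
elim: n => [|n IH]; first by rewrite mul0r rmorph0 expi0.
by rewrite expgS -IH -expiD -rmorphD -natr1 mulrDl mul1r addrC.
Qed.

Definition Tseq (phi : nat -> circle R -> circle R) (k : nat) :
    circle R -> circle R :=
  match k with
  | 0%N => phi 0%N
  | j.+1 => fun x => (phi j x * phi j.+1 x)%g
  end.

Let sizef k : size (falling k) = k.+1.
Proof. by rewrite size_prod_XsubC /index_enum -enumT size_enum_ord. Qed.

Let stirlingE f k x : homT f -> (0 < k)%N ->
  (\prod_(1 <= j < k.+1) iter j f (expgz x (stirling1 k j)))%g =
  act f (falling k) x.
Proof.
case: k => // k hf _; rewrite /act sizef /actN [RHS]big_ltn //=.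
suff -> : (falling k.+1)`_0 = 0 by rewrite mul1g.
by rewrite /falling big_ord_recl /= subr0 coefXM.
Qed.

Lemma Tseq_calH phi : calH phi -> calH (Tseq phi).
Proof.
move=> [hphi phi0 phiS]; split => //.
  by case=> [|k] //=; exact: homTM.
move=> x [//|k] xQ _.
have h1 : Tseq phi 1%N = (fun y => y * phi 1%N y)%g by rewrite /= phi0.
have hact n y : TQ y -> phi n (y ^+ n`!)%g = act (phi 1%N) (falling n) y.
  case: n => [|n] yQ; last by rewrite phiS // stirlingE.
  by rewrite phi0 expg1 /falling big_ord0 -[1]/(1%:P) actC.
rewrite h1 stirlingE //; last exact: homTM.
rewrite act_shift // falling_shift actD // actZ // /= hact //.
rewrite factS expgnA hact; first exact: circle_mulC.
exact: TQX.
Qed.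

Definition Tmap (phi : @calH R) : @calH R :=
  exist _ (Tseq (set_val phi)) (mem_set (Tseq_calH (set_valP phi))).

End TMap.

(* Main.v *)
(* Call a map [Z -> T] of the form [n |-> exp (2 i pi p(n))] a phase.  An
   ultrafilter [U] on [Z] acts on phases by [u |-> (n |-> lim_U u(n + m))].  By
   Weyl's theorem and a recurrence argument, the operators so obtained are
   exactly the additive ones that commute with the shift, fix the constants and
   coincide with a power of the shift on torsion phases of bounded degree and
   order.  They form a group, and the values at [0] of such an operator on the
   phases [n |-> x ^ 'C(n, k)] are the coordinates of a point of [H].

   The functions in [W] are the uniform limits of linear combinations of phases,
   so under (iii) the limit of [s^n x] along [U] depends only on the operator of
   [U], that is, on a point of [H]; this gives the factor map in (ii).  Under
   (iv) the group acts on [X], and [s] is distal.  Let [K] be the kernel of this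
   action.  Averaging over powers of suitable elements of [K], the
   approximations of [n |-> f(s^n x)] may be taken to consist of phases fixed by
   [K].  These extend continuously to the enveloping semigroup, where they are
   generalized eigenfunctions, and (i) follows by the Stone-Weierstrass theorem.
   Finally, in a distal system the Ellis-Numakura lemma makes every orbit
   closure minimal, which reduces (iv) to the minimal case. *)

Require Import Defs.
From HB Require Import structures.
From mathcomp Require Import all_boot all_order all_algebra complex.
From mathcomp Require Import all_classical all_reals all_analysis.
From mathcomp Require Import ring lra zify.

Set Implicit Arguments.
Unset Strict Implicit.
Unset Printing Implicit Defensive.

Import Order.TTheory GRing.Theory Num.Theory numFieldNormedType.Exports.
Local Open Scope classical_set_scope.
Local Open Scope ring_scope.

(** A limit of translations has no evident inverse. Hence [good] is an algebraic definition, for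
    which inverses are found by induction on the degree; Weyl's theorem and recurrence then realize
    each such operator by an ultrafilter. Means are limits of Cesaro averages along an ultrafilter,
    so that they always exist.

    The main obstacle is the averaging over K, whose elements need not commute and for which no
    invariant measure is constructed. Only averages over the powers of a single element G are used,
    and they remove a phase u uniformly in n when G u = u + z with z a nonzero constant: the average
    is then a geometric sum. But an element of K may add to u a nonconstant phase. The remedy is to
    take commutators with the operators u + f(D^m u), where f is an endomorphism of the circle that
    vanishes on torsion, in general discontinuous. In degree at least 2 this asks for a leading
    coefficient of infinite order; a leading term with torsion coefficient is periodic and is
    expanded into characters, which lowers the degree. *)

(* The circle group in additive notation. *)
Definition acirc (R : realType) : Type := circle R.

HB.instance Definition _ (R : realType) := Topological.copy (acirc R) (circle R).

HB.instance Definition _ (R : realType) :=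
  GRing.isZmodule.Build (acirc R) (@cmulA R) (@circle_mulC R) (@cmul1x R)
    (@cmulVx R).

Definition aval (R : realType) (x : acirc R) : Cplx R := cval x.
Definition aexp (R : realType) (r : R) : acirc R := expi r.

(** * Ultrafilters and convergence *)

Lemma ultra_fmap (S T : Type) (f : S -> T) (U : set_system S) :
  UltraFilter U -> UltraFilter (f @ U).
Proof.
move=> UU; split; first exact: fmap_proper_filter.
move=> G GP sUG; apply/seteqP; split => B; last exact: sUG.
move=> GB; have [//|UB] := in_ultra_setVsetC (f @^-1` B) UU.
have /sUG GnB : (f @ U) (~` B) by [].
by have [x []] := @filter_ex _ G GP _ (filterI GB GnB).
Qed.

Lemma ultra_union (T : Type) (U : set_system T) (A B : set T) :
  UltraFilter U -> U (A `|` B) -> U A \/ U B.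
Proof.
move=> UU UAB; have [|UA] := in_ultra_setVsetC A UU; [by left|right].
by apply: filterS (filterI UAB UA) => x [[|]].
Qed.

Lemma ultra_bigcup (T : Type) (U : set_system T) (P : nat) (S : nat -> set T) :
  UltraFilter U -> (forall x, exists2 i, (i < P)%N & S i x) ->
  exists2 i, (i < P)%N & U (S i).
Proof.
move=> UU cov.
suff : forall Q, U [set x | exists2 i, (i < Q)%N & S i x] ->
    exists2 i, (i < Q)%N & U (S i).
  by apply; apply: filterS filterT => x _; exact: cov.
elim=> [|Q IH] UQ.
  by have /filter_ex[x [k]] := UQ; rewrite ltn0.
have : U ([set x | exists2 i, (i < Q)%N & S i x] `|` S Q).
  apply: filterS UQ => x [k]; rewrite ltnS leq_eqVlt => /orP[/eqP->|iQ] Six.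
    by right.
  by left; exists k.
move=> /ultra_union; case=> [/IH[i iQ USi]|USQ]; last by exists Q.
by exists i => //; exact: ltnW.
Qed.

Lemma ultra_compact (T : Type) (X : topologicalType) (U : set_system T)
  (u : T -> X) : UltraFilter U -> compact [set: X] -> exists x : X, u @ U --> x.
Proof.
move=> UU; rewrite compact_ultra => /(_ _ (ultra_fmap u UU)).
by case => [|x [_ ux]]; [exact: filterT | exists x].
Qed.

Lemma cvg_set_val (T : Type) (X : topologicalType) (A : set X)
    (F : set_system T) (f : T -> A) (y : A) : Filter F ->
  (fun t => set_val (f t)) @ F --> set_val y <-> f @ F --> y.
Proof.
move=> FF; split => [fy B [_ [[C oC <-] Cy] sB]|fy].
  have : nbhs (set_val y) C by exact: open_nbhs_nbhs.
  by move=> /fy FC; apply: (@filterS _ F FF _ _ _ FC) => t Ct; exact: sB.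
apply: (@cvg_comp _ _ _ f set_val _ (nbhs y)) => //.
exact: (@initial_continuous A X set_val).
Qed.

(** * The circle group and the exponential *)

Section Circle.
Variable R : realType.
Notation C := (Cplx R).
Notation A := (acirc R).
Implicit Types (x y : A) (z w : C).

Lemma avalD x y : aval (x + y) = aval x * aval y. Proof. by []. Qed.
Lemma avalN x : aval (- x) = (aval x)^-1. Proof. by []. Qed.
Lemma aval0 : aval (0 : A) = 1. Proof. by []. Qed.
Lemma aval_norm x : `|aval x| = 1. Proof. exact: cval_norm. Qed.
Lemma aval_neq0 x : aval x != 0. Proof. exact: cval_neq0. Qed.
Lemma aval_inj : injective (@aval R). Proof. exact: cval_inj. Qed.

Lemma avalB x y : aval (x - y) = aval x / aval y. Proof. by []. Qed.

Lemma avalMn x n : aval (x *+ n) = aval x ^+ n.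
Proof. by elim: n => [|n IH] //; rewrite mulrS avalD IH exprS. Qed.

Lemma aval_sum (I : Type) (r : seq I) (P : pred I) (F : I -> A) :
  aval (\sum_(i <- r | P i) F i) = \prod_(i <- r | P i) aval (F i).
Proof. exact: (big_morph _ avalD aval0). Qed.

Lemma cvg_aval (T : Type) (F : set_system T) (u : T -> A) x : Filter F ->
  (fun t => aval (u t)) @ F --> aval x <-> u @ F --> x.
Proof. by move=> FF; exact: (@cvg_set_val T C [set z | `|z| = 1] F u x). Qed.

Lemma cvgC_dist (T : Type) (F : set_system T) (f : T -> C) z : Filter F ->
  f @ F --> z <-> forall e : C, 0 < e -> \forall t \near F, `|f t - z| <= e.
Proof.
move=> FF; split => [/cvgrPdist_le fz e e0|fz].
  by near do rewrite distrC; exact: fz.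
apply/cvgrPdist_le => e e0; have := fz e e0.
by apply: filterS => t; rewrite distrC.
Unshelve. all: by end_near. Qed.

Lemma cvgC_unique (T : Type) (F : set_system T) {FF : ProperFilter F}
  (f : T -> C) z w : f @ F --> z -> f @ F --> w -> z = w.
Proof. by apply: cvg_unique; exact: norm_hausdorff. Qed.

Lemma cvgR_unique (T : Type) (F : set_system T) {FF : ProperFilter F}
  (f : T -> R) (a b : R) : f @ F --> a -> f @ F --> b -> a = b.
Proof. by apply: cvg_unique; exact: norm_hausdorff. Qed.

Lemma circ_hausdorff : hausdorff_space A.
Proof.
move=> x y xy; apply: aval_inj; apply: (@norm_hausdorff _ C) => P Q Px Qy.
have cv (z : A) : {for z, continuous (@aval R)}.
  by apply/(@cvg_aval _ (nbhs z) id z).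
have [z [Pz Qz]] := xy _ _ (cv x _ Px) (cv y _ Qy).
by exists (aval z).
Qed.

Lemma cvgA_unique (T : Type) (F : set_system T) {FF : ProperFilter F}
  (f : T -> A) x y : f @ F --> x -> f @ F --> y -> x = y.
Proof. by apply: cvg_unique; exact: circ_hausdorff. Qed.

Lemma le_real_normc (a b : R) : `|(a +i* b)%C : C| <= (`|a| + `|b|)%:C%C.
Proof.
have -> : (a +i* b)%C = a%:C%C + 'i%C * b%:C%C :> C by exact: (complexE (a +i* b)%C).
have nR (r : R) : `|r%:C%C : C| = `|r|%:C%C.
  by rewrite normc_def /= expr0n /= addr0 sqrtr_sqr.
apply: (le_trans (ler_normD _ _)); rewrite normrM !nR rmorphD lerD2l.
by rewrite normc_def /= expr0n expr1n add0r sqrtr1 mul1r.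
Qed.

Lemma normc_ge_Im (z : C) : `|complex.Im z|%:C%C <= `|z|.
Proof.
have := @normc_ge_Re R (z * 'i%C).
by rewrite ReiNIm normrN normrM [`|'i%C|]normc_def /= expr0n expr1n add0r sqrtr1 mulr1.
Qed.

Lemma cvgC_complex (T : Type) (F : set_system T) (f : T -> C) (a b : R) :
  Filter F -> (fun t => complex.Re (f t)) @ F --> a ->
  (fun t => complex.Im (f t)) @ F --> b -> f @ F --> ((a +i* b)%C : C).
Proof.
move=> FF fa fb.
apply/cvgC_dist => e e0.
have [d ed] : exists d, e = d%:C%C by apply/complex_realP; exact: gtr0_real.
have d0 : 0 < d / 2 by rewrite divr_gt0 // -ltcR -ed.
move/cvgrPdist_le : fa => /(_ _ d0) fa; move/cvgrPdist_le : fb => /(_ _ d0) fb.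
near=> t; rewrite ed.
have -> : f t - (a +i* b)%C
    = ((complex.Re (f t) - a) +i* (complex.Im (f t) - b))%C by case: (f t).
apply: (le_trans (le_real_normc _ _)); rewrite lecR [d]splitr distrC lerD //.
  by near: t.
by rewrite distrC; near: t.
Unshelve. all: by end_near. Qed.

Lemma ultra_bounded (T : Type) (U : set_system T) (f : T -> C) (M : R) :
  UltraFilter U -> (forall t, `|f t| <= M%:C%C) -> exists z : C, f @ U --> z.
Proof.
move=> UU fM.
have bnd (p : C -> R) : (forall z, `|p z|%:C%C <= `|z|) ->
    exists r : R, p \o f @ U --> r.
  move=> pz; have := @segment_compact R (- M) M.
  rewrite compact_ultra => /(_ _ (ultra_fmap (p \o f) UU)).
  case => [|r [_ pr]]; last by exists r.
  apply: (@filterS _ U _ setT _ _ filterT) => t _ /=; rewrite /= in_itv /= -ler_norml -lecR.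
  exact: le_trans (pz _) (fM _).
have [a fa] := bnd (@complex.Re R) (@normc_ge_Re R).
have [b fb] := bnd (@complex.Im R) normc_ge_Im.
by exists (a +i* b)%C; exact: cvgC_complex.
Qed.

Lemma ultra_acirc (T : Type) (U : set_system T) (u : T -> A) :
  UltraFilter U -> exists x : A, u @ U --> x.
Proof.
move=> UU.
have [t|z uz] := @ultra_bounded T U (fun t => aval (u t)) 1 UU.
  by rewrite aval_norm lexx.
have z1 : `|z| = 1.
  apply: (@cvgC_unique _ U _ (fun t => `|aval (u t)|)); first exact: cvg_norm.
  rewrite (_ : (fun t => _) = (fun=> 1)); first exact: cvg_cst.
  by apply/funext => t; rewrite aval_norm.
by exists (mkcircle z1); apply/cvg_aval.
Qed.

Lemma circ_compact : compact [set: A].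
Proof.
rewrite compact_ultra => U UU _.
by have [x Ux] := @ultra_acirc _ U id UU; exists x.
Qed.

Lemma cvgCM (T : Type) (F : set_system T) {FF : Filter F} (f g : T -> C) z w :
  f @ F --> z -> g @ F --> w -> (fun t => f t * g t) @ F --> z * w.
Proof. exact: cvgM. Qed.

Lemma cvgCZ (T : Type) (F : set_system T) {FF : Filter F} (a : C) (f : T -> C) z :
  f @ F --> z -> (fun t => a * f t) @ F --> a * z.
Proof.
move=> fz; have ca : (fun=> a : C) @ F --> a by exact: cvg_cst.
exact: cvgCM ca fz.
Qed.

Lemma cvgCD (T : Type) (F : set_system T) {FF : Filter F} (f g : T -> C) z w :
  f @ F --> z -> g @ F --> w -> (fun t => f t + g t) @ F --> z + w.
Proof. exact: cvgD. Qed.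

Lemma cvgCV (T : Type) (F : set_system T) {FF : Filter F} (f : T -> C) z :
  z != 0 -> f @ F --> z -> (fun t => (f t)^-1) @ F --> z^-1.
Proof. by move=> z0; exact: cvgV. Qed.

Lemma cvgAD (T : Type) (F : set_system T) (u v : T -> A) x y : Filter F ->
  u @ F --> x -> v @ F --> y -> (fun t => u t + v t) @ F --> x + y.
Proof.
move=> FF /cvg_aval ux /cvg_aval vy; apply/cvg_aval.
have -> : (fun t => aval (u t + v t)) = (fun t => aval (u t) * aval (v t)) by [].
by rewrite avalD; apply: cvgCM.
Qed.

Lemma cvgAN (T : Type) (F : set_system T) (u : T -> A) x : Filter F ->
  u @ F --> x -> (fun t => - u t) @ F --> - x.
Proof.
move=> FF /cvg_aval ux; apply/cvg_aval.
have -> : (fun t => aval (- u t)) = (fun t => (aval (u t))^-1) by [].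
by rewrite avalN; apply: cvgCV => //; exact: aval_neq0.
Qed.

Lemma cvgAB (T : Type) (F : set_system T) (u v : T -> A) x y : Filter F ->
  u @ F --> x -> v @ F --> y -> (fun t => u t - v t) @ F --> x - y.
Proof. by move=> FF ux vy; apply: cvgAD => //; exact: cvgAN. Qed.

Lemma aexpD (a b : R) : aexp (a + b) = aexp a + aexp b.
Proof. exact: expiD. Qed.

Lemma aexp0 : aexp (0 : R) = 0.
Proof. exact: expi0. Qed.

Lemma aexpN (a : R) : aexp (- a) = - aexp a.
Proof. by apply/eqP; rewrite -addr_eq0 -aexpD addNr aexp0. Qed.

Lemma aexpMn (a : R) n : aexp (a *+ n) = aexp a *+ n.
Proof. by elim: n => [|n IH]; rewrite ?aexp0 // !mulrS aexpD IH. Qed.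

Lemma aexpMz (a : R) (n : int) : aexp (a *~ n) = aexp a *~ n.
Proof. by case: n => n; rewrite ?aexpN aexpMn. Qed.

Lemma aexp1 : aexp (1 : R) = 0.
Proof.
apply: cval_inj; rewrite cval_expi mulr1 mulr_natl -[pi *+ 2]add0r.
by rewrite cosD2pi sinD2pi cos0 sin0.
Qed.

Lemma aexp_int (n : int) : aexp (n%:~R : R) = 0.
Proof. by rewrite aexpMz aexp1 mul0rz. Qed.

(** For the fractional part d of r, cos (2 pi d) = 1 forces sin (pi d) = 0 by duplication, and sin
    is positive on ]0, pi[. *)
Lemma aexp_eq0 (r : R) : aexp r = 0 -> exists n : int, r = n%:~R.
Proof.
set n := Num.floor r; move=> r0; exists n; apply/eqP; rewrite -subr_eq0.
have d0 : 0 <= r - n%:~R by rewrite subr_ge0 Num.Theory.floor_le.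
have d1 : r - n%:~R < 1.
  by rewrite ltrBlDl -[1]/(1%:~R) -intrD; exact: Num.Theory.floorD1_gt.
have : aexp (r - n%:~R) = 0 by rewrite aexpD aexpN aexp_int oppr0 addr0.
move: (r - _) d0 d1 => d d0 d1 /(congr1 (@cval R)); rewrite cval_expi.
move=> /(congr1 (@complex.Re R)) /=; rewrite mulrAC -mulrA mulr_natl cos_mulr2n => h.
have c1 : cos (d * pi) ^+ 2 = 1 by move: h; lra.
have s0 : sin (d * pi) = 0.
  by apply/eqP; rewrite -sqrf_eq0 sin2cos2 c1 subrr.
move: d0; rewrite le_eqVlt eq_sym => /predU1P[-> //|d0].
have : 0 < sin (d * pi).
  by rewrite sin_gt0_pi// mulr_gt0 ?pi_gt0//= gtr_pMl ?pi_gt0.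
by rewrite s0 ltxx.
Qed.

Lemma aexp_surj x : exists r : R, x = aexp r.
Proof.
have := aval_norm x; case E: (aval x) => [a b]; rewrite normc_def /=.
move=> /(congr1 (@complex.Re R)) /= h.
have ab1 : a ^+ 2 + b ^+ 2 = 1.
  by rewrite -[LHS]sqr_sqrtr ?addr_ge0 ?sqr_ge0 // h expr1n.
have a1 : -1 <= a <= 1.
  rewrite -ler_norml -(@ler_pXn2r _ 2) ?nnegrE // expr1n real_normK ?num_real //.
  by rewrite -ab1 lerDl sqr_ge0.
have ca : cos (acos a) = a by rewrite acosK // in_itv.
have sa : sin (acos a) = `|b|.
  by rewrite sin_acos // -ab1 addrAC subrr add0r sqrtr_sqr.
have p2 : 2 * pi != 0 :> R by rewrite mulf_neq0 ?pnatr_eq0 // gt_eqF ?pi_gt0.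
have [b0|b0] := leP 0 b.
  exists (acos a / (2 * pi)); apply: cval_inj; rewrite cval_expi mulrC divfK //.
  by rewrite ca sa ger0_norm.
exists (- acos a / (2 * pi)); apply: cval_inj; rewrite cval_expi mulrC divfK //.
by rewrite cosN sinN ca sa ltr0_norm // opprK.
Qed.

Lemma aexp_root x (N : nat) : (0 < N)%N -> exists y, y *+ N = x.
Proof.
move=> N0; have [r ->] := aexp_surj x; exists (aexp (r / N%:R)).
by rewrite -aexpMn -[_ *+ N]mulr_natr divfK // pnatr_eq0 -lt0n.
Qed.

Lemma torsion_aexp x (N : nat) : (0 < N)%N -> x *+ N = 0 ->
  exists j : nat, x = aexp (N%:R^-1) *+ j.
Proof.
move=> N0; have [r ->] := aexp_surj x; rewrite -aexpMn => /aexp_eq0[n rn].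
have NR : N%:R != 0 :> R by rewrite pnatr_eq0 -lt0n.
have w0 : aexp (N%:R^-1 : R) *+ N = 0.
  by rewrite -aexpMn -[_ *+ N]mulr_natr mulVf // aexp1.
exists `|(n %% N)%Z|%N.
have -> : r = N%:R^-1 *~ n by rewrite -mulrzr -rn -[r *+ N]mulr_natr mulrCA mulVf ?mulr1.
rewrite aexpMz [in LHS](divz_eq n N) mulrzDr mulrzA.
rewrite mulrzAC -[_ *~ Posz N]/(_ *+ N) w0 mul0rz add0r.
have : (0 <= (n %% N)%Z)%R by rewrite modz_ge0 // eqz_nat -lt0n.
by case: (n %% N)%Z.
Qed.

End Circle.

(** * Polynomial phases *)

Lemma subrACA (V : zmodType) : @interchange V (fun x y => x - y) (fun x y => x - y).
Proof. by move=> x y z t; rewrite !opprD !opprK addrACA. Qed.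

Lemma int_dif_ext (V : zmodType) (f g : int -> V) : f 0 = g 0 ->
  (forall n, f (n + 1) - f n = g (n + 1) - g n) -> f =1 g.
Proof.
move=> fg0 fgS; elim/int_rec => [//|n IH|n IH].
  by have := fgS n; rewrite IH => /addIr; rewrite -PoszD addn1.
have e : - n.+1%:Z + 1 = - n%:Z by lia.
by have := fgS (- n.+1%:Z); rewrite e IH => /addrI /oppr_inj.
Qed.

(** The binomial coefficient at every integer n, extended to n = -(m + 1) by upper negation;
    Pascal's rule [binzS] then holds on all of Z. *)
Definition binz (n : int) (k : nat) : int :=
  match n with
  | Posz m => Posz 'C(m, k)
  | Negz m => (-1) ^+ k * Posz 'C(m + k, k)
  end.

Lemma binz0 n : binz n 0 = 1.
Proof. by case: n => n /=; rewrite ?mul1r ?addn0 bin0. Qed.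

Lemma binzS n k : binz (n + 1) k.+1 = binz n k.+1 + binz n k.
Proof.
case: n => [n|[|n]].
- by rewrite -PoszD addn1 /= binS PoszD.
- by rewrite /= !add0n !binn exprS !mulr1 mulN1r addNr bin0n.
have -> : Negz n.+1 + 1 = Negz n by rewrite !NegzE; lia.
rewrite /= !addSn !addnS [in RHS]binS PoszD exprS; ring.
Qed.

Section Phase.
Variable R : realType.
Notation C := (Cplx R).
Notation A := (acirc R).
Implicit Types (x y : A).

Definition dif (u : int -> A) : int -> A := fun n => u (n + 1) - u n.

Lemma iter_difB d (u v : int -> A) :
  iter d dif (u - v) = iter d dif u - iter d dif v.
Proof.
elim: d => //= d ->; apply/funext => n; rewrite /dif !fctE.
exact: subrACA.
Qed.

Lemma iter_dif0 d : iter d dif 0 = 0.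
Proof. by elim: d => //= d ->; apply/funext => n; rewrite /dif subrr. Qed.

Definition is_phase (u : int -> A) := `[< exists d, iter d dif u = 0 >].

Lemma is_phase_zmod_closed : zmod_closed is_phase.
Proof.
split; first by apply/asboolP; exists 0%N.
move=> u v /asboolP[d ud] /asboolP[e ve]; apply/asboolP; exists (d + e)%N.
rewrite iter_difB iterD [X in _ - X]iterD -!iterD addnC iterD ud addnC iterD ve.
by rewrite !iter_dif0 subrr.
Qed.

HB.instance Definition _ := GRing.isZmodClosed.Build (int -> A) is_phase
  is_phase_zmod_closed.

(* Polynomial phases: the maps [n |-> exp (2 i pi p(n))], [p] a real
   polynomial, described by the vanishing of an iterated difference. *)
Record phase := Phase { phase_fun :> int -> A; phaseP : is_phase phase_fun }.

Arguments phase_fun : simpl never.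

HB.instance Definition _ := [isSub for phase_fun].
HB.instance Definition _ := [Choice of phase by <:].
HB.instance Definition _ := [SubChoice_isSubZmodule of phase by <:].

Implicit Types u v w : phase.

Lemma phase_ext u v : u =1 v -> u = v.
Proof. by move=> uv; apply: val_inj; apply/funext. Qed.

Lemma phaseD u v n : (u + v) n = u n + v n. Proof. by []. Qed.
Lemma phaseN u n : (- u) n = - u n. Proof. by []. Qed.
Lemma phaseB u v n : (u - v) n = u n - v n. Proof. by []. Qed.
Lemma phase0 n : (0 : phase) n = 0. Proof. by []. Qed.
Lemma phaseMn u k n : (u *+ k) n = u n *+ k.
Proof. by elim: k => // k IH; rewrite !mulrS phaseD IH. Qed.
Lemma phase_sum (I : Type) (r : seq I) (P : pred I) (F : I -> phase) n :
  (\sum_(i <- r | P i) F i) n = \sum_(i <- r | P i) F i n.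
Proof. exact: (big_morph (fun u : phase => u n) (fun u v => phaseD u v n)). Qed.

Lemma shift_subproof u : is_phase (fun n => u (n + 1)).
Proof.
have /asboolP[d ud] := phaseP u; apply/asboolP; exists d.
have -> : iter d dif (fun n => u (n + 1)) = fun n => iter d dif u (n + 1).
  by elim: d {ud} => //= d ->; apply/funext.
by rewrite ud.
Qed.

Definition pshift u : phase := Phase (shift_subproof u).
Arguments pshift : simpl never.

Lemma shiftE u n : pshift u n = u (n + 1). Proof. by []. Qed.

Lemma shift_is_additive : {morph pshift : u v / u - v}.
Proof. by move=> u v; apply: phase_ext. Qed.

HB.instance Definition _ :=
  GRing.isZmodMorphism.Build phase phase pshift shift_is_additive.

Fact D_key : unit. Proof. exact: tt. Qed.
Definition D := locked_with D_key (fun u : phase => pshift u - u).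

Lemma DdefE u : D u = pshift u - u. Proof. by rewrite /D unlock. Qed.
Arguments D : simpl never.

Lemma DE u n : D u n = u (n + 1) - u n. Proof. by rewrite DdefE. Qed.

Lemma D_is_additive : {morph D : u v / u - v}.
Proof. by move=> u v; rewrite !DdefE raddfB subrACA. Qed.

HB.instance Definition _ :=
  GRing.isZmodMorphism.Build phase phase D D_is_additive.

Lemma val_iterD d u n : iter d D u n = iter d dif u n.
Proof. by elim: d n => //= d IH n; rewrite DE !IH. Qed.

Lemma iterD_nil u : exists d, iter d D u = 0.
Proof.
have /asboolP[d ud] := phaseP u; exists d; apply: phase_ext => n.
by rewrite val_iterD ud.
Qed.

Lemma D_shift u : D (pshift u) = pshift (D u).
Proof. by rewrite !DdefE raddfB. Qed.

Section IterAdditive.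
Variables (V : zmodType) (f : {additive V -> V}).

Lemma iter_is_additive d : {morph iter d f : u v / u - v}.
Proof. by move=> u v; elim: d => //= d ->; rewrite raddfB. Qed.

HB.instance Definition _ d :=
  GRing.isZmodMorphism.Build V V (iter d f) (iter_is_additive d).

(** The binomial theorem for 1 + f. It serves for the shift, which is 1 + [D], and for an operator G
    written as 1 + (G - 1). *)
Lemma iter_add1 n (u : V) :
  iter n (fun z : V => z + f z) u = \sum_(k < n.+1) iter k f u *+ 'C(n, k).
Proof.
elim: n => [|n IH]; first by rewrite big_ord1.
rewrite iterS IH [RHS]big_ord_recl /= bin0 mulr1n.
under [in RHS]eq_bigr do rewrite /bump /= add1n binS mulrnDr.
rewrite big_split /= addrA raddf_sum /=; congr (_ + _); last first.
  by apply: eq_bigr => k _; rewrite raddfMn.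
rewrite big_ord_recl /= bin0 mulr1n; congr (_ + _).
rewrite [RHS]big_ord_recr /= bin_small // mulr0n addr0.
by apply: eq_bigr => k _; rewrite /bump /= add1n.
Qed.

Lemma iter_add1_nil d n (u : V) : iter d f u = 0 ->
  iter n (fun z : V => z + f z) u = \sum_(k < d) iter k f u *+ 'C(n, k).
Proof.
move=> fd; have f0 k : (d <= k)%N -> iter k f u = 0.
  by move=> /subnK <-; rewrite iterD fd raddf0.
rewrite iter_add1; have [dn|nd] := leqP d n.+1.
  rewrite -!(big_mkord predT (fun k => iter k f u *+ 'C(n, k))).
  rewrite (@big_cat_nat _ _ _ d) //= [X in _ + X]big_nat_cond [X in _ + X]big1 ?addr0 //.
  by move=> k /andP[/andP[dk _] _]; rewrite f0 // mul0rn.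
rewrite -!(big_mkord predT (fun k => iter k f u *+ 'C(n, k))).
rewrite [RHS](@big_cat_nat _ _ _ n.+1) //=; last exact: ltnW.
rewrite [X in _ + X]big_nat_cond [X in _ + X]big1 ?addr0 //.
by move=> k /andP[/andP[dk _] _]; rewrite bin_small.
Qed.

End IterAdditive.

Lemma iter_shiftE k u n : iter k pshift u n = u (n + k%:Z).
Proof.
elim: k n => [|k IH] n; first by rewrite addr0.
by rewrite iterS shiftE IH -addrA -PoszD add1n.
Qed.

Lemma iterD_shift d u : iter d D (pshift u) = pshift (iter d D u).
Proof. by elim: d => //= d ->; rewrite D_shift. Qed.

Lemma newton d n u : iter d D u = 0 ->
  iter n pshift u = \sum_(k < d) iter k D u *+ 'C(n, k).
Proof.
move=> ud; rewrite -(iter_add1_nil _ ud) /=.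
by apply: eq_iter => v; rewrite DdefE addrC subrK.
Qed.

Lemma cst_subproof x : is_phase (fun=> x).
Proof. by apply/asboolP; exists 1%N; apply/funext => n; exact: subrr. Qed.

Definition pcst x : phase := Phase (cst_subproof x).
Arguments pcst : simpl never.

Lemma pcstE x n : pcst x n = x. Proof. by []. Qed.

Lemma cst_is_additive : {morph pcst : x y / x - y}.
Proof. by move=> x y; exact: phase_ext. Qed.

HB.instance Definition _ :=
  GRing.isZmodMorphism.Build A phase pcst cst_is_additive.

Lemma D_cst x : D (pcst x) = 0.
Proof. by apply: phase_ext => n; rewrite DE subrr. Qed.

Lemma iterD_cst d x : iter d.+1 D (pcst x) = 0.
Proof. by rewrite iterSr D_cst raddf0. Qed.

Lemma shift_cst x : pshift (pcst x) = pcst x.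
Proof. exact: phase_ext. Qed.

Lemma iter_shift_cst Q x : iter Q pshift (pcst x) = pcst x.
Proof. by elim: Q => //= Q ->; rewrite shift_cst. Qed.

Lemma phase_dif_ext u v : u 0 = v 0 -> D u = D v -> u = v.
Proof.
move=> uv0 Duv; apply: phase_ext; apply: int_dif_ext => // n.
by rewrite -!DE Duv.
Qed.

Lemma D_eq0 u : D u = 0 -> u = pcst (u 0).
Proof. by move=> Du; apply: phase_dif_ext; rewrite // Du D_cst. Qed.

Lemma phase_eq0 u : (forall k, iter k D u 0 = 0) -> u = 0.
Proof.
have [d] := iterD_nil u; elim: d u => //= d IH u; rewrite -iterS iterSr => ud h.
have Du0 : D u = 0 by apply: IH => // k; rewrite -iterSr h.
by rewrite (D_eq0 Du0) (h 0%N) raddf0.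
Qed.

Lemma antidif_subproof (f : int -> A) v : (forall n, f (n + 1) - f n = v n) ->
  is_phase f.
Proof.
move=> fv; have [d vd] := iterD_nil v; apply/asboolP; exists d.+1.
rewrite iterSr; have -> : dif f = v by apply/funext => n; exact: fv.
by apply/funext => n; rewrite -val_iterD vd.
Qed.

Lemma beta_subproof k x : is_phase (fun n => x *~ binz n k).
Proof.
elim: k => [|k IH].
  by rewrite (_ : (fun n => _) = pcst x) ?phaseP //; apply/funext => n; rewrite binz0.
apply: (@antidif_subproof _ (Phase IH)) => n.
by rewrite binzS mulrzDr addrAC subrr add0r.
Qed.

(** The phase whose only Newton coefficient is x, in degree k. As [D] lowers k by one without a
    factor ([D_beta]), the coefficients of a phase are its iterated differences at 0
    ([phase_beta]). *)
Definition beta k x : phase := Phase (beta_subproof k x).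
Arguments beta : simpl never.

Lemma betaE k x n : beta k x n = x *~ binz n k. Proof. by []. Qed.

Lemma beta_nat k x (n : nat) : beta k x n%:Z = x *+ 'C(n, k). Proof. by []. Qed.

Lemma beta_at0 k x : (0 < k)%N -> beta k x 0 = 0.
Proof. by move=> k0; rewrite beta_nat bin0n eqn0Ngt k0. Qed.

Lemma beta_is_additive k : {morph beta k : x y / x - y}.
Proof. by move=> x y; apply: phase_ext => n; rewrite phaseB !betaE mulrzBl. Qed.

HB.instance Definition _ k :=
  GRing.isZmodMorphism.Build A phase (beta k) (@beta_is_additive k).

Lemma beta0 x : beta 0 x = pcst x.
Proof. by apply: phase_ext => n; rewrite betaE binz0. Qed.

Lemma D_beta k x : D (beta k.+1 x) = beta k x.
Proof.
apply: phase_ext => n.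
by rewrite DE !betaE binzS mulrzDr addrAC subrr add0r.
Qed.

Lemma iterD_beta i k x : iter i D (beta (k + i) x) = beta k x.
Proof. by elim: i => [|i IH]; rewrite ?addn0 // addnS iterSr D_beta. Qed.

Lemma iterD_beta_cst k x : iter k D (beta k x) = pcst x.
Proof. by rewrite -{2}[k]add0n iterD_beta beta0. Qed.

Lemma iterD_beta0 k x : iter k.+1 D (beta k x) = 0.
Proof. by rewrite iterS iterD_beta_cst D_cst. Qed.

Lemma phase_beta d u : iter d D u = 0 -> u = \sum_(k < d) beta k (iter k D u 0).
Proof.
elim: d u => [u /= ->|d IH u]; first by rewrite big_ord0.
rewrite iterSr => /IH Du; apply: phase_dif_ext.
  by rewrite phase_sum big_ord_recl /= big1 ?addr0 ?beta0 ?pcstE.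
rewrite raddf_sum [in LHS]Du big_ord_recl /= beta0 D_cst add0r.
by apply: eq_bigr => k _; rewrite D_beta -iterSr.
Qed.

(** If Q is a period of [D u], the Q-th shift adds a constant c to u. Since [u *+ N] is constant, c
    is killed by N, so Q N is a period of u. *)
Lemma phase_period d N u : iter d D u = 0 -> D u *+ N = 0 ->
  iter (N ^ d) pshift u = u.
Proof.
elim: d u => [u /= -> _|d IH u]; first by rewrite raddf0.
rewrite iterSr => Dud DuN.
have DDuN : D (D u) *+ N = 0 by rewrite -raddfMn DuN raddf0.
have h := IH _ Dud DDuN; set Q := (N ^ d)%N in h.
have c0 : D (iter Q pshift u - u) = 0.
  rewrite raddfB -[X in _ - X]h; apply/eqP; rewrite subr_eq0; apply/eqP.
  by elim: Q {h} => //= Q IHQ; rewrite D_shift IHQ.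
have cE := D_eq0 c0; set c := _ 0 in cE.
have uQ : iter Q pshift u = u + pcst c by rewrite -cE addrC subrK.
have cN : pcst c *+ N = 0.
  rewrite -cE mulrnBl; have NuE : D (u *+ N) = 0 by rewrite raddfMn.
  rewrite -raddfMn (D_eq0 NuE).
  by rewrite /= iter_shift_cst subrr.
have uQk k : iter (Q * k) pshift u = u + pcst c *+ k.
  elim: k => [|k IHk]; first by rewrite muln0 addr0.
  rewrite mulnS iterD IHk raddfD /= uQ raddfMn /= mulrS addrA.
  by rewrite iter_shift_cst.
by rewrite expnS mulnC uQk cN addr0.
Qed.

Lemma comp_subproof (f : {additive A -> A}) u : is_phase (f \o u).
Proof.
have /asboolP[d ud] := phaseP u; apply/asboolP; exists d.
have -> : iter d dif (f \o u) = f \o (iter d dif u).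
  by elim: d {ud} => //= d ->; apply/funext => n; rewrite /dif /= raddfB.
by rewrite ud; apply/funext => n /=; rewrite raddf0.
Qed.

Definition hcomp (f : {additive A -> A}) u : phase := Phase (comp_subproof f u).
Arguments hcomp : simpl never.

Lemma hcompE f u n : hcomp f u n = f (u n). Proof. by []. Qed.

Lemma hcomp_is_additive f : {morph hcomp f : u v / u - v}.
Proof. by move=> u v; apply: phase_ext => n; rewrite phaseB !hcompE phaseB raddfB. Qed.

HB.instance Definition _ f :=
  GRing.isZmodMorphism.Build phase phase (hcomp f) (hcomp_is_additive f).

Lemma D_hcomp f u : D (hcomp f u) = hcomp f (D u).
Proof. by apply: phase_ext => n; rewrite !(DE, hcompE) raddfB. Qed.

Lemma shift_hcomp f u : pshift (hcomp f u) = hcomp f (pshift u).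
Proof. exact: phase_ext. Qed.

Lemma hcomp_cst f x : hcomp f (pcst x) = pcst (f x).
Proof. exact: phase_ext. Qed.

Lemma monomial_subproof (a : R) k : is_phase (fun n => aexp (a * n%:~R ^+ k)).
Proof.
elim/ltn_ind: k a => -[|k] IH a.
  rewrite (_ : (fun n => _) = pcst (aexp a)) ?phaseP //; apply/funext => n.
  by rewrite expr0 mulr1.
pose v : phase := \sum_(i < k.+1) Phase (IH i (ltn_ord i) (a *+ 'C(k.+1, i))).
apply: (@antidif_subproof _ v) => n; rewrite /v phase_sum /= -aexpN -aexpD.
rewrite -mulrBr intrD [n%:~R + _]addrC exprDn big_ord_recr /= subnn expr0 mul1r.
rewrite binn mulr1n addrK.
rewrite mulr_sumr (big_morph _ (@aexpD R) (@aexp0 R)); apply: eq_bigr => i _.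
by rewrite expr1n mul1r mulrnAr -mulrnAl.
Qed.

Lemma poly_phase (p : {poly R}) : is_phase (fun n => aexp p.[n%:~R]).
Proof.
pose v : phase := \sum_(i < size p) Phase (monomial_subproof p`_i i).
rewrite (_ : (fun n => _) = v) ?phaseP //; apply/funext => n.
by rewrite phase_sum /= horner_coef (big_morph _ (@aexpD R) (@aexp0 R)).
Qed.

Definition binp k : {poly R} := (k`!%:R)^-1 *: \prod_(i < k) ('X - i%:R%:P).

Lemma binpE k n : (binp k).[n%:~R] = (binz n k)%:~R.
Proof.
have factS_neq0 j : (j`!)%:R != 0 :> R by rewrite pnatr_eq0 -lt0n fact_gt0.
have hE j (x : R) : (binp j).[x] = (j`!%:R)^-1 * \prod_(i < j) (x - i%:R).
  rewrite hornerZ horner_prod; congr (_ * _); apply: eq_bigr => i _.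
  by rewrite hornerXsubC.
elim: k n => [|k IH] n; first by rewrite hE big_ord0 binz0 mulr1 invr1.
move: n; apply: int_dif_ext.
  rewrite hE big_ord_recl /= subr0 mulr0z !mul0r mulr0.
  by [].
move=> n; rewrite binzS [in RHS]intrD [RHS]addrAC subrr add0r -IH !hE intrD.
pose P := \prod_(i < k) (n%:~R - i%:R : R).
have -> : \prod_(i < k.+1) (n%:~R + 1%:~R - i%:R : R) = (n%:~R + 1) * P.
  rewrite big_ord_recl subr0; congr (_ * _); apply: eq_bigr => i _.
  by rewrite lift0 -natr1; ring.
have -> : \prod_(i < k.+1) (n%:~R - i%:R : R) = P * (n%:~R - k%:R).
  by rewrite big_ord_recr.
rewrite -/P factS natrM; have := factS_neq0 k.
have : k.+1%:R != 0 :> R by rewrite pnatr_eq0.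
rewrite -natr1; move: (k`!%:R) (k%:R) (n%:~R) P => f a b P a0 f0.
by field; rewrite a0 f0.
Qed.

(** Each Newton coefficient lifts from the circle to R. With [poly_phase], this identifies phases
    with exponentials of real polynomials. *)
Lemma phase_poly u : exists p : {poly R}, u =1 fun n => aexp p.[n%:~R].
Proof.
have [d ud] := iterD_nil u.
have /choice[r rE] := fun k => aexp_surj (iter k D u 0).
exists (\sum_(k < d) r k *: binp k) => n.
rewrite [in LHS](phase_beta ud) phase_sum horner_sum.
rewrite (big_morph _ (@aexpD R) (@aexp0 R)); apply: eq_bigr => k _.
by rewrite hornerZ binpE betaE rE -aexpMz mulrzr.
Qed.

Definition torsion x := exists2 N : nat, (0 < N)%N & x *+ N = 0.

(** The condition bears on [D u], so the constant term is free: these are exactly the periodic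
    phases, by [phase_period] and [periodic_torsion]. *)
Definition torsion_phase u := exists2 N : nat, (0 < N)%N & D u *+ N = 0.

End Phase.
Arguments phase_fun : simpl never.
Arguments pshift : simpl never.
Arguments pcst : simpl never.
Arguments beta : simpl never.
Arguments hcomp : simpl never.

(** * Invariant means and Weyl's theorem *)

Section Mean.
Variable R : realType.
Notation C := (Cplx R).
Notation A := (acirc R).

Definition bnd (f : nat -> C) := exists M : R, forall n, `|f n| <= M%:C%C.

Lemma bndD f g : bnd f -> bnd g -> bnd (fun n => f n + g n).
Proof.
move=> [M fM] [N gN]; exists (M + N) => n.
by rewrite rmorphD (le_trans (ler_normD _ _)) // lerD.
Qed.

Lemma normC_real (z : C) : exists r : R, `|z| = r%:C%C.
Proof. by apply/complex_realP; exact: normr_real. Qed.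

Lemma bndZ (a : C) f : bnd f -> bnd (fun n => a * f n).
Proof.
move=> [M fM]; have [r ar] := normC_real a; exists (r * M) => n.
by rewrite normrM ar rmorphM ler_wpM2l // -ar.
Qed.

Lemma bnd_conj f : bnd f -> bnd (fun n => (f n)^*).
Proof. by move=> [M fM]; exists M => n; rewrite norm_conjC. Qed.

Lemma bnd_cst (a : C) : bnd (fun=> a).
Proof. by have [r ar] := normC_real a; exists r => n; rewrite ar. Qed.

Lemma bndM f g : bnd f -> bnd g -> bnd (fun n => f n * g n).
Proof.
move=> [M fM] [N gN]; exists (M * N) => n.
by rewrite rmorphM normrM ler_pM.
Qed.

Lemma bnd_aval (u : nat -> A) : bnd (fun n => aval (u n)).
Proof. by exists 1 => n; rewrite aval_norm. Qed.

Lemma bnd_comp f (h : nat -> nat) : bnd f -> bnd (fun n => f (h n)).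
Proof. by move=> [M fM]; exists M. Qed.

Lemma bnd_sum (I : Type) (r : seq I) (f : I -> nat -> C) :
  (forall i, bnd (f i)) -> bnd (fun n => \sum_(i <- r) f i n).
Proof.
move=> fb; elim: r => [|i r IH].
  by exists 0 => n; rewrite big_nil normr0.
have [M fM] := bndD (fb i) IH.
by exists M => n; rewrite big_cons.
Qed.

Definition cesaro (f : nat -> C) (N : nat) : C :=
  (\sum_(n < N.+1) f n) / N.+1%:R.

Lemma cesaroD f g N : cesaro (fun n => f n + g n) N = cesaro f N + cesaro g N.
Proof. by rewrite /cesaro big_split mulrDl. Qed.

Lemma cesaroZ a f N : cesaro (fun n => a * f n) N = a * cesaro f N.
Proof. by rewrite /cesaro -mulr_sumr mulrA. Qed.

Lemma cesaro_conj f N : cesaro (fun n => (f n)^*) N = (cesaro f N)^*.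
Proof. by rewrite /cesaro rmorphM rmorph_sum /= fmorphV rmorph_nat. Qed.

Lemma cesaro_cst a N : cesaro (fun=> a) N = a.
Proof.
by rewrite /cesaro sumr_const card_ord -[_ *+ _]mulr_natr mulfK // pnatr_eq0.
Qed.

Lemma cesaro_ge0 f N : (forall n, 0 <= f n) -> 0 <= cesaro f N.
Proof. by move=> f0; rewrite divr_ge0 ?ler0n // sumr_ge0. Qed.

Lemma cesaro_bnd f M N : (forall n, `|f n| <= M) -> `|cesaro f N| <= M.
Proof.
move=> fM; rewrite normrM normfV normr_nat ler_pdivrMr ?ltr0n //.
apply: (le_trans (ler_norm_sum _ _ _)).
apply: (@le_trans _ _ (\sum_(n < N.+1) M)); first exact: ler_sum.
by rewrite sumr_const card_ord -[M *+ _]mulr_natr.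
Qed.

Lemma cesaro_shift f (M : C) N : (forall n, `|f n| <= M) ->
  `|cesaro (fun n => f n.+1) N - cesaro f N| <= M *+ 2 / N.+1%:R.
Proof.
move=> fM; rewrite /cesaro -mulrBl normrM normfV normr_nat.
rewrite ler_pM2r ?invr_gt0 ?ltr0n //.
rewrite big_ord_recr /= [X in _ - X]big_ord_recl /=.
have -> (a b c : C) : a + b - (c + a) = b - c by ring.
by rewrite (le_trans (ler_normB _ _)) // mulr2n lerD.
Qed.

Definition is_mean (L : (nat -> C) -> C) :=
  [/\ L (fun=> 1) = 1,
      forall f g, bnd f -> bnd g -> L (fun n => f n + g n) = L f + L g,
      forall a f, bnd f -> L (fun n => a * f n) = a * L f,
      forall f, bnd f -> (forall n, 0 <= f n) -> 0 <= L f
    & forall f, bnd f -> L (fun n => f n.+1) = L f /\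
        L (fun n => (f n)^*) = (L f)^*].

(** The limit of the Cesaro averages along an ultrafilter that contains the eventual sets. *)
Lemma mean_exists : exists L, is_mean L.
Proof.
have [U [UU sU]] := ultraFilterLemma eventually_filter.
pose L f : C := xget 0 [set z : C | cesaro f @ U --> z].
have LP f : bnd f -> cesaro f @ U --> L f.
  move=> [M fM]; have [N|z fz] := @ultra_bounded R nat U (cesaro f) M UU.
    exact: cesaro_bnd.
  exact: (@xgetPex _ 0 [set z : C | cesaro f @ U --> z] (ex_intro _ z fz)).
have LE f z : bnd f -> cesaro f @ U --> z -> L f = z.
  by move=> /LP fL fz; exact: cvgC_unique fL fz.
exists L; split.
- apply: LE; first exact: bnd_cst.
  rewrite (_ : cesaro _ = (fun=> 1)); first exact: cvg_cst.
  by apply/funext => N; rewrite cesaro_cst.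
- move=> f g fb gb; apply: LE; first exact: bndD.
  rewrite (_ : cesaro _ = (fun N => cesaro f N + cesaro g N)).
    by apply: cvgCD; exact: LP.
  by apply/funext => N; rewrite cesaroD.
- move=> a f fb; apply: LE; first exact: bndZ.
  rewrite (_ : cesaro _ = (fun N => a * cesaro f N)).
    by apply: cvgCM; [exact: cvg_cst | exact: LP].
  by apply/funext => N; rewrite cesaroZ.
- move=> f fb f0; have fL := LP f fb.
  have : (fun N => `|cesaro f N|) @ U --> `|L f| by exact: cvg_norm.
  rewrite (_ : (fun N => _) = cesaro f); last first.
    by apply/funext => N; rewrite ger0_norm // cesaro_ge0.
  move=> fL'; have e : L f = `|L f| by exact: cvgC_unique fL fL'.
  by rewrite e normr_ge0.
- move=> f fb; split.
    apply: LE; first exact: bnd_comp.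
    have /cvgC_dist fL := LP f fb; apply/cvgC_dist => e e0.
    have [d ed] : exists d, e = d%:C%C by apply/complex_realP; exact: gtr0_real.
    have d0 : 0 < d by rewrite -ltcR -ed.
    have [M fM] := fb.
    have e2 : 0 < e / 2 by rewrite divr_gt0.
    have small : \forall N \near U, M%:C%C *+ 2 / N.+1%:R <= e / 2.
      (* The shift changes an average by at most 2 M / (N + 1), which is at most d / 2 once N + 1 >=
         4 M / d. *)
      apply: sU; exists (Num.truncn (M *+ 4 / d)).+1 => // N /= hN.
      rewrite ler_pdivrMr ?ltr0n // ed.
      rewrite (_ : M%:C%C *+ 2 = (M *+ 2)%:C%C); last by rewrite rmorphMn.
      rewrite (_ : d%:C%C / 2 * N.+1%:R = (d / 2 * N.+1%:R)%:C%C); last first.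
        by rewrite !rmorphM /= fmorphV !rmorph_nat.
      have : M *+ 4 / d <= N.+1%:R.
        apply: ltW; apply: lt_le_trans (truncnS_gt _) _.
        by rewrite ler_nat (leq_trans hN).
      rewrite lecR ler_pdivrMr // => h.
      by have -> : M *+ 2 = M *+ 4 / 2; [by field | lra].
    have fLe := fL _ e2; near=> N.
    rewrite [e]splitr -(subrK (cesaro f N) (cesaro _ N)) -addrA.
    apply: (le_trans (ler_normD _ _)); apply: lerD; last by near: N.
    by apply: (le_trans (cesaro_shift _ fM)); near: N.
  apply: LE; first exact: bnd_conj.
  have /cvgC_dist fL := LP f fb; apply/cvgC_dist => e /fL.
  by apply: filterS => N; rewrite cesaro_conj -rmorphB norm_conjC.
Unshelve. all: by end_near. Qed.

End Mean.

Section VanDerCorput.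
Variable R : realType.
Notation C := (Cplx R).
Notation A := (acirc R).
Variables (L : (nat -> C) -> C) (meanL : is_mean L).

Lemma mean1 : L (fun=> 1) = 1. Proof. by case: meanL. Qed.

Lemma meanD f g : bnd f -> bnd g -> L (fun n => f n + g n) = L f + L g.
Proof. by case: meanL => _ h _ _ _; exact: h. Qed.

Lemma meanZ a f : bnd f -> L (fun n => a * f n) = a * L f.
Proof. by case: meanL => _ _ h _ _; exact: h. Qed.

Lemma mean_ge0 f : bnd f -> (forall n, 0 <= f n) -> 0 <= L f.
Proof. by case: meanL => _ _ _ h _; exact: h. Qed.

Lemma mean_conj f : bnd f -> L (fun n => (f n)^*) = (L f)^*.
Proof. by case: meanL => _ _ _ _ h /h[]. Qed.

Lemma mean_cst a : L (fun=> a) = a.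
Proof.
rewrite -[RHS]mulr1 -mean1 -meanZ; last exact: bnd_cst.
by congr L; apply/funext => n; rewrite mulr1.
Qed.

Lemma mean_shift f h : bnd f -> L (fun n => f (n + h)%N) = L f.
Proof.
move=> fb; elim: h => [|h IH].
  by congr L; apply/funext => n; rewrite addn0.
rewrite -IH; case: meanL => _ _ _ _ /(_ (fun n => f (n + h)%N)) [].
  exact: (bnd_comp (fun n => n + h)%N fb).
by move=> <- _; congr L; apply/funext => n; rewrite addSnnS.
Qed.

Lemma mean_sum (I : Type) (r : seq I) (f : I -> nat -> C) :
  (forall i, bnd (f i)) ->
  L (fun n => \sum_(i <- r) f i n) = \sum_(i <- r) L (f i).
Proof.
move=> fb; elim: r => [|i r IH].
  rewrite big_nil -[RHS]mean_cst; congr L; apply/funext => n.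
  by rewrite big_nil.
rewrite big_cons -IH -meanD //; last exact: bnd_sum.
by congr L; apply/funext => n; rewrite big_cons.
Qed.

Lemma mean_le f g : bnd f -> bnd g -> (forall n, f n <= g n) -> L f <= L g.
Proof.
move=> fb gb fg; rewrite -subr_ge0 -mulN1r -meanZ // -meanD //; last exact: bndZ.
apply: mean_ge0 => [|n]; first by apply: bndD => //; exact: bndZ.
by rewrite mulN1r subr_ge0.
Qed.

(** The variance of f, that is the mean of |f - L f|^2, is nonnegative. *)
Lemma mean_cauchy_schwarz f : bnd f ->
  L f * (L f)^* <= L (fun n => f n * (f n)^*).
Proof.
move=> fb; set l := L f; have fcb := bnd_conj fb.
have h : 0 <= L (fun n => `|f n - l| ^+ 2).
  apply: mean_ge0 => [|n]; last exact: exprn_ge0.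
  have [M fM] : bnd (fun n => (f n - l) * (f n - l)^*).
    apply: bndM; last apply: bnd_conj; apply: bndD => //; exact: bnd_cst.
  by exists M => n; rewrite normCK.
have e : (fun n => `|f n - l| ^+ 2) =
    (fun n => f n * (f n)^* + ((- l^*) * f n + ((- l) * (f n)^* + l * l^*))).
  by apply/funext => n; rewrite normCK rmorphB /=; ring.
have b1 : bnd (fun n => - l * (f n)^* + l * l^*).
  by apply: bndD; [exact: bndZ | exact: bnd_cst].
have b2 : bnd (fun n => - l^* * f n + (- l * (f n)^* + l * l^*)).
  by apply: bndD => //; exact: bndZ.
move: h; rewrite e meanD //; last exact: bndM.
rewrite meanD //; last exact: bndZ.
rewrite meanD; [|exact: bndZ|exact: bnd_cst].
rewrite mean_cst !meanZ // mean_conj // -/l => h; rewrite -subr_ge0.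
by move: h; congr (_ <= _); ring.
Qed.

(** The van der Corput trick: the translates of u are orthonormal for L. By Cauchy-Schwarz, the sum
    of H of them gives H^2 |l|^2 <= H for every H, hence l = 0. *)
Lemma mean_vdc (u : nat -> A) :
  (forall h, (0 < h)%N -> L (fun n => aval (u (n + h)%N - u n)) = 0) ->
  L (fun n => aval (u n)) = 0.
Proof.
move=> hu; set l := L _.
have corr (h k : nat) : L (fun n => aval (u (n + h)%N - u (n + k)%N)) = (h == k)%:R.
  have key (a b : nat) : (a < b)%N ->
      L (fun n => aval (u (n + b)%N - u (n + a)%N)) = 0.
    move=> ab; rewrite -(hu (b - a)%N) ?subn_gt0 //.
    rewrite -[RHS](@mean_shift _ a); last exact: bnd_aval.
    by congr L; apply/funext => n; rewrite -addnA subnKC // ltnW.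
  have [hk|kh|->] := ltngtP h k.
  - have e := congr1 Num.conj (key _ _ hk).
    rewrite rmorph0 -mean_conj in e; last exact: bnd_aval.
    rewrite -[RHS]e; congr L; apply/funext => n; rewrite -opprB avalN.
    by rewrite invC_norm aval_norm expr1n invr1 mul1r.
  - exact: key.
  - rewrite -[RHS]mean_cst; congr L; apply/funext => n.
    by rewrite subrr aval0.
have bound H : H%:R * (l * l^*) <= 1.
  have [->|H0] := posnP H; first by rewrite mul0r ler01.
  pose g n := \sum_(h < H) aval (u (n + h)%N).
  have gb : bnd g by apply: bnd_sum => h; exact: bnd_aval.
  have Lg : L g = H%:R * l.
    rewrite mean_sum; last by move=> h; exact: bnd_aval.
    transitivity (\sum_(h < H) l); last by rewrite sumr_const card_ord mulr_natl.
    by apply: eq_bigr => h _; rewrite (mean_shift _ (bnd_aval u)).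
  have := mean_cauchy_schwarz gb.
  have -> : (fun n => g n * (g n)^*) =
      fun n => \sum_(h < H) \sum_(k < H) aval (u (n + h)%N - u (n + k)%N).
    apply/funext => n; rewrite /g rmorph_sum big_distrl; apply: eq_bigr => h _.
    rewrite big_distrr; apply: eq_bigr => k _ /=; rewrite avalB; congr (_ * _).
    by rewrite [RHS]invC_norm aval_norm expr1n invr1 mul1r.
  pose w (h k : 'I_H) n := aval (u (n + h)%N - u (n + k)%N).
  have wb h k : bnd (w h k) by exact: bnd_aval.
  rewrite (mean_sum _ (fun h => bnd_sum (index_enum 'I_H) (wb h))).
  have -> : \sum_(h < H) L (fun n => \sum_(k < H) aval (u (n + h)%N - u (n + k)%N))
      = H%:R.
    transitivity (\sum_(h < H) (1 : C)); last by rewrite sumr_const card_ord.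
    apply: eq_bigr => h _; rewrite (mean_sum _ (wb h)).
    rewrite (bigD1 h) //= corr eqxx big1 ?addr0 // => k kh.
    by rewrite corr eq_sym -[_ == _ :> nat]/(k == h) (negbTE kh).
  rewrite Lg rmorphM rmorph_nat mulrACA -mulrA -[X in _ <= X]mulr1 ler_pM2l ?ltr0n //.
apply/eqP; rewrite -normr_eq0 -sqrf_eq0 normCK.
have [r lr] : exists r : R, l * l^* = r%:C%C.
  by rewrite -normCK; have [r ->] := normC_real l; exists (r ^+ 2); rewrite rmorphXn.
have r0 : 0 <= r by rewrite -(lecR 0) -lr -normCK exprn_ge0.
have rb H : H%:R * r <= 1 by rewrite -lecR rmorphM rmorph_nat /= -lr bound.
rewrite lr; apply/eqP; congr (_%:C%C).
move: r0; rewrite le_eqVlt => /predU1P[//|r0].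
have := rb (Num.truncn r^-1).+1; rewrite leNgt -ltr_pdivrMr // div1r.
by rewrite truncnS_gt.
Qed.

End VanDerCorput.

Section Weyl.
Variable R : realType.
Notation C := (Cplx R).
Notation A := (acirc R).
Variables (L : (nat -> C) -> C) (meanL : is_mean L).
Implicit Types u v w : phase R.

Lemma iter_shift_D d k u : iter d (@D R) (iter k (@pshift R) u) =
  iter k (@pshift R) (iter d (@D R) u).
Proof.
by elim: k => //= k <-; elim: d {u} (iter k _ u) => //= d IH u; rewrite IH D_shift.
Qed.

Lemma iter_shift_dif d k u : iter d.+1 (@D R) u = 0 ->
  iter d (@D R) (iter k (@pshift R) u - u) = 0.
Proof.
move=> ud; rewrite raddfB /= iter_shift_D; set v := iter d _ u.
by rewrite (D_eq0 (ud : D v = 0)) iter_shift_cst subrr.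
Qed.

(** Newton's formula for the k-th shift shows that k kills the leading coefficient; so [u *+ k] has
    smaller degree and still has period k. *)
Lemma periodic_torsion d k u : iter d (@D R) u = 0 -> iter k (@pshift R) u = u ->
  D u *+ k ^ d = 0.
Proof.
elim: d u => [u /= -> _|d IH u ud uk]; first by rewrite raddf0 mul0rn.
case: d => [|d] in IH ud *; first by rewrite (ud : D u = 0) mul0rn.
have h : iter d.+1 (@D R) (u *+ k) = 0.
  have := congr1 (iter d (@D R)) uk; rewrite iter_shift_D.
  rewrite (@newton _ 2) -?iterD // big_ord_recl big_ord1 /= bin0 bin1 mulr1n.
  move=> e; apply: (addrI (iter d (@D R) u)).
  by rewrite addr0 -[RHS]e raddfMn /= raddfMn.
have := IH _ h; rewrite !raddfMn /= uk -mulrnA -expnS.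
by apply.
Qed.

(** By van der Corput, some difference w of v by a multiple of M also has nonzero mean along a
    progression; it has smaller degree, so it is torsion by induction. What remains is to exclude a
    linear term of infinite order. *)
Lemma weyl d v (n0 M : nat) : iter d (@D R) v = 0 -> (0 < M)%N ->
  L (fun t => aval (v (n0 + M * t)%N)) != 0 -> torsion_phase v.
Proof.
move=> vd M0; elim: d v vd => [v /= -> _|d IH v vd Lv].
  by exists 1%N => //; rewrite raddf0.
have [h h0 Lh] : exists2 h, (0 < h)%N &
    L (fun t => aval (v (n0 + M * (t + h)%N)%N - v (n0 + M * t)%N)) != 0.
  apply: contrapT => nh; move/eqP: Lv; apply.
  apply: (mean_vdc meanL (u := fun t => v (n0 + M * t)%N)) => h h0.
  by apply/eqP; apply: contrapT => /negP Lh; apply: nh; exists h.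
pose w := iter (M * h) (@pshift R) v - v.
have [|N N0 wN] := IH w (iter_shift_dif _ vd).
  rewrite (_ : (fun t => _) =
    (fun t => aval (v (n0 + M * (t + h)%N)%N - v (n0 + M * t)%N))) //.
  apply/funext => t; congr aval; rewrite /w phaseB iter_shiftE.
  by rewrite mulnDr addnA PoszD.
have Mh0 : (0 < M * h)%N by rewrite muln_gt0 M0.
(* As w is torsion, a multiple of [D v] is periodic, hence [D (D v)] is torsion. *)
have qP : iter (M * h) (@pshift R) (D v *+ N) = D v *+ N.
  apply/eqP; rewrite -subr_eq0 raddfMn /= -mulrnBl.
  have -> : iter (M * h) (@pshift R) (D v) = D (iter (M * h) (@pshift R) v).
    by elim: (M * h)%N => //= k ->; rewrite D_shift.
  by rewrite -raddfB wN.
have := periodic_torsion (_ : iter d (@D R) (D v *+ N) = 0) qP.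
rewrite (_ : iter d _ _ = 0); last by rewrite raddfMn /= -iterSr vd mul0rn.
move=> /(_ erefl); rewrite raddfMn /= -mulrnA; set N' := (N * _)%N => DDv.
have N'0 : (0 < N')%N by rewrite muln_gt0 N0 expn_gt0 Mh0.
have zE : D v *+ N' = pcst ((D v *+ N') 0) by apply: D_eq0; rewrite raddfMn.
set z := (D v *+ N') 0 in zE.
have [[K K0 zK]|zt] := pselect (torsion z).
  exists (N' * K)%N; first by rewrite muln_gt0 N'0.
  by rewrite mulrnA zE -raddfMn zK raddf0.
(* Removing the linear term with slope y leaves a torsion phase [vt], which is periodic. *)
have [y yz] := aexp_root z N'0.
pose vt := v - beta 1 y.
have vtN : D vt *+ N' = 0.
  by rewrite raddfB /= D_beta beta0 mulrnBl zE -raddfMn yz subrr.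
have [e vte] := iterD_nil vt.
have vtP := phase_period vte vtN; set P := (N' ^ e)%N in vtP.
have P0 : (0 < P)%N by rewrite expn_gt0 N'0.
(* A translation by the period P multiplies the values on the progression by a constant. The mean
   being invariant and nonzero, this constant is 1, so y is torsion, against [zt]. *)
have fP t : aval (v (n0 + M * (t + P))%N) =
    aval (y *+ (M * P)) * aval (v (n0 + M * t)%N).
  rewrite -avalD; congr aval.
  have vE n : v n = vt n + y *~ n.
    rewrite phaseB betaE -addrA [X in _ + X](_ : _ = 0) ?addr0 //.
    apply/eqP; rewrite addrC subr_eq0; apply/eqP; congr (_ *~ _).
    by case: n => n /=; rewrite ?bin1 // addn1 NegzE expr1 mulN1r.
  have vtMP k : vt (k + P%:Z) = vt k by rewrite -iter_shiftE vtP.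
  have vtMP' j k : vt (k + (j * P)%:Z) = vt k.
    elim: j k => [|j IHj] k; first by rewrite addr0.
    by rewrite mulSn PoszD addrA IHj vtMP.
  rewrite !vE mulnDr addnA PoszD vtMP' addrCA; congr (_ + _).
  by rewrite mulrzDr addrC -pmulrn.
have vb : bnd (fun t => aval (v (n0 + M * t)%N)) by exact: bnd_aval.
have := mean_shift meanL P vb.
rewrite (_ : (fun n => _) = (fun n => aval (y *+ (M * P)) * aval (v (n0 + M * n)%N))).
  rewrite meanZ // => /eqP; rewrite -subr_eq0 -[X in _ - X]mul1r -mulrBl mulf_eq0.
  rewrite (negbTE Lv) orbF subr_eq0 => /eqP; rewrite -(@aval0 R) => /aval_inj y0.
  case: zt; rewrite -yz; exists (M * P)%N; first by rewrite muln_gt0 M0.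
  by rewrite mulrnAC y0 mul0rn.
by apply/funext => t; rewrite fP.
Qed.

End Weyl.

(** * Simultaneous recurrence *)

Section Recurrence.
Variable R : realType.
Notation C := (Cplx R).
Notation A := (acirc R).

Lemma bernoulli (x : R) n : -1 <= x -> 1 + x *+ n <= (1 + x) ^+ n.
Proof.
move=> x1; elim: n => [|n IH]; first by rewrite mulr0n addr0 expr0.
have x10 : 0 <= 1 + x by lra.
rewrite exprS; apply: le_trans (ler_wpM2l x10 IH).
have : 0 <= x ^+ 2 *+ n by rewrite mulrn_wge0 // sqr_ge0.
rewrite mulrDl mul1r mulrDr mulr1 mulrnAr -expr2 mulrS => h.
by move: h; move: (x *+ n) (x ^+ 2 *+ n) => a b; lra.
Qed.

(** Bernoulli's inequality is used twice: to find p < 1 with q <= p^r for the positive exponent r,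
    then n with p^n (n + 1) < 1. *)
Lemma geometric_lt_poly (q : R) (r : nat) : 0 < q -> q < 1 ->
  exists n, q ^+ n * n.+1%:R ^+ r < 1.
Proof.
move=> q0 q1; case: r => [|r]; first by exists 1%N; rewrite expr1 expr0 mulr1.
have r0 : 0 < r.+1%:R :> R by rewrite ltr0n.
pose p : R := 1 + (- ((1 - q) / r.+1%:R)).
have qp : q <= p ^+ r.+1.
  have := @bernoulli (- ((1 - q) / r.+1%:R)) r.+1.
  rewrite -[(- _) *+ r.+1]mulr_natr mulNr divfK ?gt_eqF // subKr; apply.
  by rewrite lerN2 ler_pdivrMr // mul1r; apply: (@le_trans _ _ 1); [lra | rewrite ler1n].
have p1 : p < 1 by rewrite /p gtrDl oppr_lt0 divr_gt0 // subr_gt0.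
have p0 : 0 < p.
  rewrite /p subr_gt0 ltr_pdivrMr // mul1r; apply: (@lt_le_trans _ _ 1); [lra|].
  by rewrite ler1n.
pose h := p^-1 - 1.
have h0 : 0 < h by rewrite subr_gt0 invf_gt1.
(* m h^2 > 2 makes (1 + h m)^2 larger than 2 m + 1. *)
pose m := (Num.truncn (2 / h ^+ 2)).+1.
have mh : 2 < m%:R * h ^+ 2.
  by rewrite -ltr_pdivrMr ?exprn_gt0 // truncnS_gt.
exists (m * 2)%N.
have key : p ^+ (m * 2) * (m * 2).+1%:R < 1.
  rewrite -ltr_pdivlMl ?exprn_gt0 // mulr1 -exprVn.
  have -> : p^-1 = 1 + h by rewrite /h addrC subrK.
  have bm : 1 + h *+ m <= (1 + h) ^+ m by apply: bernoulli; lra.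
  rewrite exprM; apply: (@lt_le_trans _ _ ((1 + h *+ m) ^+ 2)).
    rewrite -natr1 natrM -[h *+ m]mulr_natl.
    have m1 : 1 <= m%:R :> R by rewrite ler1n.
    by move: mh m1 h0; move: (m%:R : R) => a; nra.
  by rewrite ler_pXn2r // ?nnegrE ?addr_ge0 ?mulrn_wge0 ?exprn_ge0 // ltW // addr_gt0.
apply: (@le_lt_trans _ _ ((p ^+ (m * 2) * (m * 2).+1%:R) ^+ r.+1)).
  rewrite exprMn -[p ^+ _ ^+ _]exprM [(m * 2 * _)%N]mulnC [p ^+ _]exprM.
  rewrite ler_pM2r ?exprn_gt0 ?ltr0n // ler_pXn2r // nnegrE ?exprn_ge0 //; exact: ltW.
by rewrite exprn_ilt1 // mulr_ge0 ?exprn_ge0 ?ler0n // ltW.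
Qed.

Lemma parallelogram (a : C) : `|a| = 1 ->
  `|(1 + a) / 2| ^+ 2 = 1 - `|a - 1| ^+ 2 / 4.
Proof.
move=> a1; have aa : a * a^* = 1 by rewrite -normCK a1 expr1n.
rewrite !normCK rmorphM fmorphV rmorph_nat rmorphB rmorphD !rmorph1 /=.
transitivity ((1 + a * a^* + a + a^*) / 4); first by field.
transitivity (1 - (1 + a * a^* - a - a^*) / 4); last by congr (_ - _); field.
by rewrite aa; field.
Qed.

Variables (L : (nat -> C) -> C) (meanL : is_mean L).

(* The weights of [prod_i ((1 + z_i) / 2) ^ d] as a trigonometric polynomial. *)
Definition bweight r d (c : {ffun 'I_r -> 'I_d.+1}) : R :=
  \prod_i ('C(d, c i)%:R / 2 ^+ d).

Lemma bweight_ge0 r d (c : {ffun 'I_r -> 'I_d.+1}) : 0 <= bweight c.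
Proof. by apply: prodr_ge0 => i _; rewrite divr_ge0 ?ler0n ?exprn_ge0. Qed.

Lemma half_pow (K : numFieldType) (a : K) d :
  ((1 + a) / 2) ^+ d = \sum_(j < d.+1) 'C(d, j)%:R / 2 ^+ d * a ^+ j.
Proof.
rewrite exprMn exprDn mulr_suml exprVn; apply: eq_bigr => j _.
by rewrite expr1n mul1r -[_ *+ _]mulr_natl mulrAC.
Qed.

Lemma bweight_sum r d : \sum_(c : {ffun 'I_r -> 'I_d.+1}) bweight c = 1.
Proof.
rewrite -(bigA_distr_bigA (fun (i : 'I_r) (j : 'I_d.+1) => 'C(d, j)%:R / 2 ^+ d)).
apply: big1 => i _; transitivity (((1 + 1) / 2 : R) ^+ d).
  by rewrite half_pow; apply: eq_bigr => j _; rewrite expr1n mulr1.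
by rewrite -[1 + 1]/(2%:R) divff ?expr1n // pnatr_eq0.
Qed.

Lemma bweight_kernel r d (z : 'I_r -> A) :
  \prod_i ((1 + aval (z i)) / 2) ^+ d =
  \sum_(c : {ffun 'I_r -> 'I_d.+1}) (bweight c)%:C%C * aval (\sum_i z i *+ c i).
Proof.
under eq_bigr => i _ do rewrite half_pow.
rewrite bigA_distr_bigA; apply: eq_bigr => c _.
rewrite aval_sum big_split /= rmorph_prod; congr (_ * _); apply: eq_bigr => i _.
  by rewrite rmorphM fmorphV rmorphXn !rmorph_nat.
by rewrite avalMn.
Qed.

(** Cauchy-Schwarz for (d + 1)^r weights of sum 1, in the form of the nonnegativity of their squared
    distance to the uniform weights. *)
Lemma bweight_sqr r d : ((d.+1 ^ r)%:R)^-1 <=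
  \sum_(c : {ffun 'I_r -> 'I_d.+1}) bweight c ^+ 2.
Proof.
set K : R := (d.+1 ^ r)%:R; have K0 : K != 0 by rewrite pnatr_eq0 -lt0n expn_gt0.
have : 0 <= \sum_(c : {ffun 'I_r -> 'I_d.+1}) (bweight c - K^-1) ^+ 2.
  by apply: sumr_ge0 => c _; exact: sqr_ge0.
have sqE c : (bweight c - K^-1) ^+ 2 =
    bweight c ^+ 2 + (- (2 * K^-1)) * bweight c + K^-1 ^+ 2 by ring.
under eq_bigr => c _ do rewrite sqE.
rewrite !big_split /= -mulr_sumr bweight_sum mulr1.
rewrite sumr_const card_ffun !card_ord -[_ *+ (d.+1 ^ r)]mulr_natr -/K.
rewrite expr2 -mulrA mulVf // mulr1; set S := \sum_(_ | _) _; lra.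
Qed.

(* If all [z_i] stayed away from [1] simultaneously, the kernel would be
   exponentially small, whereas the mean of its squared modulus is only
   polynomially small by Cauchy-Schwarz. *)
Lemma trig_recurrence (r : nat) (e : R) : 0 < e -> exists d : nat,
  forall z : 'I_r -> nat -> A,
  (forall c c' : {ffun 'I_r -> 'I_d.+1},
    0 <= L (fun t => aval (\sum_i z i t *+ c i - \sum_i z i t *+ c' i))) ->
  exists t, forall i, `|aval (z i t) - 1| <= e%:C%C.
Proof.
(* Capping at 1 keeps q in ]0, 1[. *)
move=> e0; pose e1 := Num.min e 1.
have e10 : 0 < e1 by rewrite lt_min e0 ltr01.
have e11 : e1 <= 1 by rewrite ge_min lexx orbT.
pose q := 1 - e1 ^+ 2 / 4.
have e1s : e1 ^+ 2 <= 1 by rewrite exprn_ile1 // ltW.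
have e1s0 : 0 < e1 ^+ 2 by rewrite exprn_gt0.
have [||d dq] := @geometric_lt_poly q r; rewrite /q; [lra|lra|].
(* d depends on r and e alone: in [good_density] the progression defining z is chosen after d. *)
exists d => z zpos; apply: contrapT => nt.
pose g t := \prod_i ((1 + aval (z i t)) / 2) ^+ d.
have gE t : g t = \sum_(c : {ffun 'I_r -> 'I_d.+1})
    (bweight c)%:C%C * aval (\sum_i z i t *+ c i) by exact: bweight_kernel.
(* One factor has |z - 1| > e, so its squared modulus is at most q by [parallelogram]; the other
   factors are at most 1. *)
have gle t : g t * (g t)^* <= (q ^+ d)%:C%C.
  have [i zi] : exists i, ~ `|aval (z i t) - 1| <= e%:C%C.
    apply: contrapT => h; apply: nt; exists t => i.
    by apply: contrapT => zi; apply: h; exists i.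
  rewrite -normCK /g normr_prod (bigD1 i) //= exprMn -[X in _ <= X]mulr1.
  have h1 j : `|((1 + aval (z j t)) / 2) ^+ d| <= 1.
    rewrite normrX exprn_ile1 // -(@ler_pXn2r _ 2) ?nnegrE // expr1n.
    by rewrite parallelogram ?aval_norm // gerBl divr_ge0 ?exprn_ge0.
  apply: ler_pM; rewrite ?exprn_ge0 ?prodr_ge0 //; last first.
    by rewrite exprn_ile1 ?prodr_ge0 // prodr_ile1 // => j _; rewrite normr_ge0 h1.
  rewrite normrX -exprM mulnC exprM rmorphXn; apply: lerXn2r.
  - by rewrite nnegrE exprn_ge0.
  - by rewrite nnegrE ler0c /q; lra.
  rewrite parallelogram ?aval_norm // /q.
  have [s sE] := normC_real (aval (z i t) - 1).
  rewrite sE -rmorphXn.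
  have -> : 1 - (s ^+ 2)%:C%C / 4 = (1 - s ^+ 2 / 4)%:C%C :> C.
    by rewrite rmorphB /= rmorph1; congr (_ - _); rewrite [RHS]rmorphM fmorphV rmorph_nat.
  rewrite lecR; move: zi; rewrite sE lecR => /negP; rewrite -ltNge => es.
  have : e1 ^+ 2 <= s ^+ 2.
    have e1e : e1 <= e by rewrite ge_min lexx.
    by rewrite ler_pXn2r // ?nnegrE; lra.
  lra.
pose w (c : {ffun 'I_r -> 'I_d.+1}) t : C :=
  (bweight c)%:C%C * aval (\sum_i z i t *+ c i).
have gb : bnd g.
  have [M hM] : bnd (fun t => \sum_c w c t).
    by apply: bnd_sum => c; apply: bndZ; exact: bnd_aval.
  by exists M => t; rewrite gE; exact: hM.
pose W (c c' : {ffun 'I_r -> 'I_d.+1}) : C := (bweight c * bweight c')%:C%C.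
pose a (c c' : {ffun 'I_r -> 'I_d.+1}) t :=
  aval (\sum_i z i t *+ c i - \sum_i z i t *+ c' i).
have ggE t : g t * (g t)^* = \sum_c \sum_c' W c c' * a c c' t.
  rewrite gE rmorph_sum big_distrl; apply: eq_bigr => c _.
  rewrite big_distrr; apply: eq_bigr => c' _ /=.
  rewrite rmorphM /W rmorphM /= mulrACA /a avalB; congr (_ * _ * (_ * _)).
    by rewrite conj_Creal //; apply/complex_realP; exists (bweight c').
  by rewrite [RHS]invC_norm aval_norm expr1n invr1 mul1r.
have ab c c' : bnd (fun t => W c c' * a c c' t) by apply: bndZ; exact: bnd_aval.
have Lgg : L (fun t => g t * (g t)^*) = \sum_c \sum_c' W c c' * L (a c c').
  rewrite (_ : (fun t => _) = (fun t => \sum_c \sum_c' W c c' * a c c' t)).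
    rewrite (mean_sum meanL _ (fun c => bnd_sum (index_enum _) (ab c))).
    apply: eq_bigr => c _; rewrite (mean_sum meanL _ (ab c)).
    by apply: eq_bigr => c' _; rewrite meanZ //; exact: bnd_aval.
  by apply/funext => t; rewrite ggE.
have up : L (fun t => g t * (g t)^*) <= (q ^+ d)%:C%C.
  rewrite -(mean_cst meanL (q ^+ d)%:C%C); apply: mean_le => //.
    by apply: bndM => //; exact: bnd_conj.
  exact: bnd_cst.
have Wge0 c c' : 0 <= W c c' by rewrite ler0c mulr_ge0 // bweight_ge0.
(* Only the diagonal terms are kept; by [zpos] the others are nonnegative. *)
have low : (\sum_(c : {ffun 'I_r -> 'I_d.+1}) bweight c ^+ 2)%:C%C <=
    L (fun t => g t * (g t)^*).
  rewrite Lgg rmorph_sum; apply: ler_sum => c _.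
  rewrite (bigD1 c) //= -[X in X <= _]addr0; apply: lerD; last first.
    by apply: sumr_ge0 => c' _; rewrite mulr_ge0 // zpos.
  rewrite (_ : L (a c c) = 1) ?mulr1 // -[RHS](mean_cst meanL); congr L.
  by apply/funext => t; rewrite /a subrr aval0.
have := le_trans low up; rewrite lecR => /(le_trans (bweight_sqr r d)).
have K0 : 0 < (d.+1 ^ r)%:R :> R by rewrite ltr0n expn_gt0.
rewrite -[_^-1]mul1r ler_pdivrMr // natrX => h.
by move: (le_lt_trans h dq); rewrite ltxx.
Qed.

End Recurrence.

(** * The group of limits of translations *)

Lemma dvdn_fact2 m n : (m <= n)%N -> (m`! %| n`!)%N.
Proof.
move=> /subnK <-; elim: (n - m)%N => // k IH.
by rewrite addSn factS dvdn_mull.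
Qed.

Lemma ultra_directed (T I : Type) (S : I -> set T) (i0 : I) :
  (forall i j, exists k, S k `<=` S i `&` S j) -> (forall i, S i !=set0) ->
  exists U : set_system T, UltraFilter U /\ forall i, U (S i).
Proof.
move=> dir ne.
have FF : ProperFilter (filter_from [set: I] S).
  apply: filter_from_proper => [|i _]; last exact: ne.
  apply: filter_from_filter => [|i j _ _]; first by exists i0.
  by have [k Sk] := dir i j; exists k.
have [U [UU sU]] := ultraFilterLemma FF; exists U; split => // i.
by apply: sU; exists i.
Qed.

Section Good.
Variable R : realType.
Notation C := (Cplx R).
Notation A := (acirc R).
Notation phase := (phase R).
Notation D := (@D R).
Notation pshift := (@pshift R).
Implicit Types u v w : phase.

(* These are the operators [u |-> (n |-> lim_U u(n + m))] for [U] an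
   ultrafilter of integers, i.e. the elements of the enveloping semigroup of
   the translation acting on polynomial phases. *)
Definition good (G : {additive phase -> phase}) := [/\
  forall u, G (pshift u) = pshift (G u),
  forall x, G (pcst x) = pcst x
  & forall N d, (0 < N)%N -> exists n, forall u,
      iter d D u = 0 -> D u *+ N = 0 -> G u = iter n pshift u].

Lemma good_D G u : good G -> G (D u) = D (G u).
Proof. by case=> h _ _; rewrite !DdefE raddfB h. Qed.

Lemma good_iterD G d u : good G -> G (iter d D u) = iter d D (G u).
Proof. by move=> gG; elim: d => //= d IH; rewrite good_D // IH. Qed.

Lemma good_deg G d u : good G -> iter d D u = 0 -> iter d D (G u) = 0.
Proof. by move=> gG ud; rewrite -good_iterD // ud raddf0. Qed.

Lemma good_ext G H : good G -> good H -> (forall u, G u 0 = H u 0) -> G =1 H.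
Proof.
move=> gG gH GH u; apply/eqP; rewrite -subr_eq0; apply/eqP; apply: phase_eq0 => k.
by rewrite raddfB phaseB /= -!good_iterD // GH subrr.
Qed.

Lemma aval_dist (x y : A) : `|aval x - aval y| = `|aval (x - y) - 1|.
Proof.
rewrite avalB -(divff (aval_neq0 y)) -mulrBl normrM normfV aval_norm.
by rewrite invr1 mulr1.
Qed.

(** Consider the integer combinations of the phases of s that occur in the kernel. On the torsion
    ones, G is a power n0 of the shift and M is a common period, so their values on n0 + M t agree
    with those of G and the mean is 1. The others have mean 0 by Weyl. All means are thus
    nonnegative, and recurrence applies. *)
Lemma good_density G (s : seq phase) (e : R) : good G -> 0 < e ->
  exists m : nat, forall u, u \in s -> `|aval (u m) - aval (G u 0)| <= e%:C%C.
Proof.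
move=> gG e0; have [L meanL] := mean_exists R.
have [d dP] := trig_recurrence meanL (size s) e0.
pose r := size s; pose u (i : 'I_r) := s`_i.
pose J := ({ffun 'I_r -> 'I_d.+1} * {ffun 'I_r -> 'I_d.+1})%type.
pose v (p : J) : phase := \sum_i u i *+ p.1 i - \sum_i u i *+ p.2 i.
have /choice[N NP] : forall p : J, exists N, (0 < N)%N /\
    (torsion_phase (v p) -> D (v p) *+ N = 0).
  move=> p; have [[N N0 vN]|nt] := pselect (torsion_phase (v p)).
    by exists N.
  by exists 1%N.
have /choice[E EP] := fun p : J => iterD_nil (v p).
pose NN := (\prod_p N p)%N; pose EE := \max_p E p.
have NN0 : (0 < NN)%N by apply: prodn_gt0 => p; case: (NP p).
have vNN p : torsion_phase (v p) -> D (v p) *+ NN = 0.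
  by case: (NP p) => _ h /h vN; rewrite /NN (bigD1 p) //= mulrnA vN mul0rn.
have vEE p : iter EE D (v p) = 0.
  by rewrite -(subnK (leq_bigmax p : E p <= EE)%N) iterD EP raddf0.
have [_ _ /(_ NN EE NN0)[n0 n0P]] := gG.
pose M := (NN ^ EE)%N; have M0 : (0 < M)%N by rewrite expn_gt0 NN0.
pose z (i : 'I_r) t := u i (n0 + M * t)%N - G (u i) 0.
have lin (F : 'I_r -> phase) (c c' : {ffun 'I_r -> 'I_d.+1}) n :
    (\sum_i F i *+ c i - \sum_i F i *+ c' i) n =
    \sum_i F i n *+ c i - \sum_i F i n *+ c' i.
  rewrite phaseB !phase_sum.
  by congr (_ - _); apply: eq_bigr => i _; rewrite phaseMn.
have Gv p : G (v p) = \sum_i G (u i) *+ p.1 i - \sum_i G (u i) *+ p.2 i.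
  have Gs (c : {ffun 'I_r -> 'I_d.+1}) :
      G (\sum_i u i *+ c i) = \sum_i G (u i) *+ c i.
    by rewrite raddf_sum; apply: eq_bigr => i _; rewrite raddfMn.
  by rewrite raddfB /= !Gs.
have zE (c c' : {ffun 'I_r -> 'I_d.+1}) t :
    \sum_i z i t *+ c i - \sum_i z i t *+ c' i =
    v (c, c') (n0 + M * t)%N - G (v (c, c')) 0.
  rewrite Gv !lin subrACA -!sumrB.
  by apply: eq_bigr => i _; rewrite /z !mulrnBl.
have [t tP] : exists t, forall i : 'I_r, `|aval (z i t) - 1| <= e%:C%C.
  apply: dP => c c'; set p := (c, c').
  have [tp|nt] := pselect (torsion_phase (v p)).
    rewrite (_ : (fun t => _) = (fun=> 1)) ?(mean1 meanL) ?ler01 //.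
    apply/funext => t; rewrite zE -(@aval0 R); congr aval.
    rewrite -[(n0 + M * t)%N%:Z]add0r -iter_shiftE iterD.
    rewrite (n0P _ (vEE p) (vNN p tp)).
    rewrite (_ : iter (M * t) pshift (v p) = v p) ?subrr //.
    elim: t => [|t IH]; first by rewrite muln0.
    by rewrite mulnS iterD IH phase_period // vNN.
  rewrite (_ : (fun t => _) =
    (fun t => aval (- G (v p) 0) * aval (v p (n0 + M * t)%N))); last first.
    by apply/funext => t; rewrite zE addrC avalD.
  rewrite (meanZ meanL); last exact: bnd_aval.
  have [->|/(weyl meanL (vEE p) M0)//] := eqVneq (L (fun t => aval (v p (n0 + M * t)%N))) 0.
  by rewrite mulr0.
exists (n0 + M * t)%N => w ws.
have wi : (index w s < r)%N by rewrite index_mem.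
have := tP (Ordinal wi); rewrite /z /u /= nth_index // => h.
by rewrite aval_dist.
Qed.

Lemma good_ultra G : good G -> exists U : set_system nat, UltraFilter U /\
  forall u, (fun m : nat => u m) @ U --> G u 0.
Proof.
move=> gG.
pose S (p : seq phase * {posnum R}) := [set m : nat |
  forall u, u \in p.1 -> `|aval (u m) - aval (G u 0)| <= (p.2%:num)%:C%C].
have [||U [UU US]] := @ultra_directed _ _ S ([::], 1%:pos).
- move=> [s e] [s' e'].
  have m0 : 0 < Num.min e%:num e'%:num by rewrite lt_min; apply/andP.
  exists (s ++ s', PosNum m0).
  move=> m h; split => u us; (apply: (le_trans (h u _)); first by rewrite mem_cat us ?orbT);
    by rewrite lecR /= ge_min lexx ?orbT.
- move=> [s e]; have [|m hm] := @good_density G s e%:num gG; first by [].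
  by exists m.
exists U; split => // u; apply/cvg_aval/cvgC_dist => e e0.
have [d ed] : exists d, e = d%:C%C by apply/complex_realP; exact: gtr0_real.
have d0 : 0 < d by rewrite -ltcR -ed.
apply: filterS (US ([:: u], PosNum d0)) => m /(_ u); rewrite ed; apply.
by rewrite inE.
Qed.

Section UltraOp.
Variable U : set_system int.
Context {UU : UltraFilter U}.

Definition ulim (u : int -> A) : A := xget 0 [set x : A | u @ U --> x].

Lemma ulimP (u : int -> A) : u @ U --> ulim u.
Proof.
have [x ux] := @ultra_acirc R int U u UU.
exact: (@xgetPex _ 0 [set x : A | u @ U --> x] (ex_intro _ x ux)).
Qed.

Lemma ulim_eq (u : int -> A) x : u @ U --> x -> ulim u = x.
Proof. by move=> ux; exact: (cvgA_unique (@ulimP u) ux). Qed.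

Lemma ulimB (u v : int -> A) : ulim (fun n => u n - v n) = ulim u - ulim v.
Proof. by apply: ulim_eq; apply: cvgAB; exact: ulimP. Qed.

Lemma ulim_cst (x : A) : ulim (fun=> x) = x.
Proof. by apply: ulim_eq; exact: cvg_cst. Qed.

Lemma uop_subproof u : is_phase (fun n => ulim (fun m => u (n + m))).
Proof.
have [d ud] := iterD_nil u; apply/asboolP; exists d.
have -> : iter d (@dif R) (fun n => ulim (fun m => u (n + m))) =
    fun n => ulim (fun m => iter d D u (n + m)).
  elim: d {ud} => //= d ->; apply/funext => n; rewrite /dif -ulimB.
  by congr ulim; apply/funext => m; rewrite DE addrAC.
by apply/funext => n; rewrite ud ulim_cst.
Qed.

Definition uop u : phase := Phase (uop_subproof u).
Arguments uop : simpl never.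

Lemma uop_is_additive : {morph uop : u v / u - v}.
Proof. by move=> u v; apply: phase_ext => n; rewrite phaseB -ulimB. Qed.

HB.instance Definition _ :=
  GRing.isZmodMorphism.Build phase phase uop uop_is_additive.

Lemma uopE u n : uop u n = ulim (fun m => u (n + m)). Proof. by []. Qed.

Lemma uop_at0 u : uop u 0 = ulim u.
Proof. by rewrite uopE; congr ulim; apply/funext => m; rewrite add0r. Qed.

Lemma good_uop : good uop.
Proof.
split=> [u|x|N d N0].
- apply: phase_ext => n /=; rewrite shiftE !uopE; congr ulim; apply/funext => m.
  by rewrite shiftE addrAC.
- by apply: phase_ext => n /=; rewrite uopE ulim_cst.
pose P := (N ^ d)%N; have P0 : (0 < P)%N by rewrite expn_gt0 N0.
(* The ultrafilter selects a residue class modulo P, a common period of the phases concerned. *)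
have [m|n nP Un] := @ultra_bigcup int U P (fun n => [set m | (m %% P)%Z = n%:Z]) UU.
  have Pn0 : P%:Z != 0 by rewrite eqz_nat -lt0n.
  have := ltz_pmod m (P0 : (0 < P%:Z)%R); have := modz_ge0 m Pn0.
  by case E : (m %% P)%Z => [k|k] // _ kP; exists k.
exists n => u ud uN; apply: phase_ext => k /=; rewrite uopE iter_shiftE.
apply: ulim_eq; apply: cvg_near_cst; apply: filterS Un => m /= mn; apply/eqP.
have uP j l : u (l + (j * P)%N%:Z) = u l.
  elim: j l => [|j IH] l; first by rewrite addr0.
  by rewrite mulSn PoszD addrA IH -iter_shiftE phase_period.
have uPz (q : int) l : u (l + q * P%:Z) = u l.
  case: q => j; first by rewrite -PoszM uP.
  by rewrite -(uP j.+1) NegzE PoszM mulNr subrK.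
by rewrite {1}(divz_eq m P) mn addrCA addrC uPz.
Qed.

End UltraOp.

Lemma good_is_uop G : good G -> exists U : set_system int,
  exists UU : UltraFilter U, G =1 @uop U UU.
Proof.
move=> gG; have [U [UU UG]] := good_ultra gG.
exists (Posz @ U), (ultra_fmap Posz UU).
apply: good_ext => //; first exact: good_uop.
move=> u /=; rewrite uop_at0; apply/esym.
exact: (@ulim_eq (Posz @ U) (ultra_fmap Posz UU) u _ (UG u)).
Qed.

Lemma good_comp G H : good G -> good H -> good (G \o H).
Proof.
move=> gG gH; have [G1 G2 G3] := gG; have [H1 H2 H3] := gH; split=> [u|x|N d N0] /=.
- by rewrite H1 G1.
- by rewrite H2 G2.
have [n nP] := G3 N d N0; have [m mP] := H3 N d N0; exists (n + m)%N => u ud uN.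
rewrite nP ?iterD -?mP //; first exact: good_deg.
by rewrite -good_D // -raddfMn uN raddf0.
Qed.

Lemma antidif d w : iter d D w = 0 -> exists2 u, D u = w & iter d.+1 D u = 0.
Proof.
move=> wd; set u : phase := \sum_(k < d) beta k.+1 (iter k D w 0).
have Du : D u = w.
  rewrite [RHS](phase_beta wd) raddf_sum; apply: eq_bigr => k _.
  exact: D_beta.
by exists u => //; rewrite iterSr Du.
Qed.

Lemma good_inj G u : good G -> G u = 0 -> u = 0.
Proof.
move=> gG; have [d ud] := iterD_nil u; elim: d u ud => // d IH u.
rewrite iterSr => ud Gu.
have Du : D u = 0 by apply: IH => //; rewrite good_D // Gu raddf0.
move: Gu; rewrite (D_eq0 Du); case: gG => _ -> _ /(congr1 (fun u : phase => u 0)).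
by rewrite !pcstE => ->; rewrite raddf0.
Qed.

(** By induction on the degree: a preimage of [D v] is summed to a phase u, and G u differs from v
    by a constant, which G fixes. *)
Lemma good_surj G v : good G -> exists u, G u = v.
Proof.
move=> gG; have [d vd] := iterD_nil v; elim: d v vd => [v /= ->|d IH v].
  by exists 0; rewrite raddf0.
rewrite iterSr => /IH[w Gw]; have [e we] := iterD_nil w.
have [u Du _] := antidif we.
have : D (v - G u) = 0 by rewrite raddfB /= -good_D // Du Gw subrr.
move=> /D_eq0; set c := _ 0 => vc; exists (u + pcst c).
by rewrite raddfD /=; case: gG => _ -> _; rewrite -vc addrC subrK.
Qed.

Lemma good_inv G : good G -> exists H : {additive phase -> phase},
  [/\ good H, cancel G H & cancel H G].
Proof.
move=> gG; have [G1 G2 G3] := gG.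
have /choice[h hP] : forall v, exists u, G u = v by move=> v; exact: good_surj.
have hK : cancel G h.
  move=> u; apply/eqP; rewrite -subr_eq0; apply/eqP; apply: (good_inj gG).
  by rewrite raddfB /= hP subrr.
have hB : {morph h : u v / u - v}.
  by move=> u v; rewrite -[RHS]hK raddfB /= !hP.
pose H : {additive phase -> phase} :=
  HB.pack h (GRing.isZmodMorphism.Build phase phase h hB).
exists H; split=> //; split=> [u|x|N d N0] /=.
- by rewrite -[RHS]hK G1 hP.
- by rewrite -[RHS]hK G2.
(* A natural number congruent to -n modulo the period N^d. *)
have [n nP] := G3 N d N0; exists (N ^ d * n - n)%N => u ud uN.
rewrite -[RHS]hK nP.
- rewrite -iterD subnKC; last by rewrite leq_pmull // expn_gt0 N0.
  congr h; elim: n {nP} => [|n IH]; first by rewrite muln0.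
  by rewrite mulnS iterD -IH phase_period.
- by rewrite iter_shift_D ud raddf0.
- set k := (_ - _)%N; have -> : D (iter k pshift u) = iter k pshift (D u).
    by rewrite -[LHS]/(iter 1 D (iter k pshift u)) iter_shift_D.
  by rewrite -raddfMn uN raddf0.
Qed.

Lemma pert_is_additive (f : {additive A -> A}) m :
  {morph (fun u : phase => u + hcomp f (iter m D u)) : u v / u - v}.
Proof. by move=> u v; rewrite !raddfB /= opprD addrACA. Qed.

Definition pert f m : {additive phase -> phase} :=
  HB.pack (fun u : phase => u + hcomp f (iter m D u))
    (GRing.isZmodMorphism.Build phase phase _ (pert_is_additive f m)).

Lemma pertE f m u : pert f m u = u + hcomp f (iter m D u). Proof. by []. Qed.

Definition kills_torsion (f : A -> A) := forall x, torsion x -> f x = 0.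

Lemma torsion_values u N : (0 < N)%N -> u *+ N = 0 -> forall n, torsion (u n).
Proof. by move=> N0 uN n; exists N => //; rewrite -phaseMn uN. Qed.

(** On a torsion phase, D^m u has torsion values because m > 0, so the operator is the identity
    there: the power 0 of the shift. *)
Lemma good_pert (f : {additive A -> A}) m : kills_torsion f -> (0 < m)%N ->
  good (pert f m).
Proof.
move=> f0 m0; split=> [u|x|N d N0].
- by rewrite !pertE raddfD /= shift_hcomp -iterD_shift.
- by case: m m0 => // m _; rewrite pertE iterD_cst raddf0 addr0.
exists 0%N => u ud uN; rewrite pertE /=.
rewrite (_ : hcomp f _ = 0) ?addr0 //; apply: phase_ext => n; rewrite hcompE.
apply: f0; apply: torsion_values N0 _ n; case: m m0 => // m _.
by rewrite iterSr -raddfMn uN raddf0.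
Qed.

Lemma powf_is_additive (G : {additive phase -> phase}) (f : {additive A -> A}) :
  {morph (fun u : phase => u + hcomp f (G u - u)) : u v / u - v}.
Proof. by move=> u v; rewrite [G (u - v)]raddfB subrACA raddfB opprD addrACA. Qed.

(* The limit of the powers [G ^+ m] as [m] tends to [f] in the Bohr
   compactification of the integers and ['C(m, k)] tends to [0], [k >= 2]. *)
Definition powf (G : {additive phase -> phase}) (f : {additive A -> A}) :
    {additive phase -> phase} :=
  HB.pack (fun u : phase => u + hcomp f (G u - u))
    (GRing.isZmodMorphism.Build phase phase _ (powf_is_additive G f)).

Lemma powfE G f u : powf G f u = u + hcomp f (G u - u). Proof. by []. Qed.

(** On a phase u with [D u *+ N = 0], G is a power of the shift and [u *+ N] is constant; hence G u
    - u is killed by N, and then by f. *)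
Lemma good_powf G (f : {additive A -> A}) : kills_torsion f -> good G ->
  good (powf G f).
Proof.
move=> f0 [G1 G2 G3]; split=> [u|x|N d N0].
- by rewrite !powfE [pshift (_ + _)]raddfD /= shift_hcomp [pshift (_ - _)]raddfB /= G1.
- by rewrite powfE G2 subrr raddf0 addr0.
have [n nP] := G3 N d N0; exists 0%N => u ud uN; rewrite powfE /=.
rewrite (_ : hcomp f _ = 0) ?addr0 //; apply: phase_ext => k; rewrite hcompE.
apply: f0; apply: torsion_values N0 _ k; rewrite nP // mulrnBl -raddfMn /=.
by rewrite (D_eq0 (_ : D (u *+ N) = 0)) ?raddfMn // iter_shift_cst subrr.
Qed.

(** f is a limit of the maps z |-> m z along an ultrafilter on m. Divisibility of m by every N!
    makes f vanish on torsion; m x can moreover be brought close to y by recurrence, since x has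
    infinite order and Weyl's theorem makes all nontrivial means vanish. *)
Lemma hom_exists (x y : A) : ~ torsion x ->
  exists f : {additive A -> A}, kills_torsion f /\ f x = y.
Proof.
move=> xt.
have nt a b M : (0 < M)%N -> (b < a)%N -> (x *+ a - x *+ b) *+ M <> 0.
  move=> M0 ba xM; apply: xt; exists ((a - b) * M)%N.
    by rewrite muln_gt0 subn_gt0 ba.
  by rewrite mulrnA mulrnBr // ltnW.
have dens N (e : R) : 0 < e ->
    exists t, `|aval (x *+ (N`! * t) - y) - 1| <= e%:C%C.
  move=> e0; have [L meanL] := mean_exists R.
  have [d dP] := trig_recurrence meanL 1 e0.
  have [|t /(_ ord0) tP] := dP (fun _ t => x *+ (N`! * t) - y); last by exists t.
  move=> c c'; set k := nat_of_ord (c ord0); set k' := nat_of_ord (c' ord0).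
  have [kk'|kk'] := eqVneq k k'.
    rewrite (_ : (fun t => _) = (fun=> 1)) ?(mean1 meanL) ?ler01 //.
    by apply/funext => t; rewrite !big_ord1 -/k -/k' kk' subrr.
  pose v : phase := beta 1 (x *+ k - x *+ k').
  rewrite (_ : (fun t => _) =
      (fun t => aval (- (y *+ k - y *+ k')) * aval (v (0 + N`! * t)%N))); last first.
    apply/funext => t; rewrite !big_ord1 -/k -/k' -avalD; congr aval.
    rewrite /v beta_nat bin1 add0n !mulrnBl -!mulrnA ![(_ * (N`! * t))%N]mulnC.
    by rewrite subrACA addrC.
  rewrite (meanZ meanL); last exact: bnd_aval.
  have [->|/(weyl meanL (iterD_beta0 _ _) (fact_gt0 N))] :=
    eqVneq (L (fun t => aval (v (0 + N`! * t)%N))) 0; first by rewrite mulr0.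
  case=> M M0; rewrite /v D_beta beta0 => /(congr1 (fun u : phase => u 0)).
  rewrite phaseMn pcstE phase0 => xM.
  have [lk|lk|ek] := ltngtP k k'; last by rewrite ek eqxx in kk'.
    by case: (nt k' k M M0 lk); rewrite -opprB mulNrn xM oppr0.
  by case: (nt k k' M M0 lk).
pose S (p : nat * {posnum R}) := [set m : nat |
  (p.1`! %| m)%N /\ `|aval (x *+ m - y) - 1| <= (p.2%:num)%:C%C].
have [||U [UU US]] := @ultra_directed _ _ S (0%N, 1%:pos).
- move=> [N e] [N' e'].
  have m0 : 0 < Num.min e%:num e'%:num by rewrite lt_min; apply/andP.
  exists (maxn N N', PosNum m0).
  move=> m [/= dm h]; split; (split => /=;
    [apply: dvdn_trans dm; apply: dvdn_fact2|
     by apply: (le_trans h); rewrite lecR ge_min lexx ?orbT]).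
  + by rewrite leq_maxl.
  + by rewrite leq_maxr.
- move=> [N e]; have [|t tP] := dens N e%:num; first by [].
  by exists (N`! * t)%N; split => //=; exact: dvdn_mulr.
have /choice[f fP] : forall z : A, exists l : A, (fun m => z *+ m) @ U --> l.
  by move=> z; exact: ultra_acirc.
have fB : {morph f : u v / u - v}.
  move=> u v; apply: (cvgA_unique (fP _)).
  rewrite (_ : (fun m => _) = (fun m => u *+ m - v *+ m)); first exact: cvgAB.
  by apply/funext => m; rewrite mulrnBl.
pose F : {additive A -> A} := HB.pack f (GRing.isZmodMorphism.Build A A f fB).
exists F; split => /=.
  move=> z [N N0 zN]; apply: (cvgA_unique (fP z)); apply: cvg_near_cst.
  apply: filterS (US (N, 1%:pos)) => m [/dvdnP[k ->] _]; apply/eqP.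
  have /dvdnP[j ->] : (N %| N`!)%N by rewrite dvdn_fact // N0 leqnn.
  by rewrite mulnA mulnC mulrnA zN mul0rn.
apply: (cvgA_unique (fP x)); apply/cvg_aval/cvgC_dist => e e0.
have [d ed] : exists d, e = d%:C%C by apply/complex_realP; exact: gtr0_real.
have d0 : 0 < d by rewrite -ltcR -ed.
apply: filterS (US (0%N, PosNum d0)) => m [_ h].
by rewrite aval_dist ed.
Qed.

End Good.

(** * The Stone-Weierstrass theorem *)

(** Otherwise the complements of members of [Q] form a proper filter, and a finer ultrafilter
    contains a member of [Q] with its complement. This is the finite subcover argument, with
    ultrafilters in place of points. *)
Lemma ultra_ideal (T : Type) (Q : set T -> Prop) : Q set0 ->
  (forall S S', S `<=` S' -> Q S' -> Q S) ->
  (forall S S', Q S -> Q S' -> Q (S `|` S')) ->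
  (forall U : set_system T, UltraFilter U -> exists2 S, U S & Q S) -> Q setT.
Proof.
move=> Q0 Qs QU Qu; apply: contrapT => nQ.
pose F : set_system T := [set S | Q (~` S)].
have FF : ProperFilter F.
  split; first by rewrite /F /= setC0.
  split; first by rewrite /F /= setCT.
    by move=> S S' FS FS'; rewrite /F /= setCI; exact: QU.
  by move=> S S' SS' FS; apply: Qs FS; exact: subsetC.
have [U [UU sU]] := ultraFilterLemma FF.
have [S US QS] := Qu U UU.
have UnS : U (~` S) by apply: sU; rewrite /F /= setCK.
by have [t []] := @filter_ex _ U _ _ (filterI US UnS).
Qed.

Section StoneWeierstrass.
Variable R : realType.

(* Newton's iteration for the square root of [x ^+ 2], from below. *)
Fixpoint abs_poly (x : R) (n : nat) : R :=
  if n is m.+1 then abs_poly x m + (x ^+ 2 - abs_poly x m ^+ 2) / 2 else 0.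

Lemma abs_poly_bound (x : R) n : `|x| <= 1 ->
  [/\ 0 <= abs_poly x n, abs_poly x n <= `|x|
    & (`|x| - abs_poly x n) * n.+2%:R <= 2].
Proof.
move=> x1; have x0 := normr_ge0 x.
elim: n => [|n [a0 ax an]] /=; first by rewrite subr0 lexx; split => //; lra.
rewrite -(real_normK (num_real x)); move: x1 x0 an.
rewrite -[n.+3]addn1 natrD; set N : R := n.+2%:R.
have N2 : 2 <= N by rewrite ler_nat.
move: (`|x|) (abs_poly x n) N N2 a0 ax => y a N N2 a0 ay y1 y0 h; split; [nra|nra|].
(* The error e = y - a becomes e - (y^2 - a^2) / 2 <= e - e^2 / 2, and this recursion preserves e <=
   2 / (n + 2). *)
have e2 : (y - a) ^+ 2 / 2 <= (y ^+ 2 - a ^+ 2) / 2 by nra.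
have hs : ((y - a) - (y - a) ^+ 2 / 2) * (N + 1) <= 2.
  move: h; set e := y - a => h.
  have e0 : 0 <= e by rewrite /e; lra.
  have e1 : e <= 1 by rewrite /e; lra.
  have h1 : e * N * (1 - e / 2) <= 2 * (1 - e / 2) by apply: ler_wpM2r => //; lra.
  nra.
apply: le_trans hs; apply: ler_wpM2r; lra.
Qed.

Section Real.
Variables (T : Type) (A : set (T -> R)).
Hypothesis Ac : forall c, A (fun=> c).
Hypothesis AD : forall f g, A f -> A g -> A (fun t => f t + g t).
Hypothesis AM : forall f g, A f -> A g -> A (fun t => f t * g t).
Hypothesis Ab : forall f, A f -> exists M, forall t, `|f t| <= M.

Definition uclosure (f : T -> R) := forall e, 0 < e ->
  exists2 g, A g & forall t, `|f t - g t| <= e.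

Let B := uclosure.

Lemma uclosure_sub f : A f -> B f.
Proof. by move=> Af e e0; exists f => // t; rewrite subrr normr0 ltW. Qed.

Lemma uclosureD f g : B f -> B g -> B (fun t => f t + g t).
Proof.
move=> Bf Bg e e0; have e2 : 0 < e / 2 by rewrite divr_gt0.
have [f' Af' ff'] := Bf _ e2; have [g' Ag' gg'] := Bg _ e2.
exists (fun t => f' t + g' t); first exact: AD.
move=> t; rewrite opprD addrACA [e]splitr (le_trans (ler_normD _ _)) // lerD //.
Qed.

Lemma uclosureZ c f : B f -> B (fun t => c * f t).
Proof.
move=> Bf e e0; have c0 : 0 < `|c| + 1 by rewrite ltr_wpDl.
have [f' Af' ff'] := Bf (e / (`|c| + 1)) (divr_gt0 e0 c0).
exists (fun t => c * f' t); first exact: AM.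
move=> t; rewrite -mulrBr normrM.
apply: (@le_trans _ _ (`|c| * (e / (`|c| + 1)))); first exact: ler_wpM2l.
rewrite mulrA ler_pdivrMr // mulrC ler_pM2l //; lra.
Qed.

Lemma abs_poly_alg n f : A f -> A (fun t => abs_poly (f t) n).
Proof.
move=> Af; elim: n => [|n IH] /=; first exact: Ac.
apply: AD => //; apply: (@AM (fun t => f t ^+ 2 - abs_poly (f t) n ^+ 2)) => //.
apply: (AD (AM Af Af)).
rewrite (_ : (fun t => _) = (fun t => -1 * (abs_poly (f t) n * abs_poly (f t) n))).
  exact: (AM (Ac _) (AM IH IH)).
by apply/funext => t; rewrite mulN1r.
Qed.

Lemma uclosure_abs_alg f : A f -> B (fun t => `|f t|).
Proof.
move=> Af e e0; have [M fM] := Ab Af; pose N := `|M| + 1.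
have N0 : 0 < N by rewrite ltr_wpDl.
pose n := Num.truncn (2 * N / e); pose h t := N^-1 * f t.
have Ah : A h by exact: AM.
exists (fun t => N * abs_poly (h t) n); first by apply: (AM (Ac N)); exact: abs_poly_alg.
move=> t; have h1 : `|h t| <= 1.
  rewrite /h normrM normfV (gtr0_norm N0) ler_pdivrMl // mulr1.
  by rewrite (le_trans (fM t)) // /N (le_trans (ler_norm M)) // lerDl.
have [a0 ah an] := abs_poly_bound n h1.
have -> : `|f t| = N * `|h t|.
  by rewrite /h normrM normfV (gtr0_norm N0) mulVKf // gt_eqF.
rewrite -mulrBr normrM (gtr0_norm N0) ger0_norm ?subr_ge0 //.
have n2 : 2 * N <= e * n.+2%:R.
  rewrite -ler_pdivrMl // mulrC; apply: (@le_trans _ _ n.+1%:R).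
    exact: ltW (truncnS_gt _).
  by rewrite ler_nat.
have n0 : 0 < n.+2%:R :> R by rewrite ltr0n.
rewrite -(ler_pM2r n0); apply: le_trans n2; rewrite -mulrA mulrC.
by rewrite ler_pM2r.
Qed.

Lemma uclosure_abs f : B f -> B (fun t => `|f t|).
Proof.
move=> Bf e e0; have e2 : 0 < e / 2 by rewrite divr_gt0.
have [f' Af' ff'] := Bf _ e2; have [g Ag gg] := uclosure_abs_alg Af' e2.
exists g => // t; rewrite [e]splitr -(subrK `|f' t| `|f t|) -addrA.
rewrite (le_trans (ler_normD _ _)) // lerD // (le_trans _ (ff' t)) //.
exact: ler_dist_dist.
Qed.

Lemma uclosureB f g : B f -> B g -> B (fun t => f t - g t).
Proof.
move=> Bf Bg; rewrite (_ : (fun t => _) = (fun t => f t + -1 * g t)).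
  by apply: uclosureD => //; exact: uclosureZ.
by apply/funext => t; rewrite mulN1r.
Qed.

Lemma uclosure_max f g : B f -> B g -> B (fun t => Num.max (f t) (g t)).
Proof.
move=> Bf Bg.
rewrite (_ : (fun t => _) = (fun t => 2^-1 * ((f t + g t) + `|f t - g t|))).
  by apply/uclosureZ/uclosureD; [exact: uclosureD | apply: uclosure_abs; exact: uclosureB].
by apply/funext => t; rewrite maxr_absE mulrC.
Qed.

Lemma uclosure_min f g : B f -> B g -> B (fun t => Num.min (f t) (g t)).
Proof.
move=> Bf Bg.
rewrite (_ : (fun t => _) = (fun t => 2^-1 * ((f t + g t) - `|f t - g t|))).
  by apply/uclosureZ/uclosureB; [exact: uclosureD | apply: uclosure_abs; exact: uclosureB].
by apply/funext => t; rewrite minr_absE mulrC.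
Qed.

Variable u : T -> R.
Hypothesis u_lim : forall U : set_system T, UltraFilter U ->
  exists l : R, u @ U --> l.
Hypothesis u_sep : forall U V : set_system T, UltraFilter U -> UltraFilter V ->
  (forall g, A g -> forall l : R, g @ U --> l -> g @ V --> l) ->
  forall l : R, u @ U --> l -> u @ V --> l.

Let near_u (U : set_system T) (g : T -> R) :=
  forall d, 0 < d -> U [set t | `|g t - u t| <= d].

Let cvg_near (U : set_system T) (f g : T -> R) (l : R) : UltraFilter U ->
  f @ U --> l -> g @ U --> l -> forall d, 0 < d -> U [set t | `|g t - f t| <= d].
Proof.
move=> UU /cvgrPdist_le fl /cvgrPdist_le gl d d0.
have d2 : 0 < d / 2 by rewrite divr_gt0.
have Uf := fl _ d2; have Ug := gl _ d2.
apply: filterS2 Uf Ug => t /= ft gt; rewrite -(subrK l (g t)) -addrA [d]splitr.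
by rewrite (le_trans (ler_normD _ _)) // lerD // distrC.
Qed.

Let alg_lim (U : set_system T) g : UltraFilter U -> A g ->
  exists l : R, g @ U --> l.
Proof.
move=> UU Ag; have [M gM] := Ab Ag; have := @segment_compact R (- M) M.
rewrite compact_ultra => /(_ _ (ultra_fmap g UU)).
case=> [|l [_ gl]]; last by exists l.
apply: (@filterS _ U _ setT _ _ filterT) => t _ /=.
by rewrite /= in_itv /= -ler_norml.
Qed.

(** Either some g in [A] has distinct limits along U and V, and an affine function of g works, or u
    has the same limit along both, and a constant works. *)
Let interpolate (U V : set_system T) : UltraFilter U -> UltraFilter V ->
  exists g, [/\ B g, near_u U g & near_u V g].
Proof.
move=> UU UV; have [a ua] := u_lim UU; have [b ub] := u_lim UV.
have [[g Ag [l [gl ngl]]]|h] := pselect (exists2 g, A g &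
    exists l : R, g @ U --> l /\ ~ g @ V --> l).
  have [l' gl'] := alg_lim UV Ag.
  have ll' : l' - l != 0 by rewrite subr_eq0; apply: contra_notN ngl => /eqP <-.
  (* The affine map with l |-> a and l' |-> b. *)
  pose c := (b - a) / (l' - l); pose h t := a - c * l + c * g t.
  have hlim (W : set_system T) (m : R) : UltraFilter W -> g @ W --> m ->
      h @ W --> a - c * l + c * m.
    by move=> UW gm; apply: cvgD; [exact: cvg_cst | apply: cvgM => //; exact: cvg_cst].
  exists h; split.
  - by apply: uclosure_sub; apply: AD => //; exact: AM.
  - apply: (cvg_near UU ua); have := hlim _ _ UU gl.
    by rewrite subrK.
  - apply: (cvg_near UV ub); have := hlim _ _ UV gl'.
    by rewrite -addrA [- _ + _]addrC -mulrBr divfK // addrC subrK.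
have ua' : u @ V --> a.
  apply: (u_sep UU UV _ ua) => g Ag l gl; apply: contrapT => ngl.
  by apply: h; exists g => //; exists l.
exists (fun=> a); split; first exact: uclosure_sub.
  by apply: (cvg_near UU ua); exact: cvg_cst.
by apply: (cvg_near UV ua'); exact: cvg_cst.
Qed.

(** A maximum of finitely many interpolants: all are close to u along U, and each is close to u on
    one set of a finite cover of [T]. *)
Let upper (U : set_system T) e : UltraFilter U -> 0 < e ->
  exists g, [/\ B g, near_u U g & forall t, u t - e <= g t].
Proof.
move=> UU e0.
suff [g [Bg gU gS]] : exists g,
    [/\ B g, near_u U g & forall t, setT t -> u t - e <= g t].
  by exists g; split => // t; exact: gS.
apply: (@ultra_ideal T (fun S => exists g,
    [/\ B g, near_u U g & forall t, S t -> u t - e <= g t])).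
- by have [g [Bg gU _]] := interpolate UU UU; exists g.
- by move=> S S' SS' [g [Bg gU gS]]; exists g; split => // t /SS'; exact: gS.
- move=> S S' [g [Bg gU gS]] [g' [Bg' gU' gS']].
  exists (fun t => Num.max (g t) (g' t)); split; first exact: uclosure_max.
    move=> d d0; apply: filterS2 (gU _ d0) (gU' _ d0) => t /= h h'.
    by have [] := leP (g t) (g' t).
  by move=> t [/gS|/gS'] h; rewrite le_max h ?orbT.
move=> V UV; have [g [Bg gU gV]] := interpolate UU UV.
exists [set t | `|g t - u t| <= e]; first exact: gV.
by exists g; split => // t /=; rewrite ler_distl => /andP[].
Qed.

(** Ultrafilters on [T] stand for the points of a compactification: [u_lim] lets u extend to it, and
    [u_sep] says that [A] separates the points that u separates. The approximant is a minimum of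
    finitely many functions given by [upper]. The complex form is used on Z, then on the enveloping
    semigroup. *)
Lemma stone_weierstrass_real e : 0 < e ->
  exists2 g, A g & forall t, `|u t - g t| <= e.
Proof.
move=> e0; have e2 : 0 < e / 2 by rewrite divr_gt0.
suff [g [Bg gl gu]] : exists g, [/\ B g, forall t, u t - e / 2 <= g t
    & forall t, setT t -> g t <= u t + e / 2].
  have [g' Ag' gg'] := Bg _ e2; exists g' => // t.
  rewrite -(subrK (g t) (u t)) -addrA [e]splitr (le_trans (ler_normD _ _)) // lerD //.
  by rewrite ler_distlC gl gu.
apply: (@ultra_ideal T (fun S => exists g, [/\ B g, forall t, u t - e / 2 <= g t
    & forall t, S t -> g t <= u t + e / 2])).
(* For the empty set any function above u - e / 2 will do. Without ultrafilters [T] is empty, as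
   each point gives a principal one. *)
- have [U0|nU] := pselect (exists U : set_system T, UltraFilter U).
    by have [U UU] := U0; have [g [Bg _ gu]] := upper UU e2; exists g.
  exists (fun=> 0); split => //; first exact: uclosure_sub.
  by move=> t; case: nU; exists (principal_filter t); exact: principal_filter_ultra.
- by move=> S S' SS' [g [Bg gl gS]]; exists g; split => // t /SS'; exact: gS.
- move=> S S' [g [Bg gl gS]] [g' [Bg' gl' gS']].
  exists (fun t => Num.min (g t) (g' t)); split; first exact: uclosure_min.
    by move=> t; rewrite le_min gl gl'.
  by move=> t [/gS|/gS'] h; rewrite ge_min h ?orbT.
move=> U UU; have [g [Bg gU gl]] := upper UU e2.
exists [set t | `|g t - u t| <= e / 2]; first exact: gU.
by exists g; split => // t /=; rewrite ler_distl => /andP[].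
Qed.

End Real.

Section Complex.
Notation C := (Cplx R).
Variables (T : Type) (A : set (T -> C)).
Hypothesis Ac : forall c, A (fun=> c).
Hypothesis AD : forall f g, A f -> A g -> A (fun t => f t + g t).
Hypothesis AM : forall f g, A f -> A g -> A (fun t => f t * g t).
Hypothesis AJ : forall f, A f -> A (fun t => (f t)^*).
Hypothesis Ab : forall f, A f -> exists M : R, forall t, `|f t| <= M%:C%C.
Variable u : T -> C.
Hypothesis u_lim : forall U : set_system T, UltraFilter U ->
  exists z : C, u @ U --> z.
Hypothesis u_sep : forall U V : set_system T, UltraFilter U -> UltraFilter V ->
  (forall g, A g -> forall z : C, g @ U --> z -> g @ V --> z) ->
  forall z : C, u @ U --> z -> u @ V --> z.

Let AR : set (T -> R) := [set g | A (fun t => (g t)%:C%C)].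

Let Re_alg f : A f -> AR (fun t => complex.Re (f t)).
Proof.
move=> Af; have := AM (Ac 2^-1) (AD Af (AJ Af)); rewrite /AR /=.
congr A; apply/funext => t.
by rewrite (_ : f t + (f t)^* = 2 * (complex.Re (f t))%:C%C) ?mulKf //; exact: addcJ.
Qed.

Let Im_alg f : A f -> AR (fun t => complex.Im (f t)).
Proof.
move=> Af; have := Re_alg (AM (Ac (- 'i%C)) Af); congr AR; apply/funext => t.
by rewrite mulNr mulrC -mulNr ReiNIm; case: (f t) => a b /=; rewrite opprK.
Qed.

Lemma stone_weierstrass (e : R) : 0 < e ->
  exists2 g, A g & forall t, `|u t - g t| <= e%:C%C.
Proof.
move=> e0; have e2 : 0 < e / 2 by rewrite divr_gt0.
have ARc c : AR (fun=> c) by exact: Ac.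
have ARD f g : AR f -> AR g -> AR (fun t => f t + g t).
  by move=> Af Ag; have := AD Af Ag; congr A; apply/funext => t; rewrite rmorphD.
have ARM f g : AR f -> AR g -> AR (fun t => f t * g t).
  by move=> Af Ag; have := AM Af Ag; congr A; apply/funext => t; rewrite rmorphM.
have nR (r : R) : `|r%:C%C : C| = `|r|%:C%C.
  by rewrite normc_def /= expr0n /= addr0 sqrtr_sqr.
have ARb f : AR f -> exists M, forall t, `|f t| <= M.
  by move=> /Ab[M fM]; exists M => t; have := fM t; rewrite nR lecR.
have cRe (F : set_system T) (f : T -> C) (z : C) : Filter F -> f @ F --> z ->
    (fun t => complex.Re (f t)) @ F --> complex.Re z.
  move=> FF /cvgC_dist fz; apply/cvgrPdist_le => d d0.
  have dC : 0 < d%:C%C :> C by rewrite (ltcR 0).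
  apply: filterS (fz _ dC) => t; rewrite -lecR distrC; apply: le_trans.
  by rewrite (le_trans _ (normc_ge_Re _)) //; case: (f t) (z) => a b [].
have cIm (F : set_system T) (f : T -> C) (z : C) : Filter F -> f @ F --> z ->
    (fun t => complex.Im (f t)) @ F --> complex.Im z.
  move=> FF /cvgC_dist fz; apply/cvgrPdist_le => d d0.
  have dC : 0 < d%:C%C :> C by rewrite (ltcR 0).
  apply: filterS (fz _ dC) => t; rewrite -lecR distrC; apply: le_trans.
  by rewrite (le_trans _ (normc_ge_Im _)) //; case: (f t) (z) => a b [].
have sepA (U V : set_system T) : UltraFilter U -> UltraFilter V ->
    (forall g, AR g -> forall l : R, g @ U --> l -> g @ V --> l) ->
    forall z : C, u @ U --> z -> u @ V --> z.
  move=> UU UV h; apply: u_sep => g Ag z gz.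
  have FU : Filter U by exact: _.
  have h1 := h _ (Re_alg Ag) _ (cRe _ _ _ FU gz).
  have h2 := h _ (Im_alg Ag) _ (cIm _ _ _ FU gz).
  have FV : Filter V by exact: _.
  have := @cvgC_complex R T V g _ _ FV h1 h2.
  by have -> : (complex.Re z +i* complex.Im z)%C = z by case: (z).
have [||g1 Ag1 g1u] := @stone_weierstrass_real T AR ARc ARD ARM ARb
    (fun t => complex.Re (u t)) _ _ _ e2.
- by move=> U UU; have [z uz] := u_lim UU; exists (complex.Re z); exact: cRe.
- move=> U V UU UV h l ul; have [z uz] := u_lim UU.
  have -> : l = complex.Re z.
    by apply: (cvgR_unique ul); exact: cRe uz.
  exact: cRe (sepA _ _ UU UV h _ uz).
have [||g2 Ag2 g2u] := @stone_weierstrass_real T AR ARc ARD ARM ARb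
    (fun t => complex.Im (u t)) _ _ _ e2.
- by move=> U UU; have [z uz] := u_lim UU; exists (complex.Im z); exact: cIm.
- move=> U V UU UV h l ul; have [z uz] := u_lim UU.
  have -> : l = complex.Im z.
    by apply: (cvgR_unique ul); exact: cIm uz.
  exact: cIm (sepA _ _ UU UV h _ uz).
exists (fun t => (g1 t)%:C%C + 'i%C * (g2 t)%:C%C : C).
  by apply: AD => //; apply: (@AM (fun=> 'i%C)).
move=> t; have -> : u t - ((g1 t)%:C%C + 'i%C * (g2 t)%:C%C) =
    ((complex.Re (u t) - g1 t) +i* (complex.Im (u t) - g2 t))%C.
  rewrite [u t in LHS]complexE [RHS]complexE /= !rmorphB mulrBr opprD addrACA.
  by [].
apply: (le_trans (le_real_normc _ _)); rewrite lecR [e]splitr lerD //.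
Qed.

End Complex.
End StoneWeierstrass.

(** * Pointwise and uniform convergence *)

Lemma cvg_ptws (S : Type) (I : eqType) (Y : topologicalType) (F : set_system S)
    (g : S -> (I -> Y)) (f : I -> Y) : Filter F ->
  (forall i, (fun s => g s i) @ F --> f i) <->
  (fun s => g s : {ptws I -> Y}) @ F --> (f : {ptws I -> Y}).
Proof.
move=> FF; split=> [gf|gf i].
  apply/cvg_sup => i B [_ [[P oP <-] Pfi] sB].
  have : nbhs (f i) P by exact: open_nbhs_nbhs.
  by move=> /(gf i) FP; apply: (@filterS _ F FF _ _ _ FP) => s Ps; exact: sB.
apply: (@cvg_comp _ _ _ (fun s => g s : {ptws I -> Y}) (fun h => h i) _
  (nbhs (f : {ptws I -> Y}))) => //.
exact: (@proj_continuous I (fun=> Y) i f).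
Qed.

Section UniformClosure.
Variables (R : realType) (X : choiceType).
Notation C := (Cplx R).

Lemma uniform_closureP (V : set (X -> C)) (f : X -> C) :
  closure (V : set {uniform X -> C}) f <->
  forall e : R, 0 < e -> exists2 g, V g & forall x, `|f x - g x| <= e%:C%C.
Proof.
split=> [Vf e e0|Vf B].
  have eC : 0 < e%:C%C :> C by rewrite (ltcR 0).
  have [|g [Vg fg]] := Vf [set g | forall x, ball (f x) e%:C%C (g x)].
    apply/uniform_nbhs; exists [set xy : C * C | ball xy.1 e%:C%C xy.2]; split.
      exact: (@entourage_ball _ C (PosNum eC)).
    by move=> g /= h x; exact: h.
  by exists g => // x; have := fg x; rewrite -ball_normE /= => /ltW.
move=> /uniform_nbhs; case=> E; rewrite -entourage_ballE.
case; case=> e /= e0 eE sB.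
have [d ed] : exists d, e = d%:C%C by apply/complex_realP; exact: gtr0_real.
have d0 : 0 < d / 2 by rewrite divr_gt0 // -ltcR -ed.
have [g Vg fg] := Vf _ d0; exists g; split => //; apply: sB => x _ /=.
apply: eE => /=; rewrite -ball_normE /=; apply: le_lt_trans (fg x) _.
by rewrite ed ltcR gtr_pMr ?invf_lt1 ?ltr1n // -ltcR -ed.
Qed.

End UniformClosure.

Section Limits.
Variable R : realType.
Notation C := (Cplx R).

Lemma cvgC_dist_le (T : Type) (F : set_system T) {FF : ProperFilter F}
    (f g : T -> C) (z w : C) (c : R) : f @ F --> z -> g @ F --> w ->
  (forall t, `|f t - g t| <= c%:C%C) -> `|z - w| <= c%:C%C.
Proof.
move=> /cvgC_dist fz /cvgC_dist gw fg; have [r zw] := normC_real (z - w).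
rewrite zw lecR; apply/ler_addgt0Pr => e e0.
have eC : 0 < (e / 2)%:C%C :> C by rewrite (ltcR 0) divr_gt0.
have [t [ft gt]] := @filter_ex _ F _ _ (filterI (fz _ eC) (gw _ eC)).
rewrite -lecR -zw (_ : z - w = (f t - g t) + ((g t - w) - (f t - z))); last by ring.
rewrite [e]splitr !rmorphD (le_trans (ler_normD _ _)) // lerD //.
by rewrite (le_trans (ler_normB _ _)) // lerD.
Qed.

End Limits.

Lemma eqC_dist (R : realType) (z w : Cplx R) :
  (forall e : R, 0 < e -> `|z - w| <= e%:C%C) -> z = w.
Proof.
move=> zw; apply/eqP; rewrite -subr_eq0 -normr_eq0; apply/eqP.
have [r rE] := normC_real (z - w); rewrite rE; congr (_%:C%C).
apply/eqP; rewrite eq_le -[0 <= r]ler0c -rE normr_ge0 andbT.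
by apply/ler_addgt0Pr => e e0; rewrite add0r -lecR -rE zw.
Qed.

(** * The space W and limits along ultrafilters *)

Section CalW.
Variable R : realType.
Notation C := (Cplx R).
Notation phase := (phase R).
Implicit Types (L : seq (C * phase)).

(** Combinations of phases are kept as formal lists: an operator on phases then acts on them term by
    term ([mapL]), whether or not the list represents its function uniquely. *)
Definition evalL L (n : int) : C := \sum_(p <- L) p.1 * aval (p.2 n).

Lemma evalL_nil n : evalL [::] n = 0.
Proof. by rewrite /evalL big_nil. Qed.

Lemma evalL_cons p L n : evalL (p :: L) n = p.1 * aval (p.2 n) + evalL L n.
Proof. by rewrite /evalL big_cons. Qed.

Lemma evalL_cat L L' n : evalL (L ++ L') n = evalL L n + evalL L' n.
Proof. by rewrite /evalL big_cat. Qed.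

Lemma evalL_scale a L n :
  evalL [seq (a * p.1, p.2) | p <- L] n = a * evalL L n.
Proof.
by rewrite /evalL big_map mulr_sumr; apply: eq_bigr => p _; rewrite /= mulrA.
Qed.

Lemma evalL_mul L L' n :
  evalL [seq (p.1 * q.1, p.2 + q.2) | p <- L, q <- L'] n = evalL L n * evalL L' n.
Proof.
rewrite /evalL big_allpairs_dep big_distrl /=; apply: eq_bigr => p _.
rewrite big_distrr /=; apply: eq_bigr => q _.
by rewrite phaseD avalD mulrACA.
Qed.

Lemma evalL_conj L n : evalL [seq (p.1^*, - p.2) | p <- L] n = (evalL L n)^*.
Proof.
rewrite /evalL big_map rmorph_sum; apply: eq_bigr => p _ /=.
by rewrite rmorphM phaseN avalN invC_norm aval_norm expr1n invr1 mul1r.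
Qed.

Lemma evalL_bnd L : exists M : R, forall n, `|evalL L n| <= M%:C%C.
Proof.
elim: L => [|p L [M LM]]; first by exists 0 => n; rewrite evalL_nil normr0.
have [r pr] := normC_real p.1; exists (r + M) => n.
rewrite evalL_cons rmorphD (le_trans (ler_normD _ _)) // lerD //.
by rewrite normrM aval_norm mulr1 pr.
Qed.

Definition approxW (u : int -> C) := forall e : R, 0 < e ->
  exists L, forall n, `|u n - evalL L n| <= e%:C%C.

Lemma calWP (u : int -> C) : calW u <-> approxW u.
Proof.
have phW (v : phase) : exists p : {poly R},
    (fun n => aval (v n)) = (fun n => cval (expi p.[n%:~R])).
  by have [p vp] := phase_poly v; exists p; apply/funext => n; rewrite vp.
split=> [|uW V [[Vb [V0 Vlin] Vcl] sV]]; last first.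
  apply: Vcl; apply/uniform_closureP => e e0; have [L uL] := uW e e0.
  exists (evalL L) => //; elim: L {uL} => [|p L IH].
    by rewrite (_ : evalL _ = (fun=> 0)) //; apply/funext => n; rewrite evalL_nil.
  rewrite (_ : evalL _ = (fun n => p.1 * aval (p.2 n) + evalL L n)).
    by apply: (Vlin _ (fun n => aval (p.2 n))) => //; apply: sV; exact: phW.
  by apply/funext => n; rewrite evalL_cons.
apply; split; last first.
  move=> _ [p ->] e e0; exists [:: (1, Phase (poly_phase p))] => n.
  by rewrite evalL_cons evalL_nil addr0 mul1r subrr normr0 ler0c ltW.
split.
- move=> v vW; have [L vL] := vW 1 ltr01; have [M LM] := evalL_bnd L.
  exists (1 + M) => n; rewrite -(subrK (evalL L n) (v n)) rmorphD.
  by rewrite (le_trans (ler_normD _ _)) // lerD.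
- split=> [e e0|a f g fW gW e e0].
    by exists [::] => n; rewrite evalL_nil subr0 normr0 ler0c ltW.
  have [r ar] := normC_real a.
  have r0 : 0 <= r by rewrite -ler0c -ar.
  have r1 : 0 < r + 1 by rewrite ltr_wpDl.
  have e2 : 0 < e / 2 by rewrite divr_gt0.
  have e3 : 0 < e / 2 / (r + 1) by rewrite divr_gt0.
  have [L fL] := fW _ e3; have [L' gL'] := gW _ e2.
  exists ([seq (a * p.1, p.2) | p <- L] ++ L') => n.
  rewrite evalL_cat evalL_scale opprD addrACA -mulrBr [e]splitr rmorphD.
  rewrite (le_trans (ler_normD _ _)) // lerD // normrM ar.
  apply: (@le_trans _ _ (r%:C%C * (e / 2 / (r + 1))%:C%C)).
    by rewrite ler_wpM2l // ler0c.
  rewrite -rmorphM lecR mulrA ler_pdivrMr // mulrC ler_pM2l //; lra.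
move=> v /uniform_closureP vcl e e0; have e2 : 0 < e / 2 by rewrite divr_gt0.
have [w wW vw] := vcl _ e2; have [L wL] := wW _ e2; exists L => n.
rewrite -(subrK (w n) (v n)) -addrA [e]splitr rmorphD.
by rewrite (le_trans (ler_normD _ _)) // lerD.
Qed.

(** U and V define the same point of [calH]; see [ulimH_eq]. *)
Definition agree (U V : set_system int) :=
  forall (u : phase) (z : acirc R), (u : int -> acirc R) @ U --> z ->
    (u : int -> acirc R) @ V --> z.

Lemma agreeP (U V : set_system int) (UU : UltraFilter U) (UV : UltraFilter V) :
  agree U V <-> forall u : phase, @uop R U UU u 0 = @uop R V UV u 0.
Proof.
split=> [UVa u|h u z uz].
  by rewrite !uop_at0; apply/esym/ulim_eq/UVa; exact: ulimP.
by rewrite -(ulim_eq uz) -uop_at0 h uop_at0; exact: ulimP.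
Qed.

Lemma agree_evalL (U V : set_system int) L (z : C) : UltraFilter U -> UltraFilter V ->
  agree U V -> evalL L @ U --> z -> evalL L @ V --> z.
Proof.
move=> UU UV UVa.
have key (W : set_system int) : UltraFilter W -> agree U W ->
    evalL L @ W --> \sum_(p <- L) p.1 * aval (@ulim R U p.2).
  move=> UW UWa; elim: L => [|p L IH].
    rewrite big_nil (_ : evalL _ = (fun=> 0)); first exact: cvg_cst.
    by apply/funext => n; rewrite evalL_nil.
  rewrite big_cons (_ : evalL _ = (fun n => p.1 * aval (p.2 n) + evalL L n)).
    have pW : (fun n => aval (p.2 n)) @ W --> aval (@ulim R U p.2).
      by apply/cvg_aval; apply: UWa; exact: ulimP.
    exact: cvgCD (cvgCZ pW) IH.
  by apply/funext => n; rewrite evalL_cons.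
have UUa : agree U U by [].
move=> Lz; rewrite (cvgC_unique Lz (key U UU UUa)).
exact: key.
Qed.

Lemma calW_ultra (u : int -> C) (U V : set_system int) (z : C) :
  UltraFilter U -> UltraFilter V -> agree U V -> calW u ->
  u @ U --> z -> u @ V --> z.
Proof.
move=> UU UV UVa /calWP uW uz; apply/cvgC_dist => e e0.
have [d ed] : exists d, e = d%:C%C by apply/complex_realP; exact: gtr0_real.
have d3 : 0 < d / 3 by rewrite divr_gt0 // -ltcR -ed.
have [L uL] := uW _ d3; have [M LM] := evalL_bnd L.
have [w Lw] := ultra_bounded UU LM.
have LwV := agree_evalL UU UV UVa Lw.
have d3C : 0 < (d / 3)%:C%C :> C by rewrite (ltcR 0).
have zw : `|w - z| <= (d / 3)%:C%C by rewrite distrC; exact: cvgC_dist_le uz Lw uL.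
move/cvgC_dist : LwV => /(_ _ d3C); apply: filterS => n Ln.
have -> : u n - z = (u n - evalL L n) + ((evalL L n - w) + (w - z)) by ring.
rewrite ed (_ : d = d / 3 + (d / 3 + d / 3)); last by field.
rewrite !rmorphD (le_trans (ler_normD _ _)) // lerD //.
by rewrite (le_trans (ler_normD _ _)) // lerD.
Qed.

(** The converse of [calW_ultra]: combinations of phases form an algebra stable under conjugation,
    and ultrafilters with the same limits on it agree. *)
Lemma W_stone_weierstrass (u : int -> C) :
  (forall U : set_system int, UltraFilter U -> exists z : C, u @ U --> z) ->
  (forall U V : set_system int, UltraFilter U -> UltraFilter V -> agree U V ->
     forall z : C, u @ U --> z -> u @ V --> z) ->
  calW u.
Proof.
move=> ulim usep; apply/calWP => e e0.
pose A := [set g : int -> C | exists L, g = evalL L].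
have [|||||||g [L ->] uL] := @stone_weierstrass R int A _ _ _ _ _ u _ _ e e0.
- move=> c; exists [:: (c, 0)]; apply/funext => n.
  by rewrite evalL_cons evalL_nil addr0 aval0 mulr1.
- move=> _ _ [L ->] [L' ->]; exists (L ++ L'); apply/funext => n.
  by rewrite evalL_cat.
- move=> _ _ [L ->] [L' ->].
  exists [seq (p.1 * q.1, p.2 + q.2) | p <- L, q <- L']; apply/funext => n.
  by rewrite evalL_mul.
- move=> _ [L ->]; exists [seq (p.1^*, - p.2) | p <- L]; apply/funext => n.
  by rewrite evalL_conj.
- by move=> _ [L ->]; exact: evalL_bnd.
- exact: ulim.
- move=> U V UU UV h; apply: usep => // v x /cvg_aval vx; apply/cvg_aval.
  have vE : (fun n => aval (v n)) = evalL [:: (1, v)].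
    by apply/funext => n; rewrite evalL_cons evalL_nil addr0 mul1r.
  by rewrite vE; apply: h; [exists [:: (1, v)] | rewrite -vE].
by exists L.
Qed.

End CalW.

(** * Points whose orbit functions lie in W *)

Section Separation.
Variables (R : realType) (X : topologicalType).
Hypothesis X_compact : compact [set: X].
Notation C := (Cplx R).

Lemma cvg_continuousC (T : Type) (F : set_system T) (g : T -> X) (y : X)
    (f : X -> C) : Filter F -> continuous f -> g @ F --> y ->
  (fun t => f (g t)) @ F --> f y.
Proof. by move=> FF fc gy; exact: (@cvg_comp _ _ _ g f _ (nbhs y) _ gy (fc y)). Qed.

Lemma separate_points (y z : X) : hausdorff_space X -> y <> z ->
  exists f : X -> C, continuous f /\ f y <> f z.
Proof.
move=> hX yz; have nX := compact_normal hX X_compact.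
have cl x : closed [set x : X].
  exact: accessible_closed_set1 (hausdorff_accessible hX) x.
have yz0 : [set y] `&` [set z] = set0 :> set X.
  by apply/seteqP; split=> x // [-> /yz].
have [h [hc _ h0 h1]] :=
  (@uniform_separatorP X R _ _).1 ((@normal_separatorP R X).1 nX _ _ (cl y) (cl z) yz0).
exists (fun x => (h x)%:C%C); split.
  move=> x; apply/cvgC_dist => e e0.
  have [d ed] : exists d, e = d%:C%C by apply/complex_realP; exact: gtr0_real.
  have d0 : 0 < d by rewrite -ltcR -ed.
  move/cvgrPdist_le : (hc x) => /(_ _ d0); apply: filterS => t.
  rewrite ed -rmorphB distrC normc_def /= expr0n /= addr0 sqrtr_sqr lecR.
  by [].
have -> : h y = 0 by apply: h0; exists y.
have -> : h z = 1 by apply: h1; exists z.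
by case=> /eqP; rewrite eq_sym oner_eq0.
Qed.

Variable s : homeo X.

(** The inclusion of [omega s x] of the continuous functions in W, with the functions eliminated:
    the limit of the orbit of x along U depends only on the point of [calH] defined by U. *)
Definition Wpoint (x : X) := forall U V : set_system int, UltraFilter U ->
  UltraFilter V -> @agree R U V ->
  forall y : X, (fun n => iterz s n x) @ U --> y ->
    (fun n => iterz s n x) @ V --> y.

Lemma Wpoint_calW x : Wpoint x ->
  omega s x @` [set f : X -> C | continuous f] `<=` @calW R.
Proof.
move=> Wx _ [f fc <-]; apply: W_stone_weierstrass => [U UU|U V UU UV UVa z fz].
  have [y xy] := ultra_compact (fun n => iterz s n x) UU X_compact.
  by exists (f y); exact: cvg_continuousC xy.
have [y xy] := ultra_compact (fun n => iterz s n x) UU X_compact.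
have -> : z = f y by apply: (cvgC_unique fz); exact: cvg_continuousC xy.
by apply: cvg_continuousC => //; exact: Wx xy.
Qed.

Lemma calW_Wpoint x : hausdorff_space X ->
  omega s x @` [set f : X -> C | continuous f] `<=` @calW R -> Wpoint x.
Proof.
move=> hX Wx U V UU UV UVa y xy.
have [z xz] := ultra_compact (fun n => iterz s n x) UV X_compact.
have [-> //|/(separate_points hX)[f [fc]]] := pselect (y = z); case.
have fW : calW (omega s x f) by apply: Wx; exists f.
have fy : omega s x f @ U --> f y by exact: cvg_continuousC xy.
have fz : omega s x f @ V --> f z by exact: cvg_continuousC xz.
exact: (cvgC_unique (calW_ultra UU UV UVa fW fy) fz).
Qed.

End Separation.

(** * The action on a W-system *)

Lemma closure_ultra_in (I : Type) (Y : topologicalType) (i : I -> Y) (S : set I)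
  (y : Y) : closure (i @` S) y <->
  exists U : set_system I, [/\ UltraFilter U, U S & i @ U --> y].
Proof.
split=> [cy|[U [UU US iy]] B By]; last first.
  have [k [Bk Sk]] := @filter_ex _ U _ _ (@filterI _ U _ _ _ (iy B By : U (i @^-1` B)) US).
  by exists (i k); split => //; exists k.
have FF : ProperFilter (filter_from (nbhs y) (fun B => i @^-1` B `&` S)).
  apply: filter_from_proper => [|B /cy[_ [[k Sk <-] Bk]]]; last by exists k.
  apply: filter_from_filter => [|B B' By By']; first by exists setT; exact: filterT.
  by exists (B `&` B'); [exact: filterI | move=> k [[]]].
have [U [UU sU]] := ultraFilterLemma FF; exists U; split => //.
  by apply: sU; exists setT; [exact: filterT | move=> k []].
by move=> B By; apply: sU; exists B => // k [].
Qed.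

Lemma closure_ultra (I : Type) (Y : topologicalType) (i : I -> Y) (y : Y) :
  closure (range i) y <-> exists U : set_system I, UltraFilter U /\ i @ U --> y.
Proof.
rewrite closure_ultra_in; split=> -[U]; first by case=> UU _ iy; exists U.
by case=> UU iy; exists U; split => //; exact: filterT.
Qed.

(** h y is the common limit of j along all ultrafilters that send i to y; continuity follows from
    the regularity of Z. *)
Lemma dense_extension (I : Type) (Y Z : topologicalType) (i : I -> Y) (j : I -> Z) :
  compact [set: Z] -> hausdorff_space Z -> (forall y, closure (range i) y) ->
  (forall U V : set_system I, UltraFilter U -> UltraFilter V ->
     forall y : Y, i @ U --> y -> i @ V --> y ->
     forall z : Z, j @ U --> z -> j @ V --> z) ->
  exists h : Y -> Z, continuous h /\
    forall U : set_system I, UltraFilter U -> forall y : Y, i @ U --> y -> j @ U --> h y.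
Proof.
move=> cZ hZ di ij.
pose P (y : Y) (z : Z) := forall U : set_system I,
  UltraFilter U -> i @ U --> y -> j @ U --> z.
have /choice[h hP] : forall y, exists z, P y z.
  move=> y; have /closure_ultra[V [VV iV]] := di y.
  have [z jz] := ultra_compact j VV cZ; exists z => U UU iU.
  exact: (ij V U VV UU y iV iU z jz).
exists h; split => [y B|U UU y iy]; last exact: hP.
have rZ (z : Z) : {for z, regular_space Z}
  by exact: (compact_regular hZ cZ (@filterT _ (nbhs z) _)).
move=> /(rZ (h y)) [B' B'y sB'].
(* Otherwise an ultrafilter living outside the preimage of B' would send i to y, hence j to h y, and
   so into B'. *)
have [Q Qy QB'] : exists2 Q, nbhs y Q & i @^-1` Q `<=` j @^-1` B'.
  apply: contrapT => nQ.
  have : closure (i @` (~` (j @^-1` B'))) y.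
    move=> Q Qy; apply: contrapT => nQj; apply: nQ; exists Q => // k Qk.
    by apply: contrapT => nB; apply: nQj; exists (i k); split => //; exists k.
  move=> /closure_ultra_in[U [UU Un iy]].
  have [k [+ Bk]] := @filter_ex _ U _ _
    (@filterI _ U _ _ _ Un (hP y U UU iy B' B'y : U (j @^-1` B'))).
  by apply.
have [Q' [oQ' Q'y] Q'Q] : exists2 Q', open_nbhs y Q' & Q' `<=` Q.
  by move: Qy; rewrite nbhsE => -[Q' ? ?]; exists Q'.
have : nbhs y Q' by exact: open_nbhs_nbhs.
apply: filterS => y' Q'y' /=; apply: sB' => B2 B2y'.
have /closure_ultra[U [UU iU]] := di y'.
have UQ : U (i @^-1` Q') by apply: iU; exact: open_nbhs_nbhs.
have [k [Qk Bk]] := @filter_ex _ U _ _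
  (@filterI _ U _ _ _ UQ (hP y' U UU iU B2 B2y' : U (j @^-1` B2))).
by exists (j k); split => //; apply: QB'; exact: Q'Q.
Qed.

Section Iterz.
Variables (X : topologicalType) (s : homeo X).

Lemma iterzS1 n x : iterz s (n + 1) x = s (iterz s n x).
Proof.
case: n => [n|[|n]]; first by rewrite -PoszD addn1.
  by rewrite /= hinvK.
by rewrite (_ : Negz n.+1 + 1 = Negz n) ?NegzE //=; [rewrite hinvK | lia].
Qed.

Lemma iterzD n m x : iterz s (n + m) x = iterz s n (iterz s m x).
Proof.
elim/int_rec: n => [|n IH|n IH]; first by rewrite add0r.
  by rewrite intS [1 + _]addrC addrAC !iterzS1 IH.
apply: (can_inj (hfunK s)); rewrite -!iterzS1.
have -> : - n.+1%:Z + m + 1 = - n%:Z + m by lia.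
by have -> : - n.+1%:Z + 1 = - n%:Z by lia.
Qed.

Lemma iterz_continuous n : continuous (iterz s n).
Proof.
have it (f : X -> X) k : continuous f -> continuous (iter k f).
  move=> fc; elim: k => [|k IH] x /=; first exact: cvg_id.
  by apply: (continuous_comp (IH x)); exact: fc.
by case: n => n; apply: it; [exact: hfun_continuous | exact: hinv_continuous].
Qed.

Lemma env_ultra (a : X -> X) : env_semigroup s a <->
  exists U : set_system int, UltraFilter U /\
    forall x, (fun n => iterz s n x) @ U --> a x.
Proof.
rewrite /env_semigroup closure_ultra.
by split=> -[U [UU h]]; exists U; split => //; apply/cvg_ptws.
Qed.

End Iterz.

Section Action.
Variables (R : realType) (X : topologicalType) (s : homeo X).
Hypotheses (X_compact : compact [set: X]) (X_hausdorff : hausdorff_space X).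
Notation C := (Cplx R).
Notation A := (acirc R).
Notation phase := (phase R).
Notation D := (@D R).
Notation pshift := (@pshift R).
Implicit Types (x y : X) (u v w : phase).

Definition mapL (G : phase -> phase) (L : seq (C * phase)) :=
  [seq (p.1, G p.2) | p <- L].

Lemma evalL_map G L n : evalL (mapL G L) n = \sum_(p <- L) p.1 * aval (G p.2 n).
Proof. by rewrite /evalL big_map. Qed.

Definition close_to (f : X -> C) x (e : R) (L : seq (C * phase)) :=
  forall n : int, `|f (iterz s n x) - evalL L n| <= e%:C%C.

(* [y] is the image of [x] under [G], seen as an element of the enveloping
   semigroup. *)
Definition act (G : phase -> phase) x y := forall f : X -> C, continuous f ->
  forall e L, close_to f x e L -> close_to f y e (mapL G L).

Lemma eq_act G H x y : G =1 H -> act G x y -> act H x y.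
Proof.
move=> GH a f fc e L /(a f fc e L) h n; move: (h n).
by rewrite !evalL_map; under eq_bigr => p _ do rewrite GH.
Qed.

Lemma act_id x : act id x x.
Proof.
move=> f _ e L h n; rewrite evalL_map; exact: h.
Qed.

Lemma act_comp G H x y z : act G x y -> act H y z -> act (H \o G) x z.
Proof.
move=> xy yz f fc e L /(xy f fc)/(yz f fc) h n.
by have := h n; rewrite !evalL_map big_map.
Qed.

Lemma evalL_uop (U : set_system int) (UU : UltraFilter U) L n :
  (fun m => evalL L (n + m)) @ U --> evalL (mapL (@uop R U UU) L) n.
Proof.
elim: L => [|p L IH].
  rewrite evalL_nil (_ : (fun m => _) = (fun=> 0)); first exact: cvg_cst.
  by apply/funext => m; rewrite evalL_nil.
rewrite evalL_cons (_ : (fun m => _) =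
  (fun m => p.1 * aval (p.2 (n + m)) + evalL L (n + m))); last first.
  by apply/funext => m; rewrite evalL_cons.
have pU : (fun m => aval (p.2 (n + m))) @ U --> aval (@uop R U UU p.2 n).
  by apply/cvg_aval; exact: (@ulimP R U UU (fun m => p.2 (n + m))).
exact: cvgCD (cvgCZ pU) IH.
Qed.

Lemma act_uop (U : set_system int) (UU : UltraFilter U) x y :
  (fun n => iterz s n x) @ U --> y -> act (@uop R U UU) x y.
Proof.
move=> xy f fc e L h n.
have fy : (fun m => f (iterz s (n + m) x)) @ U --> f (iterz s n y).
  rewrite (_ : (fun m => _) = (fun m => (f \o iterz s n) (iterz s m x))).
    apply: cvg_continuousC xy => z; apply: continuous_comp; last exact: fc.
    exact: iterz_continuous.
  by apply/funext => m; rewrite iterzD.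
exact: cvgC_dist_le fy (@evalL_uop U UU L n) (fun m => h (n + m)).
Qed.

Lemma act_exists (G : {additive phase -> phase}) x : good G -> exists y, act G x y.
Proof.
move=> gG; have [U [UU GU]] := good_is_uop gG.
have [y xy] := ultra_compact (fun n => iterz s n x) UU X_compact; exists y.
by apply: (eq_act (fun u => esym (GU u))); exact: act_uop.
Qed.

Hypothesis W4 : forall x : X,
  omega s x @` [set f : X -> C | continuous f] `<=` @calW R.

Lemma W4_close f x e : continuous f -> 0 < e -> exists L, close_to f x e L.
Proof.
move=> fc e0; have /calWP h : calW (omega s x f) by apply: W4; exists f.
exact: h e e0.
Qed.

Lemma act_uniq G x y z : act G x y -> act G x z -> y = z.
Proof.
move=> xy xz; apply: contrapT => yz.
have [f [fc fyz]] := @separate_points R X X_compact y z X_hausdorff yz.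
apply: fyz; apply: eqC_dist => e e0.
have e2 : 0 < e / 2 by rewrite divr_gt0.
have [L xL] := W4_close x fc e2.
have := xy f fc _ _ xL 0; have := xz f fc _ _ xL 0 => /=.
set a := evalL _ _ => h1 h2; rewrite (_ : f y - f z = (f y - a) - (f z - a)).
  by rewrite [e]splitr rmorphD (le_trans (ler_normB _ _)) // lerD.
by rewrite opprB addrA subrK.
Qed.

Lemma act_inv (G H : {additive phase -> phase}) x y : good H -> cancel G H ->
  act G x y -> act H y x.
Proof.
move=> gH GK xy; have [z yz] := act_exists y gH.
rewrite -[X in act H y X](_ : z = x) //.
by apply: (act_uniq (eq_act GK (act_comp xy yz))); exact: act_id.
Qed.

(** a acts as the operator of U, which has an inverse H in the group; H takes a x = a y both to x
    and to y. *)
Lemma W4_distal : distal s.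
Proof.
move=> a /env_ultra[U [UU Ua]] x y axy.
have gU := @good_uop R U UU; have [H [gH GK _]] := good_inv gU.
have hx := act_inv gH GK (act_uop UU (Ua x)).
have hy := act_inv gH GK (act_uop UU (Ua y)).
by rewrite axy in hx; exact: act_uniq hx hy.
Qed.

(* The kernel of the action on [X]. *)
Definition inK (G : {additive phase -> phase}) := good G /\ forall x, act G x x.

Definition fixedK u := forall G, inK G -> G u = u.

Lemma inK_iter (G : {additive phase -> phase}) m x : inK G -> act (iter m G) x x.
Proof.
move=> [_ aG]; elim: m => [|m IH]; first exact: act_id.
exact: (act_comp IH (aG x)).
Qed.

Lemma inK_inv (G : {additive phase -> phase}) : inK G ->
  exists H : {additive phase -> phase}, [/\ inK H, cancel G H & cancel H G].
Proof.
move=> [gG aG]; have [H [gH GK HK]] := good_inv gG.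
by exists H; split => //; split => // x; exact: act_inv (aG x).
Qed.

Lemma inK_conj (G K H : {additive phase -> phase}) : good G -> good H ->
  cancel G H -> inK K -> inK (H \o (K \o G)).
Proof.
move=> gG gH GK [gK aK]; split; first by apply: good_comp => //; exact: good_comp.
move=> x; have [y xy] := act_exists x gG.
exact: (act_comp (act_comp xy (aK y)) (act_inv gH GK xy)).
Qed.

Lemma inK_comp (G H : {additive phase -> phase}) : inK G -> inK H -> inK (G \o H).
Proof.
move=> [gG aG] [gH aH]; split; first exact: good_comp.
by move=> x; exact: (act_comp (aH x) (aG x)).
Qed.

Section DiffOperator.
Variables (G : {additive phase -> phase}) (gG : good G).

Lemma kappa_is_additive : {morph (fun u => G u - u) : u v / u - v}.
Proof. by move=> u v; rewrite raddfB subrACA. Qed.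

Definition kappa : {additive phase -> phase} :=
  HB.pack (fun u => G u - u)
    (GRing.isZmodMorphism.Build phase phase _ kappa_is_additive).

Lemma kappaE u : kappa u = G u - u. Proof. by []. Qed.

Lemma kappa_deg d u : iter d.+1 D u = 0 -> iter d D (kappa u) = 0.
Proof.
move=> ud; rewrite kappaE raddfB /= -good_iterD //.
by have := D_eq0 (ud : D (iter d D u) = 0) => ->; case: gG => _ -> _; rewrite subrr.
Qed.

Lemma iter_kappa_nil d u : iter d D u = 0 -> iter d kappa u = 0.
Proof.
elim: d u => [//|d IH] u ud; rewrite iterSr; apply: IH.
exact: kappa_deg.
Qed.

(** G - 1 lowers the degree, so the binomial formula for G^m is polynomial in m. *)
Lemma iter_phase u n : exists v : phase, forall m : nat, v m = iter m G u n.
Proof.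
have [d ud] := iterD_nil u.
exists (\sum_(j < d) beta j (iter j kappa u n)) => m.
rewrite (_ : iter m G u = iter m (fun z : phase => z + kappa z) u); last first.
  by apply: eq_iter => z; rewrite kappaE addrC subrK.
rewrite (iter_add1_nil _ (iter_kappa_nil ud)) !phase_sum.
by apply: eq_bigr => j _; rewrite beta_nat phaseMn.
Qed.

End DiffOperator.

(** Along an ultrafilter realizing [pert f 1], a phase v tends to v(0) + f(v(1) - v(0)). For v(m) =
    (G^m u)(n) this is [powf G f u n], and the estimates satisfied by all powers of G pass to the
    limit. *)
Lemma inK_powf (G : {additive phase -> phase}) (f : {additive A -> A}) :
  kills_torsion f -> inK G -> inK (powf G f).
Proof.
move=> f0 [gG aG]; split; first exact: good_powf.
have [U [UU UP]] := good_ultra (good_pert f0 (ltn0Sn 0)).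
have lim u n : (fun m => iter m G u n) @ U --> powf G f u n.
  have [v vE] := iter_phase gG u n.
  rewrite (_ : (fun m => _) = (fun m : nat => v m)); last first.
    by apply/funext => m; rewrite vE.
  have := UP v; rewrite pertE powfE !phaseD !hcompE /= DE add0r.
  by rewrite (vE 0%N) (vE 1%N) /= phaseB.
move=> x h hc e L xL n.
have cst_lim : (fun=> h (iterz s n x)) @ U --> h (iterz s n x) by exact: cvg_cst.
pose g m := evalL (mapL (iter m G) L) n.
suff gl : g @ U --> evalL (mapL (powf G f) L) n.
  apply: (cvgC_dist_le cst_lim gl) => m.
  exact: (@inK_iter G m x (conj gG aG) h hc e L xL n).
rewrite evalL_map (_ : g =
  (fun m => \sum_(p <- L) p.1 * aval (iter m G p.2 n))); last first.
  by apply/funext => m; rewrite /g evalL_map.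
elim: L {xL g} => [|p L IH].
  rewrite big_nil (_ : (fun m => _) = (fun=> 0)); first exact: cvg_cst.
  by apply/funext => m; rewrite big_nil.
rewrite big_cons (_ : (fun m => _) = (fun m => p.1 * aval (iter m G p.2 n) +
   \sum_(p <- L) p.1 * aval (iter m G p.2 n))); last first.
  by apply/funext => m; rewrite big_cons.
have pU : (fun m => aval (iter m G p.2 n)) @ U --> aval (powf G f p.2 n).
  by apply/cvg_aval; exact: lim.
exact: cvgCD (cvgCZ pU) IH.
Qed.

Lemma iterD_sub_beta k w (c : A) : iter k D w = pcst c ->
  iter k D (w - beta k c) = 0.
Proof. by move=> wc; rewrite raddfB /= wc iterD_beta_cst subrr. Qed.

(* Commutators of [G] in [K] with [u |-> u + f o D^m u]. *)
Lemma killer_commutator (G : {additive phase -> phase}) l m (x y : A) :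
  inK G -> (0 < l)%N -> (0 < m)%N -> ~ torsion x ->
  (forall w, iter l D w = 0 -> G w = w) ->
  torsion (G (beta l x) 0) -> G (beta l y) 0 != 0 ->
  exists K : {additive phase -> phase}, exists z : A, [/\ inK K, z != 0
    & forall u, iter (l + m) D u = pcst x -> K u = u + pcst z].
Proof.
move=> KG l0 m0 xt Gl tx y0; have [gG aG] := KG.
have Gw w c : iter l D w = pcst c -> G w = w + pcst (G (beta l c) 0).
  move=> wc; have : G (w - beta l c) = w - beta l c.
    by apply: Gl; exact: iterD_sub_beta.
  rewrite raddfB /= => /eqP; rewrite subr_eq => /eqP ->.
  have /D_eq0 : D (G (beta l c) - beta l c) = 0.
    case: l l0 Gl {tx y0 wc} => // l _ Gl.
    by rewrite raddfB /= -good_D // D_beta Gl ?subrr // iterD_beta0.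
  rewrite phaseB beta_at0 // subr0; set e := _ 0 => Gb.
  by rewrite -(subrK (beta l c) (G (beta l c))) Gb addrACA addNr addr0.
have [f [f0 fx]] := hom_exists y xt.
pose a := pert f m; have ga : good a by exact: good_pert.
have [a' [ga' aK a'K]] := good_inv ga.
have [G' [KG' GK G'K]] := inK_inv KG.
have Kc : inK (G' \o (a' \o (G \o a))).
  by apply: inK_comp => //; exact: inK_conj.
exists (G' \o (a' \o (G \o a))), (G (beta l y) 0); split => // u ux.
set z := G (beta l y) 0; set w := iter m D u.
have wx : iter l D w = pcst x by rewrite /w -iterD.
have hw : iter l D (hcomp f w) = pcst y.
  rewrite -fx -hcomp_cst -wx; elim: (l) => //= k ->; exact: D_hcomp.
(* The term f(D^m u) has top difference y, so G adds z to it. *)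
have e1 : G (a u) = G u + hcomp f w + pcst z.
  by rewrite /a pertE -/w raddfD /= (Gw _ _ hw) addrA.
(* G moves D^m u by a torsion constant, which f kills. Hence G a u and a G u differ by exactly z. *)
have e2 : a (G u) = G u + hcomp f w.
  rewrite /a pertE -good_iterD // -/w (Gw _ _ wx) raddfD /= hcomp_cst f0 //.
  by rewrite raddf0 addr0.
have [_ a'c _] := ga'; have [[_ G'c _] _] := KG'.
by rewrite /= e1 -e2 raddfD /= a'c aK raddfD /= G'c GK.
Qed.

(** If K fixes all phases of degree less than d, an element moving u adds a constant to it, and the
    same constant to each v with the same top difference, as v - u is fixed. Otherwise some G in K
    begins to act in a positive degree smaller than d, and a commutator carries this action to
    degree d. The conclusion covers all v so that it survives averaging by other elements. *)
Lemma killer u d (x : A) : iter d D u = pcst x -> (0 < d)%N ->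
  d = 1%N \/ ~ torsion x -> ~ fixedK u ->
  exists K : {additive phase -> phase}, exists z : A, [/\ inK K, z != 0
    & forall v, iter d D v = pcst x -> K v = v + pcst z].
Proof.
move=> ux d0 dx nfix.
have [triv|] := pselect (forall G w, inK G -> iter d D w = 0 -> G w = w).
  have [G [KG Gu]] : exists G, inK G /\ G u <> u.
    by apply: contrapT => h; apply: nfix => G KG; apply: contrapT => Gu; apply: h; exists G.
  have [gG _] := KG.
  have Duz : D (G u - u) = 0.
    rewrite raddfB /= -good_D // triv ?subrr // -iterSr iterS ux D_cst //.
  have := D_eq0 Duz; set z := _ 0 => zE; exists G, z; split => // [|v vx].
    by apply/eqP => z0; apply: Gu; apply/eqP; rewrite -subr_eq0 zE z0 raddf0.
  have : G (v - u) = v - u by apply: triv; rewrite // raddfB /= vx ux subrr.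
  rewrite raddfB /= => /eqP; rewrite subr_eq => /eqP ->.
  by rewrite -addrA [- u + _]addrC zE.
move=> /existsNP[G /existsNP[w0 /not_implyP[KG /not_implyP[w0d Gw0]]]].
have [gG _] := KG.
pose P l := `[< exists w, iter l D w = 0 /\ G w <> w >].
have exP : exists l, P l by exists d; apply/asboolP; exists w0.
case: (ex_minnP exP) => -[|[|l]] /asboolP[w [wl Gw]] minl.
- by case: Gw; rewrite (wl : w = 0) raddf0.
- by case: Gw; rewrite (D_eq0 (wl : D w = 0)); case: gG.
have ld : (l.+1 < d)%N by apply: minl; apply/asboolP; exists w0.
have Gl v : iter l.+1 D v = 0 -> G v = v.
  move=> vl; apply: contrapT => Gv.
  by have := minl l.+1 (introT (asboolP _) (ex_intro _ v (conj vl Gv))); rewrite ltnn.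
have xt : ~ torsion x.
  by case: dx => // d1; move: ld; rewrite d1.
pose m := (d - l.+1)%N; have m0 : (0 < m)%N by rewrite subn_gt0.
have dE : d = (l.+1 + m)%N by rewrite subnKC // ltnW.
rewrite dE.
have beta0l (c : A) : beta l.+1 c 0 = 0 by rewrite beta_at0.
have [y Gy] : exists y : A, G (beta l.+1 y) 0 != 0.
  have wE := D_eq0 (wl : D (iter l.+1 D w) = 0); set y := _ 0 in wE.
  exists y; apply/eqP => Gy; apply: Gw.
  have : G (w - beta l.+1 y) = w - beta l.+1 y.
    by apply: Gl; exact: iterD_sub_beta.
  rewrite raddfB /= => /eqP; rewrite subr_eq => /eqP ->.
  have : D (G (beta l.+1 y) - beta l.+1 y) = 0.
    by rewrite raddfB /= -good_D // D_beta Gl ?subrr // iterD_beta0.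
  move=> /D_eq0; rewrite phaseB Gy beta0l subrr raddf0 => /eqP.
  by rewrite subr_eq0 => /eqP ->; rewrite subrK.
have [tx|ntx] := pselect (torsion (G (beta l.+1 x) 0)).
  exact: (killer_commutator KG _ m0 xt Gl tx Gy).
(* When the value of G at x has infinite order, G is replaced by [powf G f] with f sending this
   value to -1. The new value is torsion and nonzero, so x also plays the role of y in the
   commutator. *)
pose h : A := aexp (2^-1).
have h2 : h *+ 2 = 0 by rewrite -aexpMn -[_ *+ 2]mulr_natr mulVf ?pnatr_eq0 // aexp1.
have h0 : h != 0.
  apply/eqP => /aexp_eq0[n n2].
  have : 1 = (2 * n)%:~R :> R by rewrite intrM -n2 mulfV // pnatr_eq0.
  by move=> /eqP; rewrite -[1]/(1%:~R) eqr_int => /eqP; lia.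
have [f [f0 fx]] := hom_exists h ntx.
have KP := inK_powf f0 KG.
have Pb (c : A) : powf G f (beta l.+1 c) 0 = f (G (beta l.+1 c) 0).
  by rewrite powfE phaseD hcompE phaseB beta0l add0r subr0.
apply: (killer_commutator (y := x) KP _ m0 xt) => //.
- by move=> v /Gl Gv; rewrite powfE Gv subrr raddf0 addr0.
- by rewrite Pb fx; exists 2%N.
- by rewrite Pb fx.
Qed.

End Action.

(** * Averaging over the kernel of the action *)

Section NiceSpan.
Variable R : realType.
Notation C := (Cplx R).
Notation A := (acirc R).
Notation phase := (phase R).
Notation D := (@D R).
Notation pshift := (@pshift R).
Implicit Types (u v w : phase) (L : seq (C * phase)).

(* The phases which an element of [K] that moves them can be made to multiply by
   a constant: splitting [Z] into residue classes, every phase is a linear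
   combination of these. *)
Definition nice u := exists d x,
  [/\ iter d D u = pcst x, (0 < d)%N & d = 1%N \/ ~ torsion x].

Definition nspan (g : int -> C) := exists L,
  (forall p, p \in L -> nice p.2) /\ forall n, g n = evalL L n.

Lemma nspanD g h : nspan g -> nspan h -> nspan (fun n => g n + h n).
Proof.
move=> [L [nL gL]] [L' [nL' hL']]; exists (L ++ L'); split => [p|n].
  by rewrite mem_cat => /orP[/nL|/nL'].
by rewrite evalL_cat gL hL'.
Qed.

Lemma nspanZ a g : nspan g -> nspan (fun n => a * g n).
Proof.
move=> [L [nL gL]]; exists [seq (a * p.1, p.2) | p <- L]; split => [p|n].
  by move=> /mapP[q qL ->]; exact: (nL q qL).
by rewrite evalL_scale gL.
Qed.

Lemma root_of_unity_sum (P : nat) (n : int) : (0 < P)%N ->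
  \sum_(j < P) aval ((aexp (P%:R^-1) : A) *~ n *+ j) =
  if (P %| n)%Z then P%:R else 0.
Proof.
move=> P0; set a := aexp _ *~ n.
have PR : P%:R != 0 :> R by rewrite pnatr_eq0 -lt0n.
have aP : a *+ P = 0.
  rewrite /a pmulrn mulrzAC -pmulrn -aexpMn -[_ *+ P]mulr_natr mulVf //.
  by rewrite aexp1 mul0rz.
case: ifPn => [/dvdzP[q nq]|Pn].
  have a0 : a = 0.
    rewrite /a nq mulrC mulrzA -pmulrn -aexpMn -[_ *+ P]mulr_natr mulVf //.
    by rewrite aexp1 mul0rz.
  rewrite a0; under eq_bigr do rewrite mul0rn aval0.
  by rewrite sumr_const card_ord.
have a1 : aval a != 1.
  apply: contra_notN (negP Pn) => /eqP; rewrite -(@aval0 R) => /aval_inj.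
  rewrite /a -aexpMz => /aexp_eq0[k kE]; apply/dvdzP; exists k.
  have h : k%:~R * P%:R = n%:~R :> R.
    by rewrite -kE -[P%:R^-1 *~ n]mulrzr mulrAC mulVf // mul1r.
  by apply/eqP; rewrite -(eqr_int R) intrM -h.
have := subrX1 (aval a) P; rewrite -avalMn aP aval0 subrr => /eqP.
rewrite eq_sym mulf_eq0 subr_eq0 (negbTE a1) /= => /eqP e.
by under eq_bigr do rewrite avalMn.
Qed.

(** Fourier inversion on Z / P: the indicator of the class of m is the average of the characters n
    |-> j (n - m) a, which are phases of degree at most 1. *)
Lemma periodic_linear P v : (0 < P)%N -> iter P pshift v = v -> exists L,
  (forall p, p \in L -> iter 2 D p.2 = 0) /\ forall n, aval (v n) = evalL L n.
Proof.
move=> P0 vP; pose a : A := aexp (P%:R^-1).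
have PC : P%:R != 0 :> C by rewrite pnatr_eq0 -lt0n.
exists [seq (P%:R^-1 * aval (v m%:Z), beta 1 (a *+ j) - pcst (a *+ j *+ m)) |
         m <- index_iota 0 P, j <- index_iota 0 P]; split => [p|n].
  move=> /allpairsP[[m j] [_ _ ->]] /=.
  by rewrite raddfB /= D_beta D_cst subr0 beta0 D_cst.
rewrite /evalL big_allpairs_dep /= big_mkord.
have vPz (q : int) l : v (l + q * P%:Z) = v l.
  have vPn j k : v (k + (j * P)%N%:Z) = v k.
    elim: j k => [|j IH] k; first by rewrite addr0.
    by rewrite mulSn PoszD addrA IH -iter_shiftE vP.
  case: q => j; first by rewrite -PoszM vPn.
  by rewrite -(vPn j.+1) NegzE PoszM mulNr subrK.
have Pn0 : P%:Z != 0 by rewrite eqz_nat -lt0n.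
have [r rP nr] : exists2 r, (r < P)%N & (n %% P)%Z = r%:Z.
  have := ltz_pmod n (P0 : (0 < P%:Z)%R); have := modz_ge0 n Pn0.
  by case: (n %% P)%Z => [k|k] // _ kP; exists k.
have nE := divz_eq n P; rewrite nr in nE.
transitivity (\sum_(m < P) aval (v m%:Z) *
    (P%:R^-1 * \sum_(j < P) aval (a *~ (n - m%:Z) *+ j))); last first.
  apply: eq_bigr => m _; rewrite big_mkord !mulr_sumr; apply: eq_bigr => j _.
  rewrite mulrCA mulrA; congr (_ * aval _).
  have bn : binz n 1 = n.
    by case: (n) => k; rewrite /= bin1 // addn1 NegzE expr1 mulN1r.
  rewrite phaseB pcstE betaE bn -!mulrnA mulrzBr mulrnBl [(j * m)%N]mulnC.
  by rewrite !pmulrn PoszM !mulrzA ![_ *~ j]mulrzAC.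
rewrite (bigD1 (Ordinal rP)) //= root_of_unity_sum // big1 ?addr0.
  rewrite (_ : (P %| n - r%:Z)%Z) ?mulVf ?mulr1 //.
    by rewrite nE addrC vPz.
  by rewrite nE addrK dvdz_mull.
move=> m mr; rewrite root_of_unity_sum // ifN ?mulr0 //.
apply: contraNN mr => /dvdzP[q nm]; apply/eqP/val_inj => /=.
have mn : n = (q * P%:Z + m%:Z) by rewrite -nm subrK.
have : (n %% P)%Z = m%:Z by rewrite mn modzMDl modz_small //= ltz_nat.
by rewrite nr => -[].
Qed.

Lemma nspan_nice u : nice u -> nspan (fun n => aval (u n)).
Proof.
move=> nu; exists [:: (1, u)]; split => [p|n]; first by rewrite inE => /eqP ->.
by rewrite evalL_cons evalL_nil addr0 mul1r.
Qed.

(** By induction on the degree. If the leading coefficient x is torsion, the leading term b is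
    periodic, hence a combination of phases of degree at most 1, and each of these plus u - b has
    smaller degree than u. *)
Lemma nice_span u : nspan (fun n => aval (u n)).
Proof.
have low v : iter 2 D v = 0 -> nice v.
  by move=> v2; exists 1%N, (D v 0); split; [exact: D_eq0 | | left].
have [d] := iterD_nil u; elim: d u => [|[|[|d]] IH] u ud.
- by apply/nspan_nice/low; rewrite (ud : u = 0) raddf0.
- by apply/nspan_nice/low; rewrite /= (ud : D u = 0) raddf0.
- exact/nspan_nice/low.
have ux := D_eq0 (ud : D (iter d.+2 D u) = 0); set x := _ 0 in ux.
have [[N N0 xN]|xt] := pselect (torsion x); last first.
  by apply: nspan_nice; exists d.+2, x; split => //; right.
pose b := beta d.+2 x.
have bN : D b *+ N = 0 by rewrite D_beta -raddfMn xN raddf0.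
have bP := phase_period (iterD_beta0 d.+2 x) bN.
have [|L [L2 bL]] := periodic_linear _ bP; first by rewrite expn_gt0 N0.
rewrite (_ : (fun n => _) =
    (fun n => \sum_(p <- L) p.1 * aval ((p.2 + (u - b)) n))); last first.
  apply/funext => n; rewrite -[in LHS](subrK b u) phaseD avalD bL mulrC.
  by rewrite /evalL big_distrl /=; apply: eq_bigr => p _; rewrite phaseD avalD mulrA.
have {bL} : forall p, p \in L -> nspan (fun n => aval ((p.2 + (u - b)) n)).
  move=> p /L2 p2; apply: IH.
  have pd : iter d.+2 D p.2 = 0 by rewrite -[d.+2]addn2 iterD p2 raddf0.
  by rewrite [LHS]raddfD [X in X + _]pd add0r; exact: iterD_sub_beta.
elim: {L2} L => [|p L IHL] h.
  by exists [::]; split => // n; rewrite big_nil evalL_nil.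
have [|L' [nL' L'E]] := IHL; first by move=> q qL; apply: h; rewrite inE qL orbT.
have [L1 [nL1 L1E]] := nspanD (nspanZ p.1 (h p (mem_head _ _)))
  (ex_intro _ L' (conj nL' L'E)).
by exists L1; split => // n; rewrite big_cons -L1E.
Qed.

Lemma nspan_evalL L : nspan (evalL L).
Proof.
elim: L => [|p L IH]; first by exists [::].
have [L' [nL' L'E]] := nspanD (nspanZ p.1 (nice_span p.2)) IH.
by exists L'; split => // n; rewrite evalL_cons L'E.
Qed.

End NiceSpan.

Section Averaging.
Variables (R : realType) (X : topologicalType) (s : homeo X).
Hypotheses (X_compact : compact [set: X]) (X_hausdorff : hausdorff_space X).
Notation C := (Cplx R).
Notation A := (acirc R).
Notation phase := (phase R).
Notation D := (@D R).
Implicit Types (x : X) (u v w : phase) (L : seq (C * phase)).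
Hypothesis W4 : forall x : X,
  omega s x @` [set f : X -> C | continuous f] `<=` @calW R.
Notation inK := (@inK R X s).
Notation fixedK := (@fixedK R X s).
Notation close_to := (@close_to R X s).

Definition average (K : phase -> phase) N L : seq (C * phase) :=
  flatten [seq [seq (N%:R^-1 * p.1, iter m K p.2) | p <- L] | m <- iota 0 N].

Lemma evalL_flatten (Ls : seq (seq (C * phase))) n :
  evalL (flatten Ls) n = \sum_(L <- Ls) evalL L n.
Proof.
elim: Ls => [|L Ls IH]; first by rewrite big_nil evalL_nil.
by rewrite big_cons /= evalL_cat IH.
Qed.

Lemma evalL_average K N L n :
  evalL (average K N L) n = N%:R^-1 * \sum_(m < N) evalL (mapL (iter m K) L) n.
Proof.
rewrite evalL_flatten big_map -{1}[N]subn0 -/(index_iota 0 N) big_mkord mulr_sumr.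
apply: eq_bigr => m _; rewrite evalL_map mulr_sumr /evalL big_map.
by apply: eq_bigr => p _; rewrite /= mulrA.
Qed.

Lemma average_cat K N L L' n : evalL (average K N (L ++ L')) n =
  evalL (average K N L) n + evalL (average K N L') n.
Proof.
rewrite !evalL_average -mulrDr -big_split /=; congr (_ * _).
by apply: eq_bigr => m _; rewrite /mapL map_cat evalL_cat.
Qed.

Lemma average_flatten K N Ls n : evalL (average K N (flatten Ls)) n =
  evalL (flatten [seq average K N L | L <- Ls]) n.
Proof.
rewrite evalL_flatten big_map; elim: Ls => [|L Ls IH].
  rewrite big_nil evalL_average /= big1 ?mulr0 // => m _.
  by rewrite /mapL /= evalL_nil.
by rewrite big_cons /= average_cat IH.
Qed.

Lemma average_fixed K N L n : (0 < N)%N ->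
  (forall p, p \in L -> K p.2 = p.2) -> evalL (average K N L) n = evalL L n.
Proof.
move=> N0 KL; rewrite evalL_average.
rewrite (eq_bigr (fun=> evalL L n)) => [|m _].
  by rewrite sumr_const card_ord -[evalL L n *+ N]mulr_natl mulKf // pnatr_eq0 -lt0n.
rewrite evalL_map; apply: eq_big_seq => p /KL Kp; congr (_ * aval _).
by have -> : iter m K p.2 = p.2 by elim: (nat_of_ord m) => //= k ->.
Qed.

(** K fixes x, so each power of K sends an approximation of the orbit function of x to another one;
    an average of approximations is again one. *)
Lemma close_average f x e K N L : continuous f -> inK K -> (0 < N)%N ->
  close_to f x e L -> close_to f x e (average K N L).
Proof.
move=> fc KK N0 h n; have NC : N%:R != 0 :> C by rewrite pnatr_eq0 -lt0n.
have -> : f (iterz s n x) - evalL (average K N L) n =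
    N%:R^-1 * \sum_(m < N) (f (iterz s n x) - evalL (mapL (iter m K) L) n).
  rewrite sumrB mulrBr -evalL_average; congr (_ - _).
  by rewrite sumr_const card_ord -[f _ *+ N]mulr_natl mulKf.
rewrite normrM normfV normr_nat ler_pdivrMl ?ltr0n //.
apply: (le_trans (ler_norm_sum _ _ _)).
apply: (@le_trans _ _ (\sum_(m < N) e%:C%C)).
  by apply: ler_sum => m _; exact: (@inK_iter R X s K m x KK f fc e L h n).
by rewrite sumr_const card_ord -[e%:C%C *+ N]mulr_natl.
Qed.

(** All phases of [L] share their d-th difference, and a single element of the kernel adds z to each
    of them. The operators of the kernel preserve this difference, so averaging by another element
    keeps a family killable. *)
Definition killable L := exists d (c : A), (forall p, p \in L -> iter d D p.2 = pcst c) /\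
  exists K z, [/\ inK K, z != 0 & forall v, iter d D v = pcst c -> K v = v + pcst z].

Lemma killable_average L K N : inK K -> killable L -> killable (average K N L).
Proof.
move=> [gK _] [d [c [Lc h]]]; exists d, c; split => // p.
move=> /flattenP[l /mapP[m _ ->] /mapP[q /Lc qc ->]] /=.
elim: m => //= m IH; rewrite -good_iterD // IH.
by case: gK => _ ->.
Qed.

(** The average is the value of [L] times a geometric mean of ratio [aval z], of modulus at most 2 /
    (N |z - 1|) uniformly in n. *)
Lemma average_killed L (K : {additive phase -> phase}) (z : A) : z != 0 ->
  (forall m p, p \in L -> iter m K p.2 = p.2 + pcst (z *+ m)) ->
  forall e : R, 0 < e -> exists N, (0 < N)%N /\ forall n, `|evalL (average K N L) n| <= e%:C%C.
Proof.
move=> z0 KL e e0; have [M LM] := evalL_bnd L.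
have z1 : aval z - 1 != 0.
  by rewrite subr_eq0; apply: contraNneq z0; rewrite -(@aval0 R) => /aval_inj ->.
have [r zr] := normC_real (aval z - 1).
have r0 : 0 < r by rewrite -ltcR -zr normr_gt0.
have M0 : 0 <= M by rewrite -ler0c (le_trans _ (LM 0)).
pose N := (Num.truncn (2 * M / (r * e))).+1; exists N; split => // n.
have NR : 2 * M <= N%:R * (r * e).
  by rewrite -ler_pdivrMr ?mulr_gt0 // ltW // truncnS_gt.
have -> : evalL (average K N L) n =
    N%:R^-1 * (\sum_(m < N) aval z ^+ m) * evalL L n.
  rewrite evalL_average -mulrA mulr_suml; congr (_ * _); apply: eq_bigr => m _.
  rewrite evalL_map /evalL mulr_sumr; apply: eq_big_seq => p pL.
  by rewrite KL // phaseD pcstE avalD avalMn mulrA [RHS]mulrC.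
have geo : (aval z - 1) * (\sum_(m < N) aval z ^+ m) = aval z ^+ N - 1.
  by rewrite subrX1.
have : r%:C%C * `|\sum_(m < N) aval z ^+ m| <= 2.
  rewrite -zr -normrM geo (le_trans (ler_normB _ _)) // normr1 normrX aval_norm.
  by rewrite expr1n.
have [t tE] := normC_real (\sum_(m < N) aval z ^+ m).
rewrite tE -rmorphM -[2 : C](rmorph_nat (real_complex R)) lecR => rt.
have t0 : 0 <= t by rewrite -ler0c -tE normr_ge0.
have N1 : 0 < N%:R :> R by rewrite ltr0n.
rewrite !normrM tE normfV normr_nat.
apply: (@le_trans _ _ (N%:R^-1 * t%:C%C * M%:C%C)).
  by apply: ler_wpM2l => //; rewrite mulr_ge0 ?invr_ge0 ?ler0n // ler0c.
have -> : N%:R^-1 * t%:C%C * M%:C%C = (N%:R^-1 * t * M)%:C%C :> C.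
  by rewrite !rmorphM /= fmorphV rmorph_nat.
rewrite lecR -mulrA ler_pdivrMl // -(ler_pM2l r0) mulrA.
by apply: (le_trans (ler_wpM2r M0 rt)); rewrite mulrCA.
Qed.

(** The families are removed one at a time. Averaging to remove G leaves the fixed phases unchanged
    and the other families killable, and costs half of the remaining tolerance d. *)
Lemma close_fixed f x (Gs : seq (seq (C * phase))) : continuous f ->
  forall e L, (forall p, p \in L -> fixedK p.2) ->
  (forall G, G \in Gs -> killable G) ->
  close_to f x e (flatten Gs ++ L) ->
  forall d, 0 < d -> close_to f x (e + d) L.
Proof.
move=> fc; have [k] := ubnP (size Gs); elim: k Gs => // k IH [|G Gs] szG e L Lf kG h d d0.
  move=> n; rewrite (le_trans (h n)) // lecR; lra.
have [|dG [c [Gc [K [z [KK z0 Kz]]]]]] := kG G; first exact: mem_head.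
have [[_ Kc _] _] := KK; have d2 : 0 < d / 2 by rewrite divr_gt0.
have Km m p : p \in G -> iter m K p.2 = p.2 + pcst (z *+ m).
  move=> /Gc pc; elim: m => [|m IHm] /=; first by rewrite raddf0 addr0.
  by rewrite IHm raddfD /= (Kz _ pc) Kc mulrS raddfD addrA.
have [N [N0 NG]] := average_killed z0 Km d2.
have -> : e + d = (e + d / 2) + d / 2 by lra.
apply: (IH [seq average K N G' | G' <- Gs]) => //.
- by rewrite size_map.
- move=> G' /mapP[G1 G1s ->]; apply: killable_average => //; apply: kG.
  by rewrite inE G1s orbT.
move=> n; have /= := close_average fc KK N0 h n.
rewrite -catA average_cat average_cat average_flatten (@average_fixed K N L n N0); last first.
  by move=> p pL; exact: (Lf p pL K KK).
rewrite -evalL_cat; set a := evalL (_ ++ _) n => ha.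
rewrite (_ : _ - a = (f (iterz s n x) - (evalL (average K N G) n + a)) +
  evalL (average K N G) n); last by ring.
by rewrite rmorphD (le_trans (ler_normD _ _)) // lerD.
Qed.

Lemma approx_fixed f x e : continuous f -> 0 < e ->
  exists L, (forall p, p \in L -> fixedK p.2) /\ close_to f x e L.
Proof.
move=> fc e0; have e2 : 0 < e / 2 by rewrite divr_gt0.
have [L0 L0c] := W4_close W4 x fc e2.
have [L [nL L0L]] := nspan_evalL L0.
have Lc : close_to f x (e / 2) L by move=> n; rewrite -L0L; exact: L0c.
pose Q (p : C * phase) := `[< fixedK p.2 >].
exists [seq p <- L | Q p]; split => [p|].
  by rewrite mem_filter => /andP[/asboolP].
rewrite [e]splitr; apply: (@close_fixed f x [seq [:: p] | p <- L & ~~ Q p]) => //.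
- by move=> p; rewrite mem_filter => /andP[/asboolP].
- move=> G /mapP[p]; rewrite mem_filter => /andP[/asboolPn pf /nL[d [c [pc d0 dc]]]] ->.
  exists d, c; split; first by move=> q; rewrite inE => /eqP ->.
  exact: (killer X_compact X_hausdorff W4 pc d0 dc pf).
move=> n; rewrite (_ : evalL _ n = evalL L n) //.
rewrite evalL_cat evalL_flatten !big_map /evalL !big_filter [RHS](bigID Q) /= addrC.
by congr (_ + _); apply: eq_bigr => p _; rewrite big_seq1.
Qed.

End Averaging.

(** * The enveloping semigroup *)

Section LinSpan.
Variables (R : realType) (T : Type) (A : set (T -> Cplx R)).
Notation C := (Cplx R).

Lemma lin_span_subspace : is_subspace (lin_span A).
Proof.
split=> [V [[V0 _] _] //|a f g fA gA V VA].
by have [[_ VL] _] := VA; apply: VL; [exact: fA | exact: gA].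
Qed.

Lemma lin_span_mem : A `<=` lin_span A.
Proof. by move=> f Af V [_ AV]; exact: AV. Qed.

Lemma lin_span_ind (V : set (T -> C)) : is_subspace V -> A `<=` V ->
  lin_span A `<=` V.
Proof. by move=> VS AV f; apply. Qed.

Hypothesis AM : forall f g, A f -> A g -> A (fun t => f t * g t).

Lemma lin_spanM f g : lin_span A f -> lin_span A g ->
  lin_span A (fun t => f t * g t).
Proof.
have [S0 SL] := lin_span_subspace.
have main h : A h -> forall f, lin_span A f -> lin_span A (fun t => f t * h t).
  move=> Ah; apply: lin_span_ind => [|k Ak]; last by apply: lin_span_mem; exact: AM.
  split=> [|a f1 f2 h1 h2] /=.
    by rewrite (_ : (fun _ => _) = (fun=> 0)) //; apply/funext => t; rewrite mul0r.
  rewrite (_ : (fun _ => _) = (fun t => a * (f1 t * h t) + f2 t * h t)); first exact: SL.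
  by apply/funext => t; rewrite mulrDl mulrA.
move=> fA; move: g; apply: lin_span_ind => [|k Ak]; last exact: main.
split=> [|a f1 f2 h1 h2] /=.
  by rewrite (_ : (fun _ => _) = (fun=> 0)) //; apply/funext => t; rewrite mulr0.
rewrite (_ : (fun _ => _) = (fun t => a * (f t * f1 t) + f t * f2 t)); first exact: SL.
by apply/funext => t; rewrite mulrDr mulrCA.
Qed.

Lemma lin_span_conj f : (forall f, A f -> A (fun t => (f t)^*)) ->
  lin_span A f -> lin_span A (fun t => (f t)^*).
Proof.
move=> AJ; move: f; have [S0 SL] := lin_span_subspace.
apply: lin_span_ind => [|k Ak]; last by apply: lin_span_mem; exact: AJ.
split=> [|a f1 f2 h1 h2] /=.
  by rewrite (_ : (fun _ => _) = (fun=> 0)) //; apply/funext => t; rewrite rmorph0.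
rewrite (_ : (fun _ => _) = (fun t => a^* * (f1 t)^* + (f2 t)^*)); first exact: SL.
by apply/funext => t; rewrite rmorphD rmorphM.
Qed.

Lemma lin_span_bounded f : (forall f, A f -> exists M : R, forall t, `|f t| <= M%:C%C) ->
  lin_span A f -> exists M : R, forall t, `|f t| <= M%:C%C.
Proof.
move=> Ab; move: f; apply: lin_span_ind => [|k Ak]; last exact: Ab.
split=> [|a f1 f2 [M1 h1] [M2 h2]]; first by exists 0 => t; rewrite normr0.
have [r ar] := normC_real a; exists (r * M1 + M2) => t.
rewrite rmorphD rmorphM (le_trans (ler_normD _ _)) // lerD // normrM ar.
by rewrite ler_wpM2l // -ar.
Qed.

End LinSpan.

Section QuasiEigen.
Variables (R : realType) (X : topologicalType) (s : X -> X).
Notation A := (acirc R).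

Lemma qeigenSP m (f : X -> A) : @qeigen R X s m.+1 f <-> continuous f /\
  exists2 g : X -> A, @qeigen R X s m g & forall x, f (s x) = g x + f x.
Proof. by []. Qed.

Lemma qeigenS m (f : X -> A) : @qeigen R X s m f -> @qeigen R X s m.+1 f.
Proof.
elim: m f => [f [c _ <-]|m IH f [fc [g gm fg]]].
  split; first by move=> x; exact: cvg_cst.
  by exists (fun=> 0 : A); [exists (0 : A) | move=> x; apply/esym/(add0r (c : A))].
by split => //; exists g => //; exact: IH.
Qed.

Lemma qeigen_leq m n (f : X -> A) : (m <= n)%N ->
  @qeigen R X s m f -> @qeigen R X s n f.
Proof. by move=> /subnK <-; elim: (n - m)%N => // k IH /IH; exact: qeigenS. Qed.

Lemma qeigenB m (f g : X -> A) : @qeigen R X s m f -> @qeigen R X s m g ->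
  @qeigen R X s m (fun x => f x - g x).
Proof.
elim: m f g => [_ _ [c _ <-] [d _ <-]|m IH f g].
  by exists ((c : A) - (d : A)).
move=> /qeigenSP[fc [f' f'm ff]] /qeigenSP[gc [g' g'm gg]]; apply/qeigenSP.
split; first by move=> x; apply: cvgAB; [exact: fc | exact: gc].
exists (fun x => f' x - g' x) => [|x]; first exact: IH.
by rewrite ff gg opprD addrACA.
Qed.

Lemma qeigen_allB (f g : X -> A) : qeigen_all s f -> qeigen_all s g ->
  qeigen_all s (fun x => f x - g x).
Proof.
move=> [m _ fm] [n _ gn]; exists (maxn m n) => //; apply: qeigenB.
  exact: qeigen_leq (leq_maxl _ _) fm.
exact: qeigen_leq (leq_maxr _ _) gn.
Qed.

Lemma qeigen_all_cst (c : A) : qeigen_all s (fun=> c).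
Proof. by exists 0%N => //; exists c. Qed.

Lemma qeigen_allN (f : X -> A) : qeigen_all s f -> qeigen_all s (fun x => - f x).
Proof.
move=> fq; have := qeigen_allB (qeigen_all_cst 0) fq; congr qeigen_all.
by apply/funext => x; rewrite sub0r.
Qed.

Lemma qeigen_allD (f g : X -> A) : qeigen_all s f -> qeigen_all s g ->
  qeigen_all s (fun x => f x + g x).
Proof.
move=> fq /qeigen_allN gq; have := qeigen_allB fq gq; congr qeigen_all.
by apply/funext => x; rewrite opprK.
Qed.

End QuasiEigen.

Section EnvelopingSystem.
Variables (R : realType) (X : topologicalType) (s : homeo X).
Hypotheses (X_compact : compact [set: X]) (X_hausdorff : hausdorff_space X).
Notation C := (Cplx R).
Notation A := (acirc R).
Notation phase := (phase R).
Notation D := (@D R).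
Notation E := (env_semigroup s).

Definition env_iter (n : int) : E :=
  exist _ (iterz s n : {ptws X -> X})
    (mem_set (subset_closure (ex_intro2 _ _ n Logic.I erefl) : E (iterz s n))).

Lemma cvg_env (T : Type) (F : set_system T) (f : T -> E) (a : E) : Filter F ->
  (forall x, (fun t => (set_val (f t) : X -> X) x) @ F --> (set_val a : X -> X) x)
    <-> f @ F --> a.
Proof.
move=> FF; rewrite -cvg_set_val.
exact: (@cvg_ptws T X X F (fun t => set_val (f t)) (set_val a)).
Qed.

Lemma env_iter_dense (a : E) : closure (range env_iter) a.
Proof.
have /env_ultra[U [UU Ua]] : E (set_val a) by exact: set_valP.
by apply/closure_ultra; exists U; split => //; apply/cvg_env.
Qed.

Lemma env_compact : compact [set: E].
Proof.
rewrite compact_ultra => U UU _.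
have /choice[b bP] x := ultra_compact (fun a : E => (set_val a : X -> X) x) UU X_compact.
have Ub : (fun a : E => set_val a : {ptws X -> X}) @ U --> (b : {ptws X -> X}).
  by apply/cvg_ptws.
have Eb : E b.
  apply: (@closed_closure {ptws X -> X} (range (iterz s))) => B /Ub UB.
  have [a Ba] := @filter_ex _ U _ _ UB.
  by exists (set_val a); split => //; exact: set_valP.
exists (exist _ b (mem_set Eb)); split => //.
by apply/(@cvg_env _ U id).
Qed.

Lemma lambda_env_iter n : lambda (env_iter n) = env_iter (n + 1).
Proof. by apply: val_inj; apply/funext => x; rewrite /= iterzS1. Qed.

Lemma qeigen_phase m (q : E -> A) : @qeigen R E (@lambda X s) m q ->
  is_phase (fun n => q (env_iter n)).
Proof.
elim: m q => [_ [c _ <-]|m IH q /qeigenSP[_ [f fm qf]]].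
  exact: (phaseP (pcst c)).
apply: (@antidif_subproof R _ (Phase (IH f fm))) => n.
by rewrite -lambda_env_iter qf addrK.
Qed.

(** f composed with the evaluation at x is continuous on the enveloping semigroup, and generalized
    eigenfunctions restrict to phases along the iterates of s. *)
Lemma W_system_calW x : W_system R s ->
  omega s x @` [set f : X -> C | continuous f] `<=` @calW R.
Proof.
move=> Ws _ [f fc <-]; apply/calWP => e e0.
pose F (a : E) := f ((set_val a : X -> X) x).
have Fc : continuous F.
  move=> a; have Fa : Filter (nbhs a) by exact: nbhs_filter.
  have ca : id @ nbhs a --> a by exact: cvg_id.
  move/(@cvg_env E (nbhs a) id a Fa)/(_ x) : ca.
  exact: (@cvg_continuousC R X E (nbhs a) (fun a : E => (set_val a : X -> X) x)).
have /uniform_closureP/(_ e e0)[g gS Fg] := Ws F Fc.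
suff [L gL] : exists L, forall n, g (env_iter n) = evalL L n.
  by exists L => n; rewrite -gL; exact: (Fg (env_iter n)).
move: g gS {Fg}; apply: lin_span_ind => [|_ [q [m _ qm] <-]].
  split=> [|a g h [L gL] [L' hL]]; first by exists [::] => n; rewrite evalL_nil.
  exists ([seq (a * p.1, p.2) | p <- L] ++ L') => n.
  by rewrite evalL_cat evalL_scale gL hL.
exists [:: (1, Phase (qeigen_phase qm))] => n.
by rewrite evalL_cons evalL_nil addr0 mul1r.
Qed.

Hypothesis W4 : forall x : X,
  omega s x @` [set f : X -> C | continuous f] `<=` @calW R.

Definition extends (h : E -> A) (u : phase) := forall U : set_system int,
  UltraFilter U -> forall a : E, env_iter @ U --> a -> (u : int -> A) @ U --> h a.

(** If U and V have the same limit in the enveloping semigroup, their operators differ by an element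
    of the kernel. This element fixes u, so u has the same limit along U and V. *)
Lemma fixed_extension u : fixedK s u ->
  exists h : E -> A, continuous h /\ extends h u.
Proof.
move=> uK; apply: dense_extension; [exact: circ_compact | exact: circ_hausdorff |
  exact: env_iter_dense |].
move=> U V UU UV a /cvg_env Ua /cvg_env Va z uz.
have gU := @good_uop R U UU; have gV := @good_uop R V UV.
have [H [gH VK HK]] := good_inv gV.
have KHU : inK s (H \o @uop R U UU).
  split=> [|x]; first exact: good_comp.
  apply: act_comp (act_uop UU (Ua x)) _.
  exact: (act_inv X_compact X_hausdorff W4 gH VK (act_uop UV (Va x))).
have : @uop R U UU u = @uop R V UV u.
  by apply: (can_inj HK); rewrite VK; exact: uK KHU.
move=> /(congr1 (fun v : phase => v 0)); rewrite !uop_at0 (ulim_eq uz) => ->.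
exact: ulimP.
Qed.

(** The multiplier of the extension of u is the extension of [D u], which the kernel also fixes. *)
Lemma fixed_qeigen d u : fixedK s u -> iter d.+1 D u = 0 ->
  exists h : E -> A, [/\ continuous h, extends h u & @qeigen R E (@lambda X s) d h].
Proof.
elim: d u => [|d IH] u uK ud; have [h [hc hu]] := fixed_extension uK;
  exists h; split => //.
  exists (u 0) => //; apply/funext => a.
  have /closure_ultra[U [UU Ua]] := @env_iter_dense a.
  apply: (@cvgA_unique R _ U _ u _ _ _ (hu U UU a Ua)).
  by rewrite (D_eq0 ud); exact: cvg_cst.
have DK : fixedK s (D u).
  by move=> G KG; have [gG _] := KG; rewrite good_D // uK.
have [|h' [h'c h'u h'q]] := IH _ DK; first by rewrite -iterSr.
apply/qeigenSP; split => //; exists h' => // a.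
have /closure_ultra[U [UU Ua]] := @env_iter_dense a.
have uh := hu U UU a Ua; have uh' := h'u U UU a Ua.
(* Translating the ultrafilter by 1 replaces the limit a by [lambda a]. *)
pose V := (fun n : int => n + 1) @ U.
have UV : UltraFilter V by exact: ultra_fmap.
have Va : env_iter @ V --> lambda a.
  apply/(@cvg_env _ V) => x; move/cvg_env : Ua => /(_ x) Ua.
  rewrite (_ : (fun t => _) @ V = (fun n => s (iterz s n x)) @ U); last first.
    rewrite /V -fmap_comp; congr (_ @ U); apply/funext => n /=.
    exact: iterzS1.
  apply: (@cvg_comp _ _ _ (fun n => iterz s n x) s _ (nbhs (set_val a x))) => //.
  exact: hfun_continuous.
have uV := hu V UV _ Va.
have UVE : (u : int -> A) @ V = (fun n => u (n + 1)) @ U by [].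
rewrite UVE in uV.
apply: (@cvgA_unique R _ U _ _ _ _ uV).
have FU : Filter U by exact: _.
have := cvgAD FU uh' uh; rewrite (_ : (fun t => _) = (fun n => u (n + 1))) //.
by apply/funext => n; rewrite DE subrK.
Qed.

(** What has to be checked is that generalized eigenfunctions separate the points of the enveloping
    semigroup. If they agree at a and b, so do the extensions of the fixed phases that approximate
    the orbit function of f at x; hence f (a x) = f (b x) for all f and x. *)
Lemma calW_W_system : W_system R s.
Proof.
move=> u uc; apply/uniform_closureP => e e0.
have cE : forall U : set_system E, UltraFilter U -> exists a : E, U --> a.
  by move=> U UU; have := ultra_compact id UU env_compact.
set B := [set (@cval R) \o g | g in qeigen_all (@lambda X s)].
have Bc c : lin_span B (fun=> c).
  have [S0 SL] := lin_span_subspace B.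
  have B1 : B (fun=> 1) by exists (fun=> 0 : A) => //; exact: qeigen_all_cst.
  have := SL c _ _ (lin_span_mem B1) S0; congr lin_span.
  by apply/funext => a; rewrite mulr1 addr0.
have BM f g : B f -> B g -> B (fun a => f a * g a).
  move=> [f' f'q <-] [g' g'q <-]; exists (fun a => (f' a : A) + g' a) => //.
  exact: qeigen_allD.
have BJ f : B f -> B (fun a => (f a)^*).
  move=> [f' f'q <-]; exists (fun a => - (f' a : A)); first exact: qeigen_allN.
  apply/funext => a /=; rewrite -[cval _]/(aval (- (f' a : A))) avalN.
  by rewrite invC_norm aval_norm expr1n invr1 mul1r.
have Bb f : B f -> exists M : R, forall a, `|f a| <= M%:C%C.
  by move=> [f' _ <-]; exists 1 => a; rewrite cval_norm lexx.
have ucvg (U : set_system E) (a : E) : UltraFilter U -> U --> a -> u @ U --> u a.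
  move=> UU Ua; have cu : u @ nbhs a --> u a by exact: uc.
  exact: (fun P uP => Ua _ (cu P uP)).
apply: (@stone_weierstrass R E (lin_span B) Bc _ _ _ _ u _ _ e e0) => //.
- move=> f g fB gB; have [S0 SL] := lin_span_subspace B.
  have := SL 1 _ _ fB gB; congr lin_span; apply/funext => a; by rewrite mul1r.
- by move=> f g; exact: lin_spanM.
- by move=> f; exact: lin_span_conj.
- by move=> f; exact: lin_span_bounded.
- by move=> U UU; have [a Ua] := cE U UU; exists (u a); exact: ucvg.
move=> U V UU UV UVB z uz.
have [a Ua] := cE U UU; have [b Vb] := cE V UV.
have -> : z = u a by apply: (cvgC_unique uz); exact: ucvg.
suff -> : a = b by exact: ucvg.
apply: val_inj; apply/funext => x; apply: contrapT.
move=> /(@separate_points R X X_compact _ _ X_hausdorff)[f [fc]]; apply.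
apply: eqC_dist => e' e'0; have e2 : 0 < e' / 2 by rewrite divr_gt0.
have [L [LK Lc]] := approx_fixed X_compact X_hausdorff W4 x fc e2.
(* l is the common value at a and b of the continuous extension of [evalL L]. *)
have [l lP] : exists l : C, forall W : set_system int, UltraFilter W ->
    env_iter @ W --> a \/ env_iter @ W --> b -> evalL L @ W --> l.
  elim: L LK {Lc} => [_|p L IH LK].
    exists 0 => W WW _; rewrite (_ : evalL [::] = (fun=> 0)); first exact: cvg_cst.
    by apply/funext => n; rewrite evalL_nil.
  have [|l lP] := IH; first by move=> q qL; apply: LK; rewrite inE qL orbT.
  have [d pd] := iterD_nil p.2.
  have pd1 : iter d.+1 D p.2 = 0 by rewrite iterS pd raddf0.
  have [h [hc hp hq]] := fixed_qeigen (LK p (mem_head _ _)) pd1.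
  have hB : lin_span B (fun c => aval (h c)).
    by apply: lin_span_mem; exists h => //; exists d.
  have hC : continuous (fun c => aval (h c)).
    move=> c; have Fc : Filter (nbhs c) by exact: nbhs_filter.
    exact: ((@cvg_aval R _ _ h (h c) Fc).2 (hc c)).
  have hU (W : set_system E) (c : E) : UltraFilter W -> W --> c ->
      (fun c => aval (h c)) @ W --> aval (h c).
    by move=> WW Wc; exact: (fun P uP => Wc _ (hC c P uP)).
  have hab : h a = h b.
    by apply: aval_inj; exact: (cvgC_unique (UVB _ hB _ (hU U a UU Ua)) (hU V b UV Vb)).
  exists (p.1 * aval (h a) + l) => W WW Wab.
  have pW : (fun n => aval (p.2 n)) @ W --> aval (h a).
    by apply/cvg_aval; case: Wab => /hp // hW; rewrite hab; exact: hW.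
  rewrite (_ : evalL _ = (fun n => p.1 * aval (p.2 n) + evalL L n)).
    exact: cvgCD (cvgCZ pW) (lP W WW Wab).
  by apply/funext => n; rewrite evalL_cons.
have main c : c = a \/ c = b -> `|f ((set_val c : X -> X) x) - l| <= (e' / 2)%:C%C.
  move=> cab; have /closure_ultra[W [WW Wc]] := @env_iter_dense c.
  have lW : evalL L @ W --> l by apply: lP; case: cab => <-; [left|right].
  have fW : (fun n => f (iterz s n x)) @ W --> f ((set_val c : X -> X) x).
    by apply: cvg_continuousC => //; move/cvg_env : Wc => /(_ x).
  exact: cvgC_dist_le fW lW Lc.
set fa := f _; set fb := f _.
rewrite (_ : fa - fb = (fa - l) - (fb - l)); last by ring.
rewrite [e']splitr rmorphD (le_trans (ler_normB _ _)) // lerD //.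
  by apply: main; left.
by apply: main; right.
Qed.

End EnvelopingSystem.

(** * Minimal systems *)

Section Minimal.
Variables (R : realType) (X : topologicalType) (s : homeo X).
Hypothesis s_minimal : minimal s.
Notation C := (Cplx R).

Lemma minimal_orbit (x y : X) : exists U : set_system int,
  UltraFilter U /\ (fun n => iterz s n x) @ U --> y.
Proof.
apply/closure_ultra => B; rewrite nbhsE; case=> P [oP yP] PB.
have [_ dx] := s_minimal.
have [z [Pz xz]] := dx x P (ex_intro _ y yP) oP.
by exists z; split => //; exact: PB.
Qed.

(** y is the limit of the orbit of x along some U, whose operator turns the approximations at x into
    approximations at y. *)
Lemma minimal_calW x y :
  omega s x @` [set f : X -> C | continuous f] `<=` @calW R ->
  omega s y @` [set f : X -> C | continuous f] `<=` @calW R.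
Proof.
move=> xW _ [f fc <-]; apply/calWP => e e0.
have /calWP/(_ e e0)[L xL] : calW (omega s x f) by apply: xW; exists f.
have [U [UU xy]] := minimal_orbit x y.
exists (mapL (@uop R U UU) L); exact: (act_uop UU xy fc xL).
Qed.

End Minimal.

(** * The space H *)

Lemma principal_ultra (T : Type) (t : T) : UltraFilter [set B : set T | B t].
Proof.
split=> [|G GP sFG].
  split; first by [].
  by split=> [||B B' BB' /BB'].
apply/seteqP; split=> [B GB|]; last exact: sFG.
apply: contrapT => nBt; have GnB : G (~` B) by exact: sFG.
by have [x []] := @filter_ex _ G GP _ (filterI GB GnB).
Qed.

Section CalH.
Variable R : realType.
Notation C := (Cplx R).
Notation A := (acirc R).
Notation phase := (phase R).
Notation D := (@D R).
Notation pshift := (@pshift R).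
Notation calH := (@calH R).

Lemma expgzE (x : A) (n : int) : expgz x n = x *~ n.
Proof. by apply: cval_inj; rewrite cval_expgz. Qed.

Lemma expgE (x : A) n : (x ^+ n)%g = x *+ n.
Proof. by apply: cval_inj; rewrite cvalX. Qed.

Lemma TQ_torsion (x : A) : TQ x <-> torsion x.
Proof.
split=> [[q _ <-]|[N N0 xN]].
  exists `|denq q|%N; first by rewrite absz_gt0 denq_neq0.
  rewrite -[expi _]/(aexp _) -aexpMn.
  rewrite (_ : _ *+ _ = (numq q)%:~R) ?aexp_int //.
  rewrite -mulr_natr -[_%:R]/(`|denq q|%N%:~R) absz_denq -ratr_int -rmorphM.
  by rewrite -numqE; exact: ratr_int.
have [j ->] := torsion_aexp N0 xN; exists (j%:R / N%:R) => //.
rewrite -aexpMn -[expi _]/(aexp _); congr aexp.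
by rewrite rmorphM fmorphV !rmorph_nat mulrC mulr_natr.
Qed.

Lemma falling_nat k (n : nat) : (falling k).[n%:Z] = ('C(n, k) * k`!)%N%:Z.
Proof.
rewrite bin_ffact /falling horner_prod.
elim: k => [|k IH]; first by rewrite big_ord0.
rewrite big_ord_recr /= IH hornerXsubC ffactnSr PoszM.
have [kn|nk] := leqP k n; first by rewrite subzn.
by rewrite ffact_small // !mul0r.
Qed.

(** On multiples of x, the j-th iterate of f is multiplication by n^j, so the sum is x times
    [falling k] at n; the coefficient for j = 0 vanishes as k > 0. *)
Lemma stirling_sum (f : A -> A) (x : A) k (n : nat) : (0 < k)%N ->
  (forall c : int, f (x *~ c) = x *~ c *+ n) ->
  \sum_(1 <= j < k.+1) iter j f (x *~ stirling1 k j) = x *+ ('C(n, k) * k`!)%N.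
Proof.
move=> k0 fx.
have it j c : iter j f (x *~ c) = x *~ (c * n%:Z ^+ j).
  elim: j => [|j IH] /=; first by rewrite mulr1.
  by rewrite IH fx -[_ *+ n]/(_ *~ n%:Z) -mulrzA exprSr mulrA.
rewrite (eq_bigr (fun j => x *~ (stirling1 k j * n%:Z ^+ j))) //.
rewrite -[x *+ _]/(x *~ ('C(n, k) * k`!)%N%:Z) -falling_nat.
have sz : size (falling k) = k.+1.
  by rewrite size_prod_XsubC /index_enum -enumT size_enum_ord.
rewrite horner_coef sz -(big_mkord xpredT (fun j => (falling k)`_j * n%:Z ^+ j)).
rewrite [X in _ = x *~ X]big_ltn //= (_ : (falling k)`_0 = 0); last first.
  by case: k k0 {sz it} => // k _; rewrite /falling big_ord_recl /= subr0 coefXM.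
by rewrite mul0r add0r (big_morph _ (mulrzDr x) (mulr0z x)).
Qed.

Definition Hpt (G : phase -> phase) (k : nat) (x : A) : A := G (beta k x) 0.

Lemma beta_torsion k (x : A) N : (0 < k)%N -> x *+ N = 0 -> D (beta k x) *+ N = 0.
Proof. by case: k => // k _ xN; rewrite D_beta -raddfMn xN raddf0. Qed.

Lemma iterD_leq d e (u : phase) : (d <= e)%N -> iter d D u = 0 -> iter e D u = 0.
Proof. by move=> /subnK <- ud; rewrite iterD ud raddf0. Qed.

(** On torsion, G is a power n of the shift, so the j-th coordinate is multiplication by C(n, j)
    with one n for all positive j <= k; the relation becomes [stirling_sum]. *)
Lemma good_calH (G : {additive phase -> phase}) : good G -> calH (Hpt G).
Proof.
move=> [_ Gc Gt]; split.
- by move=> k x y; rewrite /Hpt -[(x * y)%g]/((x : A) + (y : A)) !raddfD.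
- by apply/funext => x; rewrite /Hpt beta0 Gc.
move=> x' k xQ k0; have [x xx'] : exists x : A, x = x' by exists x'.
move: xQ; rewrite -xx' => /TQ_torsion[N N0 xN] {x' xx'}.
have [n nG] := Gt N k.+1 N0.
have GE j (y : A) : (0 < j)%N -> (j <= k)%N -> y *+ N = 0 ->
    Hpt G j y = y *+ 'C(n, j).
  move=> j0 jk yN; rewrite /Hpt nG.
  - by rewrite iter_shiftE add0r.
  - by apply: (@iterD_leq j.+1) => //; exact: iterD_beta0.
  - exact: beta_torsion.
have xcN (c : int) : x *~ c *+ N = 0.
  by rewrite -[_ *+ N]/(_ *~ N%:Z) mulrzAC -[x *~ N%:Z]/(x *+ N) xN mul0rz.
rewrite expgE GE //; last exact: (xcN k`!).
rewrite -mulrnA mulnC -(@stirling_sum (Hpt G 1)) // => c.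
by rewrite GE ?bin1.
Qed.

Section Operator.
Variable phi : nat -> A -> A.
Hypothesis phiH : calH phi.

Lemma phi_is_additive k : {morph phi k : x y / x - y}.
Proof.
have [/(_ k) ph _ _] := phiH.
have phD (x y : A) : phi k (x + y) = phi k x + phi k y by exact: ph.
have ph0 : phi k 0 = 0 by apply: (addrI (phi k 0)); rewrite -phD !addr0.
move=> x y; rewrite phD; congr (_ + _); apply: (addrI (phi k y)).
by rewrite -phD !subrr.
Qed.

Definition phi_add k : {additive A -> A} :=
  HB.pack (phi k) (GRing.isZmodMorphism.Build A A _ (phi_is_additive k)).

(** Newton's formula for a power of the shift, with the binomial coefficient C(n, k) replaced by the
    endomorphism [phi k]. *)
Definition phi_part d (u : phase) : phase :=
  \sum_(k < d) hcomp (phi_add k) (iter k D u).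

Definition phi_op (u : phase) : phase :=
  phi_part (xget 0%N [set d | iter d D u = 0]) u.

Lemma phi_partD d e u : iter d D u = 0 -> phi_part (d + e) u = phi_part d u.
Proof.
move=> ud; elim: e => [|e IH]; first by rewrite addn0.
rewrite addnS /phi_part big_ord_recr /= -/(phi_part _ _) IH.
by rewrite (iterD_leq (leq_addr e d) ud) raddf0 addr0.
Qed.

Lemma phi_opE d u : iter d D u = 0 -> phi_op u = phi_part d u.
Proof.
move=> ud; rewrite /phi_op; set e := xget _ _.
have ue : iter e D u = 0.
  by apply: (@xgetPex _ 0%N [set d | iter d D u = 0]); exists d.
by rewrite -(phi_partD d ue) addnC phi_partD.
Qed.

Lemma phi_op_is_additive : {morph phi_op : u v / u - v}.
Proof.
move=> u v; have [d ud] := iterD_nil u; have [e ve] := iterD_nil v.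
have ud' := iterD_leq (leq_addr e d) ud; have ve' := iterD_leq (leq_addl d e) ve.
have uv : iter (d + e) D (u - v) = 0 by rewrite raddfB /= ud' ve' subrr.
rewrite (phi_opE ud') (phi_opE ve') (phi_opE uv).
by rewrite /phi_part -sumrB; apply: eq_bigr => k _; rewrite !raddfB.
Qed.

Definition phi_map : {additive phase -> phase} :=
  HB.pack phi_op (GRing.isZmodMorphism.Build phase phase _ phi_op_is_additive).

Lemma Hpt_phi : Hpt phi_map = phi.
Proof.
apply/funext => k; apply/funext => x.
rewrite /Hpt /phi_map /= (phi_opE (iterD_beta0 k x)) phase_sum big_ord_recr /=.
rewrite big1 ?add0r => [|j _]; first by rewrite hcompE iterD_beta_cst.
rewrite hcompE -[in beta _ _](subnK (ltnW (ltn_ord j))) iterD_beta beta_at0 ?subn_gt0 //.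
exact: raddf0.
Qed.

(** The relation defining [calH] is used here: phi 1 is multiplication by some n on M-torsion, and
    the relation, applied to an M-torsion x whose k!-th multiple is y, gives phi k y = C(n, k) y. *)
Lemma phi_torsion (N d : nat) : (0 < N)%N -> exists n : nat, forall k (y : A),
  (k < d)%N -> y *+ N = 0 -> phi k y = y *+ 'C(n, k).
Proof.
move=> N0; have [_ phi0 phiT] := phiH.
(* For k < d, dividing an N-torsion element by k! gives an M-torsion one. *)
pose M := (N * d`!)%N; have M0 : (0 < M)%N by rewrite muln_gt0 N0 fact_gt0.
pose w : A := aexp (M%:R^-1).
have w0 : w *+ M = 0.
  by rewrite -aexpMn -[_ *+ M]mulr_natr mulVf ?pnatr_eq0 -?lt0n // aexp1.
have phiMn k (x : A) m : phi k (x *+ m) = phi k x *+ m by exact: (raddfMn (phi_add k)).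
have [|n nE] := @torsion_aexp R (phi 1 w) M M0.
  by rewrite -phiMn w0; exact: (raddf0 (phi_add 1)).
have phi1 (y : A) : y *+ M = 0 -> phi 1 y = y *+ n.
  by move=> /(torsion_aexp M0)[j ->]; rewrite phiMn nE mulrnAC.
exists n => -[|k] y kd yN; first by rewrite phi0 bin0.
have [x xy] := @aexp_root R y k.+1`! (fact_gt0 _).
have xM : x *+ M = 0.
  have -> : M = (k.+1`! * N * (d`! %/ k.+1`!))%N.
    by rewrite /M -{1}(divnK (dvdn_fact2 (ltnW kd))); ring.
  by rewrite 2!mulrnA xy yN mul0rn.
have xQ : TQ x by apply/TQ_torsion; exists M.
rewrite -xy -expgE phiT //.
transitivity (\sum_(1 <= j < k.+2) iter j (phi 1) (x *~ stirling1 k.+1 j)).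
  by apply: eq_bigr => j _; rewrite -expgzE.
rewrite (@stirling_sum _ _ _ n) // => [|c]; first by rewrite mulnC mulrnA.
rewrite phi1 // -[_ *+ M]/(_ *~ M%:Z) mulrzAC -[x *~ M%:Z]/(x *+ M) xM.
exact: mul0rz.
Qed.

Lemma good_phi_map : good phi_map.
Proof.
split=> [u|x|N d N0].
- have [d ud] := iterD_nil u.
  rewrite /phi_map /= (phi_opE ud) (@phi_opE d) ?iterD_shift ?ud ?raddf0 //.
  rewrite /phi_part raddf_sum; apply: eq_bigr => k _.
  by rewrite iterD_shift /= shift_hcomp.
- rewrite /phi_map /= (phi_opE (iterD_cst 0 x)) /phi_part big_ord1 /= hcomp_cst.
  by have [_ phi0 _] := phiH; congr pcst; rewrite /phi_add /= phi0.
have [n nP] := phi_torsion d N0; exists n => u ud uN.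
rewrite /phi_map /= (phi_opE ud) (newton _ ud); apply: eq_bigr => k _.
apply: phase_ext => m; rewrite hcompE phaseMn; case: k => [[|k] kd] /=.
  by have [_ phi0 _] := phiH; rewrite /phi_add /= phi0 bin0.
apply: nP => //; rewrite -phaseMn -iterS iterSr -raddfMn uN raddf0 //.
Qed.

End Operator.

Definition ulimH (U : set_system int) (UU : UltraFilter U) : calH :=
  exist _ (Hpt (@uop R U UU)) (mem_set (good_calH (@good_uop R U UU))).

(** The point with coordinates x |-> C(n, k) x, the n-th iterate under T of the point with
    coordinates id, 0, 0, ... in additive notation. *)
Definition iterH (n : int) : calH := ulimH (principal_ultra n).

Definition coordH (phi : calH) (k : nat) (x : A) : A := set_val phi k x.

Lemma coord_iterH n k (x : A) : coordH (iterH n) k x = beta k x n.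
Proof.
have UU := principal_ultra n; rewrite /coordH [LHS]uop_at0; apply: ulim_eq => B.
exact: nbhs_singleton.
Qed.

Lemma coord_ulimH U (UU : UltraFilter U) k (x : A) :
  coordH (ulimH UU) k x = ulim U (beta k x).
Proof. exact: uop_at0. Qed.

Lemma cvg_calH (T : Type) (F : set_system T) (f : T -> calH) (phi : calH) :
  Filter F ->
  (forall k (x : A), (fun t => coordH (f t) k x) @ F --> coordH phi k x)
    <-> f @ F --> phi.
Proof.
move=> FF; rewrite -cvg_set_val -cvg_ptws; split=> h k; last first.
  by move/cvg_ptws : (h k).
by apply/cvg_ptws; exact: h.
Qed.

Lemma iterH_ulimH U (UU : UltraFilter U) : iterH @ U --> ulimH UU.
Proof.
apply/cvg_calH => k x; rewrite coord_ulimH.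
rewrite (_ : (fun t => _) = beta k x); first exact: ulimP.
by apply/funext => n; rewrite coord_iterH.
Qed.

Lemma ulimH_eq U V (UU : UltraFilter U) (UV : UltraFilter V) :
  @agree R U V <-> ulimH UU = ulimH UV.
Proof.
rewrite agreeP; split=> [h|h u].
  by apply: val_inj; apply/funext => k; apply/funext => x; exact: h.
have [d ud] := iterD_nil u; rewrite (phase_beta ud) !raddf_sum !phase_sum.
apply: eq_bigr => k _; set x := iter k D u 0.
exact: (congr1 (fun phi : calH => coordH phi k x) h).
Qed.

(** [phi_map] is good and has the coordinates phi, so it comes from an ultrafilter. *)
Lemma iterH_dense (phi : calH) : exists U : set_system int,
  exists UU : UltraFilter U, ulimH UU = phi.
Proof.
have phiH : calH (set_val phi) by exact: set_valP.
have [U [UU UG]] := good_is_uop (good_phi_map phiH).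
exists U, UU; apply: val_inj; rewrite -[RHS](Hpt_phi phiH).
by apply/funext => k; apply/funext => x; rewrite /Hpt UG.
Qed.

Lemma Tmap_iterH n : Tmap (iterH n) = iterH (n + 1).
Proof.
apply: val_inj; apply/funext => k; apply/funext => x.
rewrite -[RHS]/(coordH (iterH (n + 1)) k x) coord_iterH.
case: k => [|k].
  rewrite -[LHS]/(coordH (iterH n) 0%N x) coord_iterH !betaE !binz0 //.
rewrite -[LHS]/(coordH (iterH n) k x + coordH (iterH n) k.+1 x) !coord_iterH.
by rewrite !betaE binzS mulrzDr addrC.
Qed.

Section Factor.
Variables (X : topologicalType) (s : homeo X).
Hypotheses (X_compact : compact [set: X]) (X_hausdorff : hausdorff_space X).

Lemma factor_calW : is_factor (@Tmap R) s -> exists x : X,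
  omega s x @` [set f : X -> C | continuous f] `<=` @calW R.
Proof.
move=> [p [pc _ pT]]; exists (p (iterH 0)); apply: Wpoint_calW => //.
have pE n : p (iterH n) = iterz s n (p (iterH 0)).
  elim/int_rec: n => [//|n IH|n IH].
    by rewrite -addn1 PoszD -Tmap_iterH pT IH iterzS1.
  apply: (can_inj (hfunK s)); rewrite -pT Tmap_iterH -iterzS1.
  by have -> : - n.+1%:Z + 1 = - n%:Z by lia.
have lim (U : set_system int) (UU : UltraFilter U) :
    (fun n => iterz s n (p (iterH 0))) @ U --> p (ulimH UU).
  have <- : (fun n => p (iterH n)) = (fun n => iterz s n (p (iterH 0))).
    by apply/funext => n; rewrite pE.
  exact: (fun P pP => @iterH_ulimH U UU _ (pc (ulimH UU) P pP)).
move=> U V UU UV /(@ulimH_eq U V UU UV) UVE y yU.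
have -> : y = p (ulimH UU).
  by apply: (cvg_unique X_hausdorff yU); exact: lim.
by rewrite UVE; exact: lim.
Qed.

Lemma calW_factor x : minimal s ->
  omega s x @` [set f : X -> C | continuous f] `<=` @calW R ->
  is_factor (@Tmap R) s.
Proof.
move=> sm /(calW_Wpoint X_compact X_hausdorff) Wx.
have limU U (UU : UltraFilter U) phi : iterH @ U --> phi -> phi = ulimH UU.
  move=> Uphi; apply: val_inj; apply/funext => k; apply/funext => z.
  move/cvg_calH : Uphi => /(_ k z) Uphi.
  rewrite -[RHS]/(coordH (ulimH UU) k z) coord_ulimH; apply/esym/ulim_eq.
  move: Uphi; rewrite (_ : (fun t => _) = beta k z) //.
  by apply/funext => n; rewrite coord_iterH.
have [||y|U V UU UV phi /(limU U UU) -> /(limU V UV)/(ulimH_eq UU UV) UV2 y|p [pc pP]] :=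
  @dense_extension int calH X iterH (fun n => iterz s n x) => //.
- apply/closure_ultra; have [U [UU <-]] := iterH_dense y.
  by exists U; split => //; exact: iterH_ulimH.
- exact: Wx.
exists p; split => //.
  apply/seteqP; split => // y _; have [U [UU xy]] := minimal_orbit sm x y.
  exists (ulimH UU) => //; have := pP U UU _ (@iterH_ulimH U UU).
  by move=> xp; exact: (cvg_unique X_hausdorff xp xy).
move=> phi; have [U [UU <-]] := iterH_dense phi.
have xU := pP U UU _ (@iterH_ulimH U UU).
(* Along the translated ultrafilter the coordinates obey Pascal's rule, which is the formula of
   T. *)
pose V := (fun n : int => n + 1) @ U.
have UV : UltraFilter V by exact: ultra_fmap.
have VT : Tmap (ulimH UU) = ulimH UV.
  apply: val_inj; apply/funext => k; apply/funext => z.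
  rewrite -[RHS]/(coordH (ulimH UV) k z) coord_ulimH; apply/esym/ulim_eq.
  have Uk j : beta j z @ U --> coordH (ulimH UU) j z.
    by rewrite coord_ulimH; exact: ulimP.
  rewrite (_ : beta k z @ V = (fun n => beta k z (n + 1)) @ U) //.
  case: k => [|k].
    rewrite (_ : (fun n => _) = beta 0 z); first exact: Uk.
    by apply/funext => n; rewrite !betaE !binz0.
  rewrite (_ : (fun n => _) = (fun n => beta k z n + beta k.+1 z n)).
    by apply: cvgAD; exact: Uk.
  by apply/funext => n; rewrite !betaE binzS mulrzDr addrC.
have xV := pP V UV _ (@iterH_ulimH V UV).
rewrite VT; apply: (cvg_unique X_hausdorff xV).
rewrite (_ : _ @ V = (fun n => s (iterz s n x)) @ U).
  exact: (fun P sP => xU _ (@hfun_continuous _ s (p (ulimH UU)) P sP)).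
by rewrite /V -fmap_comp; congr (_ @ U); apply/funext => n; rewrite /= iterzS1.
Qed.

End Factor.

End CalH.

(** * Distal systems *)

Section Ellis.
Variable X : topologicalType.
Hypotheses (X_compact : compact [set: X]) (X_hausdorff : hausdorff_space X).
Implicit Types (S M N : set (X -> X)) (U : set_system (X -> X)) (e b : X -> X).

Definition pt_limit U b := forall x, (fun a : X -> X => a x) @ U --> b x.

Definition pt_closed M := forall U, UltraFilter U -> U M ->
  forall b, pt_limit U b -> M b.

Lemma pt_limit_exists U : UltraFilter U -> exists b, pt_limit U b.
Proof.
move=> UU; have /choice[b bP] x := ultra_compact (fun a : X -> X => a x) UU X_compact.
by exists b.
Qed.

(** An ultrafilter on the translate is lifted to [M] by choosing preimages; the lift has a limit d
    by compactness, and [d \o e] is the given limit. *)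
Lemma pt_closed_translate M e : pt_closed M -> pt_closed [set m \o e | m in M].
Proof.
move=> cM U UU UN b Ub; set N := [set _ | _ in _] in UN *.
have /choice[g gP] : forall c, exists m, N c -> M m /\ m \o e = c.
  move=> c; have [[m Mm <-]|nN] := pselect (N c); first by exists m.
  by exists id => /nN.
have UV := @ultra_fmap _ _ g U UU.
have [d Vd] := pt_limit_exists UV.
exists d; first by apply: (cM _ UV _ _ Vd); apply: (@filterS _ U _ _ _ _ UN) => c /gP[].
apply/funext => x /=.
have db : (fun c : X -> X => c x) @ U --> d (e x).
  move=> B /(Vd (e x)) UB.
  apply: (@filterS _ U _ _ _ _ (@filterI _ U _ _ _ (UB : U _) UN)) => c [gB /gP[_ gc]].
  by rewrite /= -gc.
exact: (cvg_unique X_hausdorff db (Ub x)).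
Qed.

(** Let M be a minimal closed subsemigroup and e in M. The translate of M by e is a closed
    subsemigroup of M, hence is M, so some m satisfies [m \o e = e]. Such m form a closed
    subsemigroup, which is again M and contains e. *)
Lemma ellis_numakura S : S !=set0 -> pt_closed S ->
  (forall a b, S a -> S b -> S (a \o b)) -> exists2 e, S e & e \o e = e.
Proof.
move=> S0 cS SS.
(* Zorn's lemma is applied to unions, so the minimal subsemigroup is obtained as the complement in S
   of a maximal B. *)
pose P (B : set (X -> X)) := [/\ S `\` B !=set0, pt_closed (S `\` B) &
  forall a b, (S `\` B) a -> (S `\` B) b -> (S `\` B) (a \o b)].
have [|B [[[e Me] cM MM] Bmax]] := @Zorn_bigcup _ P.
  move=> F FP Ftot; split.
  - have [[B0 FB0]|F0] := pselect (F !=set0); last first.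
      have [a Sa] := S0; exists a; split => // -[B FB _].
      by apply: F0; exists B.
    have [||U [UU US]] := @ultra_directed _ {B | F B} (fun B => S `\` sval B)
        (exist _ B0 FB0).
    + move=> [B FB] [B' FB']; have [BB'|B'B] := Ftot B B' FB FB'.
        by exists (exist _ B' FB') => a /= [Sa B'a]; split; split => // /BB'.
      by exists (exist _ B FB) => a /= [Sa Ba]; split; split => // /B'B.
    + by move=> [B FB] /=; have [] := FP B FB.
    have [b Ub] := pt_limit_exists UU; exists b.
    have bB B : F B -> (S `\` B) b.
      move=> FB; have [_ cB _] := FP B FB.
      exact: cB UU (US (exist _ B FB)) _ Ub.
    by split=> [|[B FB Bb]]; [have [] := bB _ FB0 | have [] := bB _ FB].
  - move=> U UU UB b Ub; split.
      by apply: (cS U UU _ b Ub); apply: filterS UB => a [].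
    move=> [B FB Bb]; have [_ cB _] := FP B FB.
    have [] // := cB U UU _ b Ub; apply: filterS UB => a [Sa nB]; split => // Ba.
    by apply: nB; exists B.
  - move=> a b [Sa nBa] [Sb nBb]; split; first exact: SS.
    move=> [B FB Bab]; have [_ _ hB] := FP B FB.
    have [] // := hB a b; split => // h; [apply: nBa | apply: nBb]; by exists B.
set M := S `\` B in cM MM.
have Mmin N : N `<=` M -> N !=set0 -> pt_closed N ->
    (forall a b, N a -> N b -> N (a \o b)) -> M `<=` N.
  move=> NM N0 cN NN m Mm; apply: contrapT => nNm.
  have SN : S `\` ~` N = N.
    by apply/seteqP; split=> [a [_ /contrapT]|a Na] //; split; [have [] := NM a Na | apply].
  apply: (Bmax (~` N)); last by rewrite /P SN.
  split=> [a Ba Na|h]; first by have [_] := NM a Na.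
  by have [_] := Mm; apply; exact: h.
have Ne : M `<=` [set m \o e | m in M].
  apply: Mmin => [_ [m Mm <-]||| _ _ [a Ma <-] [b Mb <-]]; first exact: MM.
  - by exists (e \o e), e.
  - exact: pt_closed_translate.
  - by exists (a \o e \o b) => //; apply: (MM) => //; exact: MM.
have [m Mm me] := Ne e Me.
have Nid : M `<=` [set m | M m /\ m \o e = e].
  apply: Mmin => [a []||U UU UN b Ub|a b [Ma ae] [Mb be]] //; first by exists m.
  - split; first by apply: (cM U UU _ b Ub); apply: filterS UN => a [].
    apply/funext => x; apply: (cvg_unique X_hausdorff (Ub (e x))) => B' B'e.
    apply: (@filterS _ U _ _ _ _ UN) => a [_ ae] /=.
    by rewrite -[a (e x)]/((a \o e) x) ae; exact: nbhs_singleton.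
  - by split; [exact: MM | rewrite -compA be ae].
by have [Se _] := Me; exists e => //; have [] := Nid e Me.
Qed.

End Ellis.

Section Distal.
Variables (X : topologicalType) (s : homeo X).
Hypotheses (X_compact : compact [set: X]) (X_hausdorff : hausdorff_space X).

Lemma env_closed : pt_closed (env_semigroup s).
Proof.
move=> U UU UE b Ub.
apply: (@closed_closure {ptws X -> X} (range (iterz s))) => B Bb.
have /(_ B Bb) UB : (id : _ -> {ptws X -> X}) @ U --> (b : {ptws X -> X}).
  by apply/cvg_ptws.
have [a [Ea Ba]] := @filter_ex _ U _ _ (@filterI _ U _ _ _ UE UB).
by exists a.
Qed.

Lemma env_comp a b : env_semigroup s a -> env_semigroup s b ->
  env_semigroup s (a \o b).
Proof.
move=> /env_ultra[V [VV Va]] /env_ultra[U [UU Ub]].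
have Enb n : env_semigroup s (iterz s n \o b).
  apply/env_ultra; exists ((fun m => n + m) @ U); split; first exact: ultra_fmap.
  move=> x; rewrite (_ : _ @ _ = (fun m => iterz s n (iterz s m x)) @ U).
    exact: (fun B Bb => Ub x _ (@iterz_continuous X s n (b x) B Bb)).
  by rewrite -fmap_comp; congr (_ @ U); apply/funext => m; rewrite /= iterzD.
have WU := @ultra_fmap _ _ (fun n => iterz s n \o b) V VV.
apply: (env_closed WU) => [|x]; last exact: Va.
by apply: (@filterS _ V _ setT) => [n _|]; [exact: Enb | exact: filterT].
Qed.

(** The left ideal generated by a contains an idempotent [b \o a]; it is injective by distality, and
    an injective idempotent is the identity. *)
Lemma distal_inverse a : distal s -> env_semigroup s a ->
  exists2 b, env_semigroup s b & b \o a = id.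
Proof.
move=> ds Ea.
have [|||e [b Eb <-] ee] := @ellis_numakura X X_compact X_hausdorff
    [set b \o a | b in env_semigroup s].
- by exists (a \o a), a.
- exact: (pt_closed_translate X_compact X_hausdorff env_closed).
- move=> _ _ [b Eb <-] [c Ec <-]; exists (b \o a \o c) => //.
  by apply: env_comp => //; exact: env_comp.
exists b => //; apply/funext => x; apply: (ds (b \o a)); first exact: env_comp.
exact: (congr1 (fun f => f x) ee).
Qed.

Definition orbit_closure x := closure (range (fun n => iterz s n x)).

Lemma orbit_closureP x y : orbit_closure x y <-> exists2 a, env_semigroup s a & a x = y.
Proof.
split=> [/closure_ultra[U [UU Uy]]|[a /env_ultra[U [UU Ua]] <-]]; last first.
  by apply/closure_ultra; exists U.
have /choice[a aP] z := ultra_compact (fun n => iterz s n z) UU X_compact.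
exists a; first by apply/env_ultra; exists U.
exact: (cvg_unique X_hausdorff (aP x) Uy).
Qed.

Lemma orbit_closure_iter x y n : orbit_closure x y -> orbit_closure x (iterz s n y).
Proof.
move=> xy B /(@iterz_continuous X s n y)/xy[_ [[m _ <-] Bm]].
by exists (iterz s (n + m) x); rewrite iterzD; split => //; exists (n + m); rewrite ?iterzD.
Qed.

Lemma orbit_closure_trans x y z :
  orbit_closure x y -> orbit_closure y z -> orbit_closure x z.
Proof.
move=> xy yz; apply: (@closed_closure _ (range (fun n => iterz s n x))) => B /yz.
move=> [_ [[n _ <-] Bn]]; exists (iterz s n y); split => //.
exact: orbit_closure_iter.
Qed.

Lemma orbit_closure_sym x y : distal s -> orbit_closure x y -> orbit_closure y x.
Proof.
move=> ds /orbit_closureP[a Ea <-]; have [b Eb ba] := distal_inverse ds Ea.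
by apply/orbit_closureP; exists b => //; exact: (congr1 (fun f => f x) ba).
Qed.

Lemma orbit_closure_subsystem x : is_subsystem s (orbit_closure x).
Proof.
split; [by exists x; apply: subset_closure; exists 0 | exact: closed_closure |].
apply/seteqP; split=> [_ [y xy <-]|y xy]; first exact: (@orbit_closure_iter x y (Posz 1) xy).
exists (iterz s (-1) y); first exact: orbit_closure_iter.
by rewrite -iterzS1.
Qed.

Section Subsystem.
Variables (Y : set X) (hY : is_subsystem s Y).

Lemma val_iterz n (y : Y) :
  set_val (iterz (subsystem_map hY) n y) = iterz s n (set_val y).
Proof.
have it (f : Y -> Y) (g : X -> X) k (z : Y) :
    (forall w, set_val (f w) = g (set_val w)) ->
    set_val (iter k f z) = iter k g (set_val z).
  by move=> fg; elim: k => //= k <-.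
by case: n => n; apply: it => w; rewrite /subsystem_map; case: hY.
Qed.

Lemma subsystem_compact : compact [set: Y].
Proof.
rewrite compact_ultra => U UU _.
have [x Ux] := ultra_compact (fun y : Y => set_val y) UU X_compact.
have Yx : Y x.
  have [_ cY _] := hY; apply: cY => B /Ux UB.
  by have [y By] := @filter_ex _ U _ _ UB; exists (set_val y); split => //; exact: set_valP.
exists (exist _ x (mem_set Yx)); split => //.
by apply/(@cvg_set_val _ X Y U id (exist _ x (mem_set Yx))).
Qed.

Lemma subsystem_hausdorff : hausdorff_space Y.
Proof.
move=> y z yz; apply: val_inj; apply: X_hausdorff => B B' By Bz.
have cv (w : Y) : {for w, continuous (set_val : Y -> X)} by exact: initial_continuous.
by have [w [? ?]] := yz _ _ (cv y _ By) (cv z _ Bz); exists (set_val w).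
Qed.

End Subsystem.

Lemma orbit_closure_minimal x : distal s ->
  minimal (subsystem_map (orbit_closure_subsystem x)).
Proof.
move=> ds; have [[x0 xx0] _ _] := orbit_closure_subsystem x.
split=> [|y B [z Bz] [P oP PB]]; first by exists (exist _ x0 (mem_set xx0)).
have yz : orbit_closure (set_val y) (set_val z).
  apply: (orbit_closure_trans (y := x)); last exact: set_valP.
  by apply: orbit_closure_sym => //; exact: set_valP.
have [|_ [[n _ <-] Pn]] := yz P.
  by apply: open_nbhs_nbhs; split => //; move: Bz; rewrite -PB.
exists (iterz (subsystem_map (orbit_closure_subsystem x)) n y); split; last by exists n.
by rewrite -PB /= val_iterz.
Qed.

End Distal.

Section Subsystems.
Variables (R : realType) (X : topologicalType) (s : homeo X).
Hypotheses (X_compact : compact [set: X]) (X_hausdorff : hausdorff_space X).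
Notation C := (Cplx R).

(** Through [Wpoint] the claim concerns orbits alone, so continuous functions on Y are not extended
    to X. *)
Lemma calW_subsystem (Y : set X) (hY : is_subsystem s Y) :
  (forall x : X, omega s x @` [set f : X -> C | continuous f] `<=` @calW R) ->
  forall y : Y,
    omega (subsystem_map hY) y @` [set f : Y -> C | continuous f] `<=` @calW R.
Proof.
move=> W4 y; apply: Wpoint_calW; first exact: (subsystem_compact X_compact hY).
have Wy := calW_Wpoint X_compact X_hausdorff (W4 (set_val y)).
move=> U V UU UV UVa z /cvg_set_val yz; apply/cvg_set_val.
have vE : (fun n => set_val (iterz (subsystem_map hY) n y)) =
    (fun n => iterz s n (set_val y)) by apply/funext => n; exact: val_iterz.
by move: yz; rewrite vE; exact: Wy.
Qed.

Lemma distal_calW : distal s ->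
  (forall (Y : set X) (hY : is_subsystem s Y),
     minimal (subsystem_map hY) -> W_system R (subsystem_map hY)) ->
  forall x : X, omega s x @` [set f : X -> C | continuous f] `<=` @calW R.
Proof.
move=> ds WY x _ [f fc <-].
set hY := orbit_closure_subsystem s x.
have xx : orbit_closure s x x by apply: subset_closure; exists 0.
pose y : orbit_closure s x := exist _ x (mem_set xx).
have fy : continuous (f \o (set_val : orbit_closure s x -> X)).
  move=> z; apply: continuous_comp; last exact: fc.
  exact: initial_continuous.
have WYx := WY _ hY (orbit_closure_minimal X_compact X_hausdorff x ds).
have := @W_system_calW R _ (subsystem_map hY) y WYx; apply.
exists (f \o set_val) => //; apply/funext => n.
by rewrite /omega /= val_iterz.
Qed.

End Subsystems.

Theorem proposition5p11 (R : realType) (X : topologicalType) (s : homeo X)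
    (X_compact : compact [set: X]) (X_hausdorff : hausdorff_space X) :
  (minimal s ->
     [<-> W_system R s;
          is_factor (@Tmap R) s;
          exists x : X,
            omega s x @` [set f : X -> Cplx R | continuous f] `<=` @calW R;
          forall x : X,
            omega s x @` [set f : X -> Cplx R | continuous f] `<=` @calW R])
  /\
  [<-> W_system R s;
       forall x : X,
         omega s x @` [set f : X -> Cplx R | continuous f] `<=` @calW R;
       distal s /\
         forall (Y : set X) (hY : is_subsystem s Y),
           minimal (subsystem_map hY) -> W_system R (subsystem_map hY)].
Proof.
have W4 := calW_W_system X_compact X_hausdorff.
split=> [sm|]; tfae.
- move=> Ws; have [[x _] _] := sm.
  exact: (calW_factor X_compact X_hausdorff (x := x) sm (W_system_calW Ws)).
- exact: factor_calW.
- by move=> [x xW] y; exact: minimal_calW xW.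
- exact: W4.
- by move=> Ws x; exact: W_system_calW.
- move=> XW; split=> [|Y hY _]; first exact: (W4_distal X_compact X_hausdorff XW).
  apply: calW_W_system.
  + exact: (subsystem_compact X_compact hY).
  + exact: subsystem_hausdorff.
  + exact: calW_subsystem.
- by move=> [ds WY]; apply: W4; exact: distal_calW.
Qed.
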